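(* Let $K$ be a number field, $\mathfrak{o}$ its ring of integers and let $d\geq 2$ be an integer. The density of the set $\widetilde{\Gamma}^d\subseteq\mathfrak{o}^{d+1}$ of shifted Eisenstein polynomials of degree $d$ over $\mathfrak{o}$ exists, is independent of the integral basis, and is given by $$\rho(\widetilde{\Gamma}^d)=1-\prod_{\mathfrak{p}\in\mathcal{P}_K}\left(1-\frac{(N(\mathfrak{p})-1)^2}{N(\mathfrak{p})^{d+1}}\right),$$ where $N(\mathfrak{p})=|\mathfrak{o}/\mathfrak{p}|$.
   Context: $\mathcal{P}_K$ is the set of non-zero prime ideals of $\mathfrak{o}$. A polynomial $a_0+a_1x+\dots+a_dx^d\in\mathfrak{o}[x]$ is identified with the tuple $(a_0,\dots,a_d)\in\mathfrak{o}^{d+1}$. For $\mathfrak{p}\in\mathcal{P}_K$ it is called $\mathfrak{p}$-Eisenstein if $a_d\notin\mathfrak{p}$, $a_i\in\mathfrak{p}$ for all $i\in\{0,\dots,d-1\}$, and $a_0\notin\mathfrak{p}^2$. A polynomial $f\in\mathfrak{o}[x]$ of degree $d$ is called a shifted $\mathfrak{p}$-Eisenstein polynomial if there exists $b\in\mathfrak{o}$ such that $f(x+b)$ is $\mathfrak{p}$-Eisenstein, and a shifted Eisenstein polynomial if it is shifted $\mathfrak{p}$-Eisenstein for some $\mathfrak{p}\in\mathcal{P}_K$. $\widetilde{\Gamma}^d$ is the set of all shifted Eisenstein polynomials of degree $d$. The infinite product is the limit of its finite partial products (all factors lie in $(0,1)$); the value $0$ is allowed. Density: let $k=[K:\mathbb{Q}]$.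 For an integral basis $\mathbb{E}=\{e_1,\dots,e_k\}$ of $\mathfrak{o}$ and a positive integer $H$ put $O(H,\mathbb{E})=\{\sum_{j=1}^k a_je_j : a_j\in[-H,H)\cap\mathbb{Z}\}$. For $T\subseteq\mathfrak{o}^{m}$ put $\rho_\mathbb{E}(T)=\lim_{H\to\infty}\frac{|T\cap O(H,\mathbb{E})^{m}|}{(2H)^{mk}}$ if the limit exists; if it exists for every $\mathbb{E}$ and does not depend on $\mathbb{E}$, it is denoted $\rho(T)$. *)

(* Defs.v *)
From HB Require Import structures.
From mathcomp Require Import all_boot all_order all_algebra all_field.
From mathcomp Require Import finmap.
From mathcomp Require Import all_classical all_reals all_analysis.
From mathcomp Require Import summability.

Set Implicit Arguments.
Unset Strict Implicit.
Unset Printing Implicit Defensive.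

Import Order.TTheory GRing.Theory Num.Theory.
Import numFieldNormedType.Exports.

Local Open Scope classical_set_scope.
Local Open Scope ring_scope.

(* A number field is a finite extension K : fieldExtType rat; its degree
   over the rationals is \dim {:K}. *)
Section RingOfIntegers.
Variable K : fieldExtType rat.

Definition algint : {pred K} :=
  fun x => `[< integralOver (intr : int -> K) x >].

Fact algint_subring_closed : subring_closed algint.
Proof.
split=> [|x y /asboolP Ix /asboolP Iy|x y /asboolP Ix /asboolP Iy];
  apply/asboolP.
- exact: integral1.
- exact: integral_sub.
- exact: integral_mul.
Qed.

HB.instance Definition _ :=
  GRing.isSubringClosed.Build K algint algint_subring_closed.

Record ring_of_integers := RingOfIntegers {
  algint_val : K;
  algint_valP : algint_val \in algint }.

HB.instance Definition _ := [isSub for algint_val].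
HB.instance Definition _ := [Choice of ring_of_integers by <:].
HB.instance Definition _ :=
  [SubChoice_isSubComNzRing of ring_of_integers by <:].

End RingOfIntegers.

Section Ideals.
Variable A : comNzRingType.
Implicit Types I J p : set A.

Definition nonzero_prime_ideals : set (set A) :=
  [set p : set A | [/\ idealr_closed (mem p), prime_idealr_closed (mem p)
             & p != [set 0]]].

Definition ideal_mul I J : set A :=
  [set x | exists2 s : seq (A * A),
             {in s, forall u, u.1 \in I /\ u.2 \in J}
           & x = \sum_(u <- s) u.1 * u.2].

Definition cosets I : set (set A) :=
  [set [set x + y | y in I] | x in [set: A]].

(* fset_set sends infinite sets to the empty one, so the value is 0 when A / I
   is infinite; this never happens for a non-zero ideal of the ring of integers
   of a number field. *)
Definition ideal_norm I : nat := #|` fset_set (cosets I)|.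

(* The degree of f is (size f).-1; the zero polynomial is excluded because its
   leading coefficient is 0. *)
Definition eisenstein p (f : {poly A}) : Prop :=
  [/\ lead_coef f \notin p,
      forall i, (i < (size f).-1)%N -> f`_i \in p
    & f`_0 \notin ideal_mul p p].

Definition shifted_eisenstein_at p (f : {poly A}) : Prop :=
  exists b : A, eisenstein p (f \Po ('X + b%:P)).

Definition shifted_eisenstein (f : {poly A}) : Prop :=
  exists2 p, p \in nonzero_prime_ideals & shifted_eisenstein_at p f.

(* rVpoly identifies the row vector (a_0, ..., a_d) with the polynomial
   a_0 + a_1 X + ... + a_d X^d. *)
Definition shifted_eisenstein_set d : set 'rV[A]_d.+1 :=
  [set v | size (rVpoly v) = d.+1 /\ shifted_eisenstein (rVpoly v)].

End Ideals.

Arguments nonzero_prime_ideals : clear implicits.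
Arguments shifted_eisenstein_set : clear implicits.

Section Density.
Variables (R : realType) (K : fieldExtType rat).
Local Notation k := (\dim {:K}).
Local Notation oK := (ring_of_integers K).

Definition integral_basis (e : 'I_k -> oK) : Prop :=
  forall x : oK, exists! a : {ffun 'I_k -> int}, x = \sum_j e j *~ a j.

Definition box (H : nat) (e : 'I_k -> oK) : set oK :=
  [set \sum_j e j *~ a j | a in
     [set a : {ffun 'I_k -> int} | forall j, - H%:Z <= a j < H%:Z]].

Definition box_ratio m (T : set 'rV[oK]_m) (e : 'I_k -> oK) (H : nat) : R :=
  #|` fset_set (T `&` [set v | forall i, v 0 i \in box H e])|%:R
    / (2 * H)%:R ^+ (m * k).

Definition has_density m (T : set 'rV[oK]_m) (rho : R) : Prop :=
  forall e, integral_basis e -> box_ratio T e @ \oo --> rho.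

End Density.

(* Limit of the products over finite subsets of P, directed by inclusion. *)
Definition has_infinite_product (R : realType) (I : choiceType) (P : set I)
    (F : I -> R) (l : R) : Prop :=
  (fun S : {fset P} => \prod_(i <- S) F (val i)) @ totally --> l.

(* Main.v *)
(* A polynomial is shifted p-Eisenstein when some translate of it lies in the product set
   E = {a_d not in p, a_i in p for i < d, a_0 not in p^2}. The translate is determined modulo p, and
   p / p^2 has N(p) elements, so the residues modulo p^2 of shifted p-Eisenstein polynomials have
   proportion N(p) (1 - 1/N(p)) N(p)^-(d-1) (1/N(p) - 1/N(p)^2) = (N(p) - 1)^2 / N(p)^(d+1). For
   finitely many primes these conditions are independent by the Chinese remainder theorem, and
   periodic sets have the expected density in boxes; hence all partial products are densities and
   only the contribution of the large primes has to be controlled.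

   For d > 2, a shifted p-Eisenstein polynomial is a (X - b)^d modulo p,
     so its top four coefficients
   satisfy a quadratic and a cubic relation modulo p which, once a_d and a_{d-1} are given,
     determine
   the residues of a_{d-2} and a_{d-3}. Primes over a rational prime l <= 2H contribute O(1/l^2);
   for the other ones the quadratic relation is a nonzero element of controlled size, which lies in
   boundedly many primes of large norm, and the cubic relation gains a factor O(1/H).

   For d = 2 the density is 1, because the product is 0, i.e. the sum of the 1/N(p) diverges.
   Otherwise, by a packing bound for ideals, most elements of a large box would lie in no prime
   outside a finite set; their norms would be smooth integers, hence take few values, and each value
   of the norm is taken O(H^(k-1)) times. *)
Require Import Defs.
From mathcomp Require Import all_boot all_order all_algebra all_field.
From mathcomp Require Import perm finmap.
From mathcomp Require Import all_classical all_reals all_analysis.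
From mathcomp Require Import summability.
From mathcomp Require Import ring lra zify.

Set Implicit Arguments.
Unset Strict Implicit.
Unset Printing Implicit Defensive.
Import Order.TTheory GRing.Theory Num.Theory.
Import numFieldNormedType.Exports.
Local Open Scope classical_set_scope.
Local Open Scope ring_scope.

(** * Ideals and congruences *)

(** The arguments run over a commutative domain [A] with a finite basis over the integers and a
    fraction-free form of integral closedness; only the last part mentions number fields. Unique
    factorization of ideals is avoided: the local input is that A / p is a field and that p / p^2
    has dimension one over it, and both facts come from pigeonhole arguments modulo a rational
    prime. Local counts are exact identities of natural numbers with denominators cleared. A single
    relation modulo p saves only 1/l, and the sum of these savings over the rational primes
    diverges; hence two relations are used, which needs four top coefficients, and d = 2 has to be
    settled by the vanishing of the product. Savings are measured by the rational prime l below p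
    rather than by N(p), because one integer coordinate of a coefficient is moved at a time; this
    suffices since a bounded number of primes lie over a large l. *)

Section Ideals.
Variable A : comNzRingType.
Implicit Types (I J : set A) (x y : A).

Definition is_ideal I : Prop :=
  [/\ I 0, (forall x y, I x -> I y -> I (x + y)) & (forall a x, I x -> I (a * x))].

Section IdealClosure.
Variables (I : set A) (idI : is_ideal I).

Lemma idl0 : I 0. Proof. by case: idI. Qed.
Lemma idlD x y : I x -> I y -> I (x + y). Proof. by case: idI => _ h _; apply: h. Qed.
Lemma idlM a x : I x -> I (a * x). Proof. by case: idI => _ _; apply. Qed.
Lemma idlMr a x : I x -> I (x * a). Proof. by rewrite mulrC; apply: idlM. Qed.
Lemma idlN x : I x -> I (- x). Proof. by rewrite -mulN1r; apply: idlM. Qed.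
Lemma idlB x y : I x -> I y -> I (x - y).
Proof. by move=> ? ?; apply: idlD => //; apply: idlN. Qed.
Lemma idlBC x y : I (x - y) -> I (y - x).
Proof. by rewrite -(opprB y x) => /idlN; rewrite opprK. Qed.
Lemma idl_sum (T : Type) (s : seq T) (P : pred T) (F : T -> A) :
  (forall i, P i -> I (F i)) -> I (\sum_(i <- s | P i) F i).
Proof. by move=> h; apply: big_ind => //; [exact: idl0 | exact: idlD]. Qed.
Lemma idlMz x (z : int) : I x -> I (x *~ z).
Proof. by rewrite -mulrzl; apply: idlM. Qed.
Lemma idl_congr x y : I (x - y) -> I y <-> I x.
Proof.
move=> h; split=> [/(idlD h)|hx]; first by rewrite subrK.
by rewrite -(subKr x y); apply: idlB.
Qed.

Definition congm m (v w : 'rV[A]_m) := forall i, I (v 0 i - w 0 i).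
Definition periodic_mod m (T : set 'rV[A]_m) := forall v w, congm v w -> T v -> T w.

Lemma congmC m (v w : 'rV[A]_m) : congm v w -> congm w v.
Proof. by move=> h i; apply: idlBC. Qed.
Lemma periodicE m (T : set 'rV[A]_m) v w : periodic_mod T -> congm v w -> T v = T w.
Proof. by move=> h hc; apply/propext; split; apply: h => //; apply: congmC. Qed.
End IdealClosure.

Definition is_prime I : Prop :=
  [/\ is_ideal I, ~ I 1, (forall x y, I (x * y) -> I x \/ I y) & exists2 x, I x & x != 0].

Definition multiples n : set A := [set x | exists y, x = n%:R * y].

Lemma multiples_ideal n : is_ideal (multiples n).
Proof.
split=> [|x y [x' ->] [y' ->]|a x [y ->]]; first by exists 0; rewrite mulr0.
  by exists (x' + y'); rewrite mulrDr.
by exists (a * y); rewrite mulrCA.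
Qed.

Lemma multiples_sub I n : is_ideal I -> I n%:R -> forall x, multiples n x -> I x.
Proof. by move=> h hn x [y ->]; apply: idlMr. Qed.

Lemma periodic_sub I J m (T : set 'rV[A]_m) : (forall x, J x -> I x) ->
  periodic_mod I T -> periodic_mod J T.
Proof. by move=> h hT v w hvw; apply: hT => i; apply: h. Qed.
End Ideals.

Arguments multiples_ideal {A} n.
Arguments periodic_mod {A} I {m} T.
Arguments congm {A} I {m} v w.

(** * Counting in boxes and residue systems *)

Section FreeRing.
Variables (A : comNzRingType) (k : nat) (e : 'I_k -> A).
Definition lincomb (a : {ffun 'I_k -> int}) : A := \sum_j e j *~ a j.
Hypothesis basis : forall x : A, exists! a : {ffun 'I_k -> int}, x = \sum_j e j *~ a j.

Definition coords (x : A) : {ffun 'I_k -> int} := sval (cid (basis x)).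

Lemma coordsK x : lincomb (coords x) = x.
Proof. by rewrite /coords; case: cid => a /= [->]. Qed.
Lemma lincombK a : coords (lincomb a) = a.
Proof. by rewrite /coords; case: cid => b /= [_ h]; apply: h. Qed.

Lemma lincombD a b : lincomb (a + b) = lincomb a + lincomb b.
Proof. by rewrite /lincomb -big_split; apply: eq_bigr => j _; rewrite ffunE mulrzDr. Qed.
Lemma lincomb0 : lincomb 0 = 0.
Proof. by rewrite /lincomb big1 // => j _; rewrite ffunE. Qed.
Lemma coordsD x y : coords (x + y) = coords x + coords y.
Proof. by rewrite -{1}(coordsK x) -{1}(coordsK y) -lincombD lincombK. Qed.
Lemma coords0 : coords 0 = 0. Proof. by rewrite -lincomb0 lincombK. Qed.
Lemma coordsN x : coords (- x) = - coords x.
Proof. by apply/eqP; rewrite -addr_eq0 -coordsD addNr coords0. Qed.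
Lemma coordsB x y : coords (x - y) = coords x - coords y. Proof. by rewrite coordsD coordsN. Qed.
Lemma coordsMn x n : coords (x *+ n) = coords x *+ n.
Proof. by elim: n => [|n IH]; rewrite ?mulr0n ?coords0 // !mulrS coordsD IH. Qed.
Lemma coordsMnE x n j : coords (n%:R * x) j = n%:Z * coords x j.
Proof. by rewrite mulr_natl coordsMn ffunMnE -mulr_natl natz. Qed.
Lemma coords_inj : injective coords. Proof. exact: can_inj coordsK. Qed.

(* Boxes and residue systems are treated uniformly: the coordinates range over [c, c + N), with
   c = - H and N = 2 H for a box, and c = 0 and N = n for the residues modulo n. *)
Definition pt1 (c : int) N (r : {ffun 'I_k -> 'I_N}) : A := lincomb [ffun j => (r j)%:Z + c].
Definition pt (c : int) N m (r : {ffun 'I_m -> {ffun 'I_k -> 'I_N}}) : 'rV[A]_m :=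
  \row_i pt1 c (r i).

(** Sums of indicators over index functions instead of cardinals of sets: double counting becomes an
    exchange of sums, and a change of variables a reindexing by an injection. *)
Definition cnt m (c : int) N (T : set 'rV[A]_m) : nat :=
  (\sum_(r : {ffun 'I_m -> {ffun 'I_k -> 'I_N}}) `[< T (pt c r) >])%N.
Definition cnt1 (c : int) N (T : set A) : nat :=
  (\sum_(r : {ffun 'I_k -> 'I_N}) `[< T (pt1 c r) >])%N.

Lemma cnt_prod m c N (B : 'I_m -> set A) :
  cnt c N [set v : 'rV[A]_m | forall i, B i (v 0 i)] = (\prod_i cnt1 c N (B i))%N.
Proof.
rewrite /cnt /cnt1 bigA_distr_bigA; apply: eq_bigr => r _ /=.
case: asboolP => [h|h].
  by rewrite big1 // => i _; have := h i; rewrite mxE => /asboolP ->.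
have [i hi] : exists i, ~ B i (pt1 c (r i)).
  by apply/existsNP => h'; apply: h => i; rewrite mxE.
by rewrite (bigD1 i) //= ; case: asboolP hi.
Qed.

Lemma card_pts m N : #|{: {ffun 'I_m -> {ffun 'I_k -> 'I_N}} }| = (N ^ (m * k))%N.
Proof. by rewrite !card_ffun !card_ord -expnM mulnC. Qed.

Lemma cnt_setT m c N : cnt c N [set: 'rV[A]_m] = (N ^ (m * k))%N.
Proof.
by rewrite /cnt -(card_pts m) -sum1_card; apply: eq_bigr => r _; case: asboolP => // /(_ I).
Qed.
Lemma cnt1_setT c N : cnt1 c N setT = (N ^ k)%N.
Proof. by have := @cnt_prod 1 c N (fun=> setT); rewrite big_ord1 => <-;
  rewrite -[k in RHS]mul1n -(cnt_setT 1 c); congr cnt; apply/seteqP; split. Qed.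

Lemma cnt_mono m c N (T U : set 'rV[A]_m) : (forall v, T v -> U v) -> (cnt c N T <= cnt c N U)%N.
Proof. by move=> h; apply: leq_sum => r _; case: asboolP => // /h /asboolP ->. Qed.

Lemma cnt_setI_C m c N (T U : set 'rV[A]_m) :
  (cnt c N (T `&` U) + cnt c N (T `&` ~` U))%N = cnt c N T.
Proof.
rewrite -big_split; apply: eq_bigr => r _ /=.
case: (asboolP ((T `&` U) _)) => [[hT hU]|h1].
  by case: asboolP => [[]//|_]; case: asboolP.
case: asboolP => [[hT hU]|h2]; first by case: asboolP.
by case: asboolP => // hT; case: h2; split=> // hU; apply: h1.
Qed.
Lemma cnt_setC m c N (T : set 'rV[A]_m) : (cnt c N T + cnt c N (~` T))%N = (N ^ (m * k))%N.
Proof. by rewrite -(cnt_setT m c N) -(cnt_setI_C c N setT T) !setTI. Qed.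

Section Residues.
Variable n : nat.
Local Notation n1 := n.+1.
Local Notation nI := (@multiples A n1).

Definition residue (x : A) : {ffun 'I_k -> 'I_n1} := [ffun j => inord `|(coords x j %% n1)%Z|%N].
Definition residue_row m (v : 'rV[A]_m) : {ffun 'I_m -> {ffun 'I_k ->
  'I_n1}} := [ffun i => residue (v 0 i)].

Lemma residueE x j : (residue x j : int) = (coords x j %% n1)%Z.
Proof.
by rewrite ffunE inordK ?gez0_abs ?modz_ge0 // -ltz_nat gez0_abs ?modz_ge0 // ltz_pmod.
Qed.

Lemma multiplesP x : nI x <-> forall j, (n1 %| coords x j)%Z.
Proof.
split=> [[y ->] j|h]; first by rewrite coordsMnE dvdz_mulr.
exists (lincomb [ffun j => (coords x j %/ n1)%Z]); apply: coords_inj; apply/ffunP => j.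
by rewrite coordsMnE lincombK ffunE mulrC divzK.
Qed.

Lemma residueP x y : residue x = residue y <-> nI (x - y).
Proof.
rewrite multiplesP; split=> [h j|h].
  rewrite coordsB ffunE ffunE -eqz_mod_dvd; apply/eqP.
  by rewrite -[LHS]residueE h residueE.
apply/ffunP => j; apply/val_inj/eqP; rewrite -eqz_nat !residueE.
by have := h j; rewrite coordsB ffunE ffunE -eqz_mod_dvd.
Qed.

Lemma pt1K : cancel (@pt1 0 n1) residue.
Proof.
move=> r; apply/ffunP => j; apply/val_inj/eqP; rewrite -eqz_nat residueE lincombK ffunE addr0.
by rewrite modz_small //= ltz_nat ltn_ord.
Qed.
Lemma residue_pt1 x : nI (pt1 0 (residue x) - x).
Proof. by apply/residueP; rewrite pt1K. Qed.

Variable m : nat.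
Implicit Types (v w : 'rV[A]_m) (T : set 'rV[A]_m).
Lemma residue_rowP v w : residue_row v = residue_row w <-> congm nI v w.
Proof.
split=> [h i|h]; first by apply/residueP; move/ffunP/(_ i): h; rewrite !ffunE.
by apply/ffunP => i; rewrite !ffunE; apply/residueP.
Qed.
Lemma ptK : cancel (@pt 0 n1 m) (@residue_row m).
Proof. by move=> r; apply/ffunP => i; rewrite ffunE mxE pt1K. Qed.
Lemma residue_row_pt v : congm nI (pt 0 (residue_row v)) v.
Proof. by apply/residue_rowP; rewrite ptK. Qed.

(** As [g] respects congruence, [f] induces an injective map of the finite set of residue rows,
    hence a permutation of it. *)
Lemma cnt_bij (f g : 'rV[A]_m -> 'rV[A]_m) T : cancel f g ->
  (forall v w, congm nI v w -> congm nI (f v) (f w)) ->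
  (forall v w, congm nI v w -> congm nI (g v) (g w)) ->
  periodic_mod nI T -> cnt 0 n1 [set v | T (f v)] = cnt 0 n1 T.
Proof.
move=> fK hf hg hT; rewrite /cnt.
pose h (r : {ffun 'I_m -> {ffun 'I_k -> 'I_n1}}) := residue_row (f (pt 0 r)).
have hinj : injective h.
  move=> r s /residue_rowP /hg; rewrite !fK => /residue_rowP; by rewrite !ptK.
rewrite [RHS](reindex_inj hinj); apply: eq_bigr => r _ /=; congr (nat_of_bool (asbool _)).
by apply: (periodicE (multiples_ideal n1) hT); apply/residue_rowP; rewrite ptK.
Qed.

(* As u + w = 1, the map (x, y) |-> (w x + u y, y - x) is invertible; it sends T1 x T2 onto the
   product of the intersection of T1 and T2 with the whole space. *)
Lemma cnt_indep (I1 I2 : set A) (u w : A) T1 T2 :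
  is_ideal I1 -> is_ideal I2 -> I1 u -> I2 w -> u + w = 1 ->
  I1 n1%:R -> I2 n1%:R -> periodic_mod I1 T1 -> periodic_mod I2 T2 ->
  (cnt 0 n1 T1 * cnt 0 n1 T2 = cnt 0 n1 (T1 `&` T2) * n1 ^ (m * k))%N.
Proof.
move=> id1 id2 I1u I2w uw1 I1n I2n pT1 pT2.
pose G := {ffun 'I_m -> {ffun 'I_k -> 'I_n1}}.
pose h (x : G * G) : G * G :=
  (residue_row (w *: pt 0 x.1 + u *: pt 0 x.2), residue_row (pt 0 x.2 - pt 0 x.1)).
have idn := multiples_ideal (A := A) n1.
have hinj : injective h.
  move=> [r s] [r' s']; rewrite /h /= => -[/residue_rowP h1 /residue_rowP h2].
  have hr : congm nI (pt 0 r) (pt 0 r').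
    move=> i; move: (idlB idn (h1 i) (idlM idn u (h2 i))); rewrite !mxE.
    congr nI; have -> : w = 1 - u by rewrite -uw1 addrC addKr.
    by ring.
  have hs : congm nI (pt 0 s) (pt 0 s').
    move=> i; move: (idlD idn (h2 i) (hr i)); rewrite !mxE.
    by congr nI; ring.
  by move/residue_rowP: hr; move/residue_rowP: hs; rewrite !ptK => -> ->.
rewrite {1 2}/cnt big_distrlr /= pair_bigA /=.
rewrite -card_pts -sum1_card big_distrlr /= pair_bigA /=.
rewrite [RHS](reindex_inj hinj) /=; apply: eq_bigr => -[r s] _ /=; rewrite muln1 -mulnb.
have E1 : T1 (pt 0 (residue_row (w *: pt 0 r + u *: pt 0 s))) = T1 (pt 0 r).
  apply: (periodicE id1 pT1) => i.
  rewrite -(subrK ((w *: pt 0 r + u *: pt 0 s) 0 i) (pt _ _ 0 i)) -addrA.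
  apply: (idlD id1); first exact: (multiples_sub id1 I1n (residue_row_pt _ i)).
  rewrite !mxE; set X := pt1 0 (r i); set Y := pt1 0 (s i).
  have -> : w * X + u * Y - X = (Y - X) * u.
    have -> : w = 1 - u by rewrite -uw1 addrC addKr.
    by ring.
  exact: idlM.
have E2 : T2 (pt 0 (residue_row (w *: pt 0 r + u *: pt 0 s))) = T2 (pt 0 s).
  apply: (periodicE id2 pT2) => i.
  rewrite -(subrK ((w *: pt 0 r + u *: pt 0 s) 0 i) (pt _ _ 0 i)) -addrA.
  apply: (idlD id2); first exact: (multiples_sub id2 I2n (residue_row_pt _ i)).
  rewrite !mxE; set X := pt1 0 (r i); set Y := pt1 0 (s i).
  have -> : w * X + u * Y - Y = (X - Y) * w.
    have -> : u = 1 - w by rewrite -uw1 addrK.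
    by ring.
  exact: idlM.
by rewrite E1 E2 asbool_and /asbool; do 2!case: pselect => ? /=.
Qed.
End Residues.
End FreeRing.

(** * Norms and local structure at a prime *)

Section Norm.
Variables (A : comNzRingType) (k : nat) (e : 'I_k -> A).
Hypothesis basis : forall x : A, exists! a : {ffun 'I_k -> int}, x = \sum_j e j *~ a j.
Hypothesis domain : forall x y : A, x * y = 0 -> x = 0 \/ y = 0.
Local Notation coords := (coords basis).
Local Notation lincomb := (lincomb e).

Definition coord_row (x : A) : 'rV[int]_k := \row_j coords x j.
Definition row_lincomb (v : 'rV[int]_k) : A := lincomb [ffun j => v 0 j].
Lemma coord_rowK : cancel coord_row row_lincomb.
Proof. by move=> x; rewrite /row_lincomb -[RHS](coordsK basis); congr lincomb; apply/ffunP => j;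
  rewrite ffunE mxE. Qed.
Lemma row_lincombK : cancel row_lincomb coord_row.
Proof. by move=> v; apply/rowP => j; rewrite mxE (lincombK basis) ffunE. Qed.

Lemma coords_sum (I : Type) (r : seq I) (P : pred I) (F : I -> A) :
  coords (\sum_(i <- r | P i) F i) = \sum_(i <- r | P i) coords (F i).
Proof. by apply: (big_morph coords (coordsD basis) (coords0 basis)). Qed.
Lemma coordsMzE x (z : int) j : coords (x *~ z) j = z * coords x j.
Proof.
case: z => n; first by rewrite -pmulrn (coordsMn basis) ffunMnE -mulr_natl natz.
by rewrite NegzE mulrNz -pmulrn (coordsN basis) ffunE (coordsMn basis) ffunMnE -mulr_natl natz
  mulNr.
Qed.

Definition mulmat (x : A) : 'M[int]_k := \matrix_(i, j) coords (x * e i) j.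

Lemma coord_rowM x y : coord_row (x * y) = coord_row y *m mulmat x.
Proof.
apply/rowP => j; rewrite !mxE -{1}(coordsK basis y) /lincomb mulr_sumr coords_sum sum_ffunE.
by apply: eq_bigr => i _; rewrite !mxE mulrzAr coordsMzE.
Qed.

Lemma row_lincomb_inj : injective row_lincomb. Proof. exact: can_inj row_lincombK. Qed.
Lemma row_lincomb0 : row_lincomb 0 = 0.
Proof. by rewrite -(coord_rowK 0); congr row_lincomb; apply/rowP => j;
  rewrite !mxE (coords0 basis) ffunE. Qed.
Lemma coord_row0 : coord_row 0 = 0. Proof. by rewrite -row_lincomb0 row_lincombK. Qed.

Lemma mulmatM x y : mulmat (x * y) = mulmat x *m mulmat y.
Proof.
apply/row_matrixP => i; rewrite row_mul.
have rowE z : row i (mulmat z) = coord_row (z * e i) by apply/rowP => j; rewrite !mxE.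
by rewrite !rowE -mulrA mulrCA (coord_rowM y).
Qed.
Lemma mulmat1 : mulmat 1 = 1%:M.
Proof.
apply/row_matrixP => i; rewrite [RHS]rowE mulmx1 -[RHS]row_lincombK.
have -> : row_lincomb (delta_mx 0 i) = e i.
  rewrite /row_lincomb /lincomb (bigD1 i) //= big1 ?addr0 => [|j ji];
    rewrite ffunE mxE !eqxx ?(negPf ji) //=.
by apply/rowP => j; rewrite !mxE mul1r.
Qed.

Definition normA (x : A) : int := \det (mulmat x).

Lemma normAM x y : normA (x * y) = normA x * normA y.
Proof. by rewrite /normA mulmatM det_mulmx. Qed.

Lemma normA_neq0 x : x != 0 -> normA x != 0.
Proof.
move=> x0; apply/det0P => -[v v0 hv].
have : coord_row (x * row_lincomb v) = 0 by rewrite coord_rowM row_lincombK.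
rewrite -coord_row0 => /(can_inj coord_rowK) /domain [/eqP|]; first by rewrite (negPf x0).
by rewrite -row_lincomb0 => /row_lincomb_inj /eqP; rewrite (negPf v0).
Qed.

Lemma coord_row_int (z : int) : coord_row z%:~R = z *: coord_row 1.
Proof. by apply/rowP => j; rewrite !mxE coordsMzE. Qed.

(** The adjugate of the multiplication matrix, applied to the coordinates of 1, gives the cofactor;
    conjugates of [x] do not enter. *)
Lemma normA_dvd x : exists y, x * y = (normA x)%:~R :> A.
Proof.
exists (row_lincomb (coord_row 1 *m \adj (mulmat x))); apply: (can_inj coord_rowK).
by rewrite coord_rowM row_lincombK -mulmxA mul_adj_mx coord_row_int mul_mx_scalar.
Qed.

Lemma exists_multiple x : x != 0 -> exists2 n : nat, (0 < n)%N & exists y, x * y = n%:R :> A.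
Proof.
move=> x0; exists `|normA x|%N; first by rewrite absz_gt0 normA_neq0.
have [y hy] := normA_dvd x; case: (intP (normA x)) hy => [|n|n] hy.
- by exists y; rewrite hy.
- by exists y; rewrite hy.
- by exists (- y); rewrite mulrN hy abszN /= mulrNz opprK.
Qed.

Lemma natA_inj n (x : A) : (0 < n)%N -> n%:R * x = 0 -> x = 0.
Proof.
move=> n0 h; apply: (coords_inj (basis := basis)); apply/ffunP => j.
have := congr1 (fun y => coords y j) h; rewrite (coordsMnE basis) (coords0 basis) !ffunE => /eqP.
by rewrite mulf_eq0 eqz_nat; case: n n0 {h} => //= n _ /eqP.
Qed.
Lemma natA_lreg n (x y : A) : (0 < n)%N -> n%:R * x = n%:R * y -> x = y.
Proof.
move=> n0 h; apply/eqP; rewrite -subr_eq0; apply/eqP/(natA_inj n0).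
by rewrite mulrBr h subrr.
Qed.

Lemma pigeonhole n (u : nat -> A) : exists i j, (i < j)%N /\ multiples n.+1 (u j - u i).
Proof.
pose F := {ffun 'I_k -> 'I_n.+1}.
pose f (i : 'I_(#|{: F}|).+1) : F := residue basis n (u i).
have : ~ injective f by move=> /leq_card; rewrite card_ord ltnn.
move=> /existsNP [i /existsNP [j /not_implyP [hf ij]]].
have /residueP := hf; have /esym/residueP := hf; move=> h1 h2.
case: (ltngtP i j) => [lt|gt|/val_inj //].
- by exists i, j.
- by exists j, i.
Qed.

Section Prime.
Variables (p : set A) (pp : is_prime p).
Let idp : is_ideal p. Proof. by case: pp. Qed.
Let p1 : ~ p 1. Proof. by case: pp. Qed.
Let pM x y : p (x * y) -> p x \/ p y. Proof. by case: pp => _ _ h _; apply: h. Qed.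

Lemma primeX x n : p (x ^+ n) -> p x.
Proof. by elim: n => [|n IH]; rewrite ?expr0 // exprS => /pM []. Qed.

Lemma prime_nat : exists2 l, prime l & p l%:R.
Proof.
have [x px x0] : exists2 x, p x & x != 0 by case: pp.
have [n n0 [y hy]] := exists_multiple x0.
have : p n%:R by rewrite -hy; apply: (idlMr idp).
elim/ltn_ind: n n0 {hy} => n IH n0 pn.
case: (ltngtP n 1) => [|n1|n1]; first by case: n n0 {IH pn}.
  have := pn; rewrite -(divnK (pdiv_dvd n)) natrM => /pM [] h.
    apply: (IH (n %/ pdiv n)%N) => //; first by rewrite ltn_Pdiv // prime_gt1 // pdiv_prime.
    by rewrite divn_gt0 ?pdiv_leq // prime_gt0 // pdiv_prime.
  by exists (pdiv n) => //; apply: pdiv_prime.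
by move: pn; rewrite n1.
Qed.

Variables (l : nat) (lprime : prime l) (pl : p l%:R).

Lemma prime_dvd n : p n%:R -> (l %| n)%N.
Proof.
move=> pn; apply: contrapT => /negP; rewrite -prime_coprime // => /coprimeP.
move=> /(_ (prime_gt0 lprime)) [[a b] /= h].
apply: p1; have -> : 1 = a%:R * l%:R - b%:R * n%:R :> A.
  rewrite -!natrM -natrB ?h //; apply: ltnW; rewrite -subn_gt0; lia.
by apply: (idlB idp); apply: (idlM idp).
Qed.

Lemma prime_dvdz (z : int) : p z%:~R -> (l %| z)%Z.
Proof.
rewrite dvdzE; case: z => n; first exact: prime_dvd.
by rewrite NegzE mulrNz => /(idlN idp); rewrite opprK => /prime_dvd; rewrite abszN.
Qed.

(** Pigeonhole on the powers of [x] modulo [l]. For [x] outside [p] the second factor must lie in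
    [p], which inverts [x] modulo [p]; for [x] in [p] it lies outside [p] and kills a power of [x]
    modulo [l]. *)
Lemma pow_diff (x : A) : exists i j, (0 < j)%N /\ multiples l (x ^+ i * (x ^+ j - 1)).
Proof.
have [i [j [ij h]]] := pigeonhole l.-1 (fun i => x ^+ i).
exists i, (j - i)%N; split; first by rewrite subn_gt0.
move: h; rewrite prednK ?prime_gt0 //; congr multiples.
by rewrite mulrBr mulr1 -exprD subnKC // ltnW.
Qed.

Lemma prime_inv x : ~ p x -> exists y, p (x * y - 1).
Proof.
move=> px; have [i [j [j0 h]]] := pow_diff x.
exists (x ^+ j.-1); rewrite -exprS prednK //.
by case: (pM (multiples_sub idp pl h)) => // /primeX.
Qed.

Let I := @multiples A l.
Let idI : is_ideal I := multiples_ideal l.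

(** This is nilpotency of the elements of the maximal ideal in the localization of A / lA at [p],
    with the denominators collected in [c]: the factors x^j - 1 of [pow_diff] lie outside [p]. *)
Lemma nilpotent_cofactor (s : seq A) : (forall x, x \in s -> p x) ->
  exists2 c, ~ p c & forall x, x \in s -> exists n, I (c * x ^+ n).
Proof.
elim: s => [|x s IH] hs; first by exists 1.
have [|c pc hc] := IH; first by move=> y ys; apply: hs; rewrite inE ys orbT.
have [i [j [j0 h]]] := pow_diff x.
exists (c * (x ^+ j - 1)).
  move=> /pM [] // hx; apply: p1.
  rewrite -(subKr (x ^+ j) 1); apply: (idlB idp) => //.
  rewrite -(prednK j0) exprS; apply: (idlMr idp); apply: hs; exact: mem_head.
move=> y; rewrite inE => /orP [/eqP ->|ys].
  by exists i; rewrite -mulrA [_ * x ^+ i]mulrC; apply: (idlM idI).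
by have [n hn] := hc _ ys; exists n; rewrite mulrAC; apply: (idlMr idI).
Qed.

(** For the least n with c x^n in [I], the element c x^(n-1) is still outside [I] and is annihilated
    by x modulo [I]; repeat with the next generator. *)
Lemma kill_generators (s : seq A) (c : A) : ~ I c -> (forall x, x \in s ->
  exists n, I (c * x ^+ n)) ->
  exists2 a, ~ I (a * c) & forall x, x \in s -> I (a * c * x).
Proof.
elim: s c => [|x s IH] c Ic hc; first by exists 1; rewrite ?mul1r.
have ex : exists n, `[< I (c * x ^+ n) >].
  by have [n hn] := hc x (mem_head _ _); exists n; apply/asboolP.
case: (ex_minnP ex) => -[|n] /asboolP hn hmin; first by case: Ic; rewrite expr0 mulr1 in hn.
have [||a Ia ha] := IH (c * x ^+ n).
- by move=> /asboolP /hmin; rewrite ltnn.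
- move=> y ys; have [|m hm] := hc y; first by rewrite inE ys orbT.
  by exists m; rewrite mulrAC; apply: (idlMr idI).
exists (a * x ^+ n); first by rewrite -mulrA [_ * c]mulrC.
move=> y; rewrite -(mulrA a) (mulrC _ c) inE => /orP [/eqP ->|]; last exact: ha.
by rewrite -!mulrA -exprSr; apply: (idlM idI).
Qed.

(** The fraction b / l lies in the inverse of [p] but not in [A]. The residues modulo [l] that lie
    in [p] form a finite list generating [p] modulo lA. *)
Lemma annihilated_element : exists2 b, ~ I b & forall x, p x -> I (b * x).
Proof.
have l1 : l.-1.+1 = l by rewrite prednK // prime_gt0.
pose s := [seq x <- [seq pt1 e 0 r | r <- enum {: {ffun 'I_k -> 'I_l.-1.+1}}] | `[< p x >]].
have [|c pc hc] := @nilpotent_cofactor s.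
  by move=> x; rewrite mem_filter => /andP [/asboolP].
have [|a Ia ha] := kill_generators _ hc; first by move=> h; apply: pc;
  apply: (multiples_sub idp pl h).
exists (a * c) => // x px.
have hx : I (x - pt1 e 0 (residue basis l.-1 x)).
  by apply: (idlBC idI); rewrite /I -l1; apply: residue_pt1.
rewrite -(subrK (pt1 e 0 (residue basis l.-1 x)) x) mulrDr.
apply: (idlD idI); first exact: (idlM idI).
apply: ha; rewrite mem_filter map_f ?mem_enum // andbT; apply/asboolP.
by apply/(idl_congr idp (x := x)) => //; apply: (multiples_sub idp pl).
Qed.

(** Integral closedness without fractions: division by n^j turns the equation into the monic one y^j
    = y^i + w for y = b / n. This shape is the one that a pigeonhole argument produces. *)
Hypothesis normal : forall (b w : A) (n i j : nat), (0 < n)%N -> (i < j)%N ->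
  b ^+ j = b ^+ i * n%:R ^+ (j - i) + w * n%:R ^+ j -> multiples n b.

Let l0 : (0 < l)%N := prime_gt0 lprime.

Lemma natX_inj n (x y : A) : l%:R ^+ n * x = l%:R ^+ n * y -> x = y.
Proof. by rewrite -natrX; apply: natA_lreg; rewrite expn_gt0 l0. Qed.

(* The element [b / l] of the fraction field lies in the inverse of [p] but is
   not integral, so it cannot map [p] into itself. *)
Lemma uniformizer : exists b pi u,
  [/\ p pi, ~ p u, b * pi = l%:R * u & forall x, p x -> I (b * x)].
Proof.
have [b Ib hb] := annihilated_element; exists b.
case: (pselect (exists pi u, [/\ p pi, ~ p u & b * pi = l%:R * u])).
  by move=> [pi [u [h1 h2 h3]]]; exists pi, u.
move=> hN; case: Ib.
have step x : p x -> exists2 z, p z & b * x = l%:R * z.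
  move=> px; have [z hz] := hb x px; exists z => //.
  by apply: contrapT => pz; apply: hN; exists x, z.
have pow j : exists z, p z /\ b ^+ j * l%:R = l%:R ^+ j * z.
  elim: j => [|j [z [pz hz]]]; first by exists l%:R; rewrite !expr0 !mul1r.
  have [z' pz' hz'] := step z pz; exists z'; split => //.
  by rewrite exprS -mulrA hz mulrCA hz' exprSr mulrA.
have [z hz] := choice pow.
(* Here z j = l (b / l)^j, so two values congruent modulo l make (b / l)^j - (b / l)^i an element of
   [A]. *)
have [i [j [ij [w hw]]]] := pigeonhole l.-1 z.
rewrite prednK // in hw.
apply: (@normal b w l i j l0 ij); apply: (@natX_inj 1); rewrite expr1.
rewrite mulrC (hz j).2 -(subrK (z i) (z j)) hw mulrDr mulrDr addrC; congr (_ + _); last by ring.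
rewrite mulrA [l%:R * _]mulrC (hz i).2 mulrAC -exprD subnKC //; exact: ltnW.
Qed.

Local Notation p2 := (ideal_mul p p).

Lemma sq_ideal : is_ideal p2.
Proof.
split.
- by exists [::]; rewrite ?big_nil.
- move=> x y [s hs ->] [t ht ->]; exists (s ++ t); last by rewrite big_cat.
  by move=> u; rewrite mem_cat => /orP [/hs|/ht].
- move=> a x [s hs ->]; exists [seq (a * u.1, u.2) | u <- s].
    move=> _ /mapP [u /hs [h1 h2] ->]; split=> //=.
    by rewrite inE; apply: (idlM idp); move: h1; rewrite inE.
  by rewrite big_map mulr_sumr; apply: eq_bigr => u _; rewrite mulrA.
Qed.

Lemma sq_mul x y : p x -> p y -> p2 (x * y).
Proof.
move=> px py; exists [:: (x, y)]; last by rewrite big_cons big_nil addr0.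
by move=> u; rewrite mem_seq1 => /eqP ->; split; rewrite inE.
Qed.

Lemma sq_sub x : p2 x -> p x.
Proof.
move=> [s hs ->]; rewrite big_seq; apply: (idl_sum idp) => u /hs [h _].
by apply: (idlMr idp) => //; move: h; rewrite inE.
Qed.

(** Multiplication by [pi] induces a bijection from A / p to p / p^2. Injectivity: [b] maps p^2 into
    l p, while b pi = l u with u outside p. Surjectivity: b x = l y gives u x = pi y, and u is
    invertible modulo p. *)
Lemma uniformizerP : exists pi,
  [/\ p pi, (forall x, p2 (pi * x) -> p x) & forall x, p x -> exists y, p2 (x - pi * y)].
Proof.
have [b [pi [u [ppi pu hbpi hb]]]] := uniformizer; exists pi; split=> //.
  have hb2 x : p2 x -> exists2 z, p z & b * x = l%:R * z.
    move=> [s]; elim: s x => [|[y z] s IH] x hs ->.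
      by exists 0; rewrite ?big_nil ?mulr0 //; apply: (idl0 idp).
    have [|t pt ht] := IH (\sum_(u <- s) u.1 * u.2) _ erefl.
      by move=> v vs; apply: hs; rewrite inE vs orbT.
    have [] := hs _ (mem_head _ _); rewrite !inE /= => py pz.
    have [y' hy'] := hb y py; exists (y' * z + t).
      by apply: (idlD idp) => //; apply: (idlM idp).
    by rewrite big_cons mulrDr ht /= mulrA hy' mulrDr mulrA.
  move=> x /hb2 [z pz]; rewrite mulrA hbpi -mulrA => /(natA_lreg l0) h.
  by case: (@pM u x); rewrite // h.
move=> x px; have [y hy] := hb x px; have [v hv] := prime_inv pu.
have h : u * x = pi * y.
  by apply: (natA_lreg l0); rewrite mulrA -hbpi mulrAC hy; ring.
exists (v * y); have -> : x - pi * (v * y) = - ((u * v - 1) * x).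
  by rewrite mulrCA -h; ring.
by apply: (idlN sq_ideal); apply: sq_mul.
Qed.
End Prime.
End Norm.

(** * Cosets and the index of an ideal *)

Section Cosets.
Variables (A : comNzRingType) (k : nat) (e : 'I_k -> A).
Hypothesis basis : forall x : A, exists! a : {ffun 'I_k -> int}, x = \sum_j e j *~ a j.
Local Notation cnt1 := (cnt1 e).

Definition translate (I : set A) (x : A) : set A := [set x + y | y in I].
Lemma translateP (I : set A) x z : translate I x z <-> I (z - x).
Proof.
split=> [[y Iy <-]|h]; first by rewrite addrC addKr.
by exists (z - x) => //; rewrite addrC subrK.
Qed.
Lemma translate_eq (I : set A) x z : is_ideal I -> I (x - z) <-> translate I x = translate I z.
Proof.
move=> idI; split=> [h|E].
  apply/seteqP; split => y /translateP hy; apply/translateP.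
    by rewrite -(subrK x y) -addrA; apply: idlD.
  by rewrite -(subrK z y) -addrA; apply: idlD => //; apply: idlBC.
by apply/translateP; rewrite -E; apply/translateP; rewrite subrr; apply: idl0.
Qed.

Lemma finite_cosets (I : set A) n : is_ideal I -> I n.+1%:R -> finite_set (cosets I).
Proof.
move=> idI In; apply: (@sub_finite_set _ _ [set translate I (pt1 e 0 r) | r in [set: {ffun 'I_k ->
  'I_n.+1}]]).
  move=> _ [x _ <-]; exists (residue basis n x) => //.
  by apply/translate_eq => //; apply: (multiples_sub idI In); apply: residue_pt1.
exact/finite_image/finite_finset.
Qed.

(** A transversal is encoded by the value 1 of a count, so that [sum_reps] can replace 1 by a sum
    over cosets. Finiteness of the quotient is what makes [ideal_norm] the true index. *)
Lemma reps_exist (I : set A) n : is_ideal I -> I n.+1%:R ->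
  exists s : seq A, (forall x, count (fun c => `[< I (x - c) >]) s = 1%N) /\ size s = ideal_norm I.
Proof.
move=> idI In; have fin := finite_cosets idI In.
exists [seq xget 0 C | C <- fset_set (cosets I)]; split; last by rewrite size_map.
move=> x; rewrite count_map.
rewrite (@eq_in_count _ _ (pred1 (translate I x))).
  rewrite count_uniq_mem ?fset_uniq //.
  suff -> : translate I x \in fset_set (cosets I) by [].
  by rewrite in_fset_set // inE; exists x.
move=> C; rewrite in_fset_set // inE => -[y _ <-] /=.
have : translate I y (xget 0 (translate I y)).
  by apply: xgetPex; exists y; apply/translateP; rewrite subrr; apply: idl0.
rewrite -/(translate I y); set c := xget _ _ => /translateP hc.
apply/asboolP/eqP => [h|/esym/(translate_eq _ _ idI) h].
  apply/esym/(translate_eq _ _ idI).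
  by rewrite -(subrK c x) -addrA; apply: idlD.
by rewrite -(subrK y x) -addrA; apply: idlD; [|apply: h|apply: idlBC].
Qed.

Section CosetCount.
Variables (I : set A) (idI : is_ideal I) (n : nat) (In : I n.+1%:R).
Variables (s : seq A) (hs : forall x, count (fun c => `[< I (x - c) >]) s = 1%N).

Lemma sum_reps (x : A) : (\sum_(c <- s) `[< I (x - c)%R >] = 1)%N.
Proof. by rewrite -(hs x) -sum1_count [RHS]big_mkcond; apply: eq_bigr => c _; case: asboolP. Qed.

Lemma cnt1E c N (B : set A) : cnt1 c N B = cnt e c N [set v : 'rV[A]_1 | forall i, B (v 0 i)].
Proof. by rewrite (cnt_prod e c N (fun=> B)) big_ord1. Qed.

Lemma cnt1_shift (B : set A) x : (forall y z, multiples n.+1 (y - z) -> B y -> B z) ->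
  cnt1 0 n.+1 [set y | B (y - x)] = cnt1 0 n.+1 B.
Proof.
move=> hB; rewrite !cnt1E.
rewrite -(cnt_bij basis (T := [set v : 'rV_1 | forall i,
  B (v 0 i)]) (f := fun v => v - const_mx x) (g := fun v => v + const_mx x)).
- by congr cnt; apply/seteqP; split=> v /= h i; have := h i; rewrite !mxE.
- by move=> v; rewrite subrK.
- by move=> v w h i; move: (h i); rewrite !mxE; congr multiples; ring.
- by move=> v w h i; move: (h i); rewrite !mxE; congr multiples; ring.
- by move=> v w h hv i; apply: (hB (v 0 i)).
Qed.

Lemma ideal_periodic1 (J : set A) : is_ideal J -> J n.+1%:R ->
  forall y z, multiples n.+1 (y - z) -> J y -> J z.
Proof. by move=> idJ Jn y z h; rewrite (idl_congr idJ (multiples_sub idJ Jn h)). Qed.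

Lemma cnt1_ideal : (cnt1 0 n.+1 I * size s = n.+1 ^ k)%N.
Proof.
have <- : (\sum_(c <- s) cnt1 0%R n.+1 [set y | I (y - c)%R] = n.+1 ^ k)%N.
  rewrite exchange_big /=.
  under eq_bigr do rewrite sum_reps.
  by rewrite sum1_card card_ffun !card_ord.
under eq_bigr => c _ do rewrite (cnt1_shift _ (ideal_periodic1 idI In)).
by rewrite big_const_seq count_predT iter_addn_0.
Qed.
End CosetCount.
End Cosets.

(** * Translates of polynomials *)

Section Shift.
Variables (A : comNzRingType) (d : nat).
Implicit Types (f g : {poly A}) (b c : A) (v w : 'rV[A]_d.+1).

Lemma coef_comp_ideal (I : set A) f g : is_ideal I ->
  (forall i, I f`_i) -> forall i, I (f \Po g)`_i.
Proof.
by move=> idI hf i; rewrite coef_comp_poly; apply: (idl_sum idI) => j _; apply: idlMr.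
Qed.

Lemma size_shift f b : (size (f \Po ('X + b%:P)) <= size f)%N.
Proof.
case: (eqVneq f 0) => [->|f0]; first by rewrite comp_poly0.
apply: leq_trans (size_comp_poly_leq _ _) _.
by rewrite size_XaddC muln1 prednK // lt0n size_poly_eq0.
Qed.

Lemma lead_shift f b : (size f <= d.+1)%N -> (f \Po ('X + b%:P))`_d = f`_d.
Proof.
move=> sf; rewrite coef_comp_poly.
have mon i : (('X + b%:P) ^+ i)`_i = 1.
  have : ('X + b%:P) ^+ i \is monic by rewrite monic_exp // monicXaddC.
  move=> /monicP <-; rewrite lead_coefE; congr (_`_ _).
  by rewrite -[b]opprK polyCN size_exp_XsubC.
have small i : (i < d)%N -> (('X + b%:P) ^+ i)`_d = 0.
  by move=> id; rewrite nth_default // -[b]opprK polyCN size_exp_XsubC.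
case: (ltngtP (size f) d.+1) sf => // [sf _|sf _].
  rewrite [RHS]nth_default //; apply: big1 => i _; rewrite small ?mulr0 //.
  exact: leq_trans (ltn_ord i) sf.
rewrite sf big_ord_recr /= mon mulr1 big1 ?add0r // => i _.
by rewrite small ?mulr0 //=.
Qed.

Lemma const_shift f b : (f \Po ('X + b%:P))`_0 = f.[b].
Proof. by rewrite -horner_coef0 horner_comp hornerD hornerX hornerC add0r. Qed.

Lemma shift_congr (I : set A) f c i : is_ideal I -> I c ->
  I ((f \Po ('X + c%:P))`_i - f`_i).
Proof.
move=> idI Ic; rewrite -{2}(comp_polyXr f) !comp_polyE -coefB -sumrB coef_sum.
apply: (idl_sum idI) => j _; rewrite -scalerBr coefZ; apply: (idlM idI).
by rewrite subrXX addrAC subrr add0r coefCM; apply: idlMr.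
Qed.

Definition row_shift b v : 'rV[A]_d.+1 := poly_rV (rVpoly v \Po ('X + b%:P)).

Lemma size_rVpoly v : (size (rVpoly v) <= d.+1)%N. Proof. exact: size_poly. Qed.

Lemma rVpoly_shift b v : rVpoly (row_shift b v) = rVpoly v \Po ('X + b%:P).
Proof. by rewrite poly_rV_K // (leq_trans (size_shift _ _)) ?size_rVpoly. Qed.

Lemma shiftK b : cancel (row_shift b) (row_shift (- b)).
Proof. by move=> v; rewrite /row_shift rVpoly_shift polyCN comp_polyXaddC_K rVpolyK. Qed.

Lemma shiftD b c v : row_shift c (row_shift b v) = row_shift (b + c) v.
Proof.
rewrite /row_shift rVpoly_shift -comp_polyA; congr (poly_rV (_ \Po _)).
by rewrite comp_polyD comp_polyX comp_polyC polyCD addrAC addrA.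
Qed.

Lemma shift_congm (I : set A) b v w : is_ideal I -> congm I v w ->
  congm I (row_shift b v) (row_shift b w).
Proof.
move=> idI h i; have -> : row_shift b v 0 i - row_shift b w 0 i = (rVpoly (v - w) \Po ('X +
  b%:P))`_i.
  by rewrite -!coef_rVpoly_ord !rVpoly_shift linearB comp_polyB coefB.
apply: coef_comp_ideal => // j; rewrite coef_rVpoly; case: insub => [j'|]; last exact: idl0.
by rewrite !mxE; apply: h.
Qed.
End Shift.

(** * Local densities *)

Section Local.
Variables (A : comNzRingType) (k : nat) (e : 'I_k -> A).
Hypothesis basis : forall x : A, exists! a : {ffun 'I_k -> int}, x = \sum_j e j *~ a j.
Hypothesis domain : forall x y : A, x * y = 0 -> x = 0 \/ y = 0.
Hypothesis normal : forall (b w : A) (n i j : nat), (0 < n)%N -> (i < j)%N ->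
  b ^+ j = b ^+ i * n%:R ^+ (j - i) + w * n%:R ^+ j -> multiples n b.
Local Notation cnt1 := (cnt1 e).
Local Notation cnt := (cnt e).

Variables (p : set A) (pp : is_prime p).
Local Notation p2 := (ideal_mul p p).
Local Notation q := (ideal_norm p).
Let idp : is_ideal p. Proof. by case: pp. Qed.
Let p1 : ~ p 1. Proof. by case: pp. Qed.
Let pM x y : p (x * y) -> p x \/ p y. Proof. by case: pp => _ _ h _; apply: h. Qed.
Let idp2 : is_ideal p2 := sq_ideal pp.
Let p2p x : p2 x -> p x := @sq_sub A p pp x.

Lemma cnt1_setD c N (B C : set A) : C `<=` B ->
  (cnt1 c N C + cnt1 c N (B `\` C) = cnt1 c N B)%N.
Proof.
move=> CB; rewrite -big_split; apply: eq_bigr => r _ /=.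
case: (asboolP (C _)) => [hC|hC].
  by case: asboolP => [[]//|_]; case: asboolP => // -[]; apply: CB.
case: asboolP => [[hB _]|h2]; first by case: asboolP.
by case: asboolP => // hB; case: h2.
Qed.

Lemma reps_prime : exists s : seq A,
  (forall x, count (fun c => `[< p (x - c) >]) s = 1%N) /\ size s = ideal_norm p.
Proof.
have [l lp pl] := prime_nat basis domain pp.
by apply: (reps_exist basis (n := l.-1)) => //; rewrite prednK // prime_gt0.
Qed.

Lemma cnt1_prime n : p n.+1%:R -> (cnt1 0 n.+1 p * q = n.+1 ^ k)%N.
Proof. by have [s [hs <-]] := reps_prime; move=> pn; apply: cnt1_ideal. Qed.

(** The integers 0, ..., l - 1 are pairwise incongruent modulo [p], so each representative accounts
    for at most one of them. *)
Lemma prime_le_norm l : prime l -> p l%:R -> (l <= q)%N.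
Proof.
move=> lp pl; have [s [hs <-]] := reps_prime.
have -> : l = (\sum_(i < l) \sum_(c <- s) `[< p (i%:R - c)%R >])%N.
  by under eq_bigr do rewrite (sum_reps hs); rewrite sum1_card card_ord.
rewrite exchange_big /= -sum1_size; apply: leq_sum => c _.
rewrite -big_mkcond sum1_card; apply/card_le1_eqP => i j.
rewrite -!topredE /= => /asboolP hi /asboolP hj.
have h : p (i%:R - j%:R) by rewrite -(subrKA c) addrC -opprB; have := idlB idp hi hj; congr p; ring.
have := @prime_dvdz A p pp l lp pl (i%:Z - j%:Z); rewrite rmorphB /= => /(_ h) hl.
apply/val_inj/eqP; rewrite -eqz_nat.
move: hl; rewrite -eqz_mod_dvd !modz_small //= ?ltz_nat ?ltn_ord // => /eqP -> //.
Qed.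

Lemma norm_gt1 : (1 < q)%N.
Proof.
have [l lp pl] := prime_nat basis domain pp.
exact: leq_trans (prime_gt1 lp) (prime_le_norm lp pl).
Qed.

(** With [pi] from [uniformizerP], the products pi c represent p modulo p^2 when c runs through
    representatives modulo p. *)
Lemma cnt1_sq n : p2 n.+1%:R -> (cnt1 0 n.+1 p2 * q = cnt1 0 n.+1 p)%N.
Proof.
move=> p2n; have [s [hs <-]] := reps_prime.
have [l lp pl] := prime_nat basis domain pp.
have [pi [ppi h1 h2]] := uniformizerP basis pp lp pl normal.
have -> : cnt1 0 n.+1 p = (\sum_(c <- s) cnt1 0%R n.+1 [set x | p2 (x - pi * c)%R])%N.
  rewrite exchange_big; apply: eq_bigr => r _ /=; set x := pt1 _ _ _.
  case: asboolP => [px|px].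
    have [y hy] := h2 _ px; apply: etrans (esym (sum_reps hs y)) _; apply: eq_bigr => c _.
    congr (nat_of_bool _); apply: asbool_equiv_eq.
    have -> : x - pi * c = x - pi * y + pi * (y - c) by ring.
    split=> h; first by apply: (idlD idp2) => //; apply: sq_mul.
    by apply: h1; move: (idlB idp2 h hy); congr p2; ring.
  rewrite big1 // => c _; case: asboolP => // /p2p h; case: px.
  by rewrite -(subrK (pi * c) x); apply: (idlD idp) => //; apply: (idlMr idp).
under eq_bigr => c _ do rewrite (cnt1_shift basis _ (ideal_periodic1 idp2 p2n)).
by rewrite big_const_seq count_predT iter_addn_0.
Qed.

Variable d : nat.
Hypothesis d1 : (1 < d)%N.

(** Reading the leading coefficient at the fixed index [d] avoids a degree condition, as an element
    outside [p] is nonzero. [shifted_eisenstein_setE] reconciles this with the definition by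
    degree. *)
Definition eis_poly (f : {poly A}) : Prop :=
  [/\ ~ p f`_d, (forall i, (i < d)%N -> p f`_i) & ~ p2 f`_0].

(** The constant term becomes f(c), and a_i c^i lies in p^2 for every i > 0: for i < d both factors
    are in [p], and for i = d because d >= 2. *)
Lemma eis_shift (f : {poly A}) c : (size f <= d.+1)%N -> p c -> eis_poly f ->
  eis_poly (f \Po ('X + c%:P)).
Proof.
move=> sf pc [h1 h2 h3]; split; first by rewrite lead_shift.
  move=> i id; rewrite -(subrK f`_i (_ \Po _)`_i); apply: (idlD idp); last exact: h2.
  exact: shift_congr.
move=> h; apply: h3; apply/(idl_congr idp2 (x := f.[c])); last by rewrite -const_shift.
rewrite (horner_coef_wide _ sf) big_ord_recl expr0 mulr1 addrC addKr.
apply: (idl_sum idp2) => i _; rewrite lift0.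
case: (ltngtP i.+1 d) => [id|id|id].
- by rewrite exprS; apply: sq_mul; [apply: h2 | apply: (idlMr idp)].
- by have := ltn_ord i; rewrite ltnNge -ltnS id.
- apply: (idlM idp2); rewrite id -(subnKC d1) addSn add1n !exprS mulrA.
  by apply: (idlMr idp2); apply: sq_mul.
Qed.

(** Modulo [p] the polynomial is a_d X^d, so the new constant term is a_d b^d. With [eis_shift] this
    shows that the admissible shifts, if there are any, form exactly one class modulo [p]. *)
Lemma eis_unique (f : {poly A}) b : (size f <= d.+1)%N -> eis_poly f ->
  eis_poly (f \Po ('X + b%:P)) -> p b.
Proof.
move=> sf [h1 h2 _] [_ h3 _].
have := h3 0%N (ltnW d1); rewrite const_shift (horner_coef_wide _ sf) big_ord_recr /=.
set S := \sum_(_ < _) _; have hS : p S.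
  by apply: (idl_sum idp) => i _; apply: (idlMr idp); apply: h2.
move=> /(idlB idp) /(_ hS); rewrite [S + _]addrC addrK => /pM [] // /primeX; exact.
Qed.

Definition eis_set : set 'rV[A]_d.+1 := [set v | eis_poly (rVpoly v)].
Definition shifted_eis_set : set 'rV[A]_d.+1 := [set v | exists b, eis_set (row_shift b v)].

Lemma eis_setE : eis_set = [set v | forall i : 'I_d.+1,
  (if i == ord_max then ~` p else if i == ord0 then p `\` p2 else p) (v 0 i)].
Proof.
apply/seteqP; split=> v.
  move=> [h1 h2 h3] i; have := h2 i; rewrite -coef_rVpoly_ord.
  case: eqP => [->//|/eqP im]; rewrite ltn_neqAle -ltnS ltn_ord andbT => /(_ im) hp.
  by case: eqP => // i0; split; rewrite ?i0 //; apply: h2; apply: ltnW.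
move=> h; split.
- by have := h ord_max; rewrite eqxx -coef_rVpoly_ord.
- move=> i id; have id' := ltnW (id : (i.+1 < d.+1)%N).
  have := h (Ordinal id'); rewrite -coef_rVpoly_ord /= -val_eqE /= (ltn_eqF id).
  by case: ifP => // _ [].
- by have := h ord0; rewrite -coef_rVpoly_ord /= -val_eqE /= (ltn_eqF (ltnW d1)) => -[].
Qed.

Lemma eis_periodic : periodic_mod p2 eis_set.
Proof.
have step v w (T : set A) i (J : set A) : is_ideal J -> (forall x, p2 x -> J x) ->
    congm p2 v w -> J (v 0 i) -> J (w 0 i).
  by move=> idJ hJ h; apply: (idl_congr idJ (hJ _ (h i))).2.
move=> v w h; have h' := congmC idp2 h; rewrite eis_setE => hv i; have := hv i.
case: eqP => _; first by move=> hn hw; apply: hn; apply: step h' hw.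
by case: eqP => _; [case=> h1 h2; split; [|move=> h3; apply: h2] |]; apply: step => //.
Qed.

Lemma shifted_eis_periodic : periodic_mod p2 shifted_eis_set.
Proof.
by move=> v w h [b hb]; exists b; apply: eis_periodic hb; apply: shift_congm.
Qed.

Lemma cnt_eis n : cnt 0 n eis_set =
  (cnt1 0 n (p `\` p2) * cnt1 0 n p ^ d.-1 * cnt1 0 n (~` p))%N.
Proof.
rewrite eis_setE (cnt_prod e 0 n (fun i : 'I_d.+1 =>
  if i == ord_max then ~` p else if i == ord0 then p `\` p2 else p)) big_ord_recr eqxx;
    congr (_ * _)%N.
case: d d1 => [|[|d']] // _; rewrite big_ord_recl /=; congr (_ * _)%N.
by rewrite -[d'.+1 in RHS]card_ord -prod_nat_const; apply: eq_bigr => i _;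
  rewrite -!val_eqE /= /bump /= add1n !eqSS (ltn_eqF (ltn_ord i)).
Qed.

Lemma cnt_shifted_eis n : p2 n.+1%:R ->
  cnt 0 n.+1 shifted_eis_set = (q * cnt 0 n.+1 eis_set)%N.
Proof.
move=> p2n; have [s [hs <-]] := reps_prime.
have -> : cnt 0 n.+1 shifted_eis_set = (\sum_(c <- s) cnt 0%R n.+1 [set v | eis_set (row_shift c
  v)])%N.
  rewrite exchange_big; apply: eq_bigr => r _ /=; set v := pt _ _ _.
  case: asboolP => [[b hb]|hN]; last first.
    by rewrite big1 // => c _; case: asboolP => // h; case: hN; exists c.
  apply: etrans (esym (sum_reps hs b)) _; apply: eq_bigr => c _.
  congr (nat_of_bool _); apply: asbool_equiv_eq.
  have E : rVpoly (row_shift c v) = rVpoly (row_shift b v) \Po ('X + (c - b)%:P).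
    by rewrite -rVpoly_shift shiftD addrC subrK.
  split=> h.
    by suff : eis_poly (rVpoly (row_shift c v)) by []; rewrite E; apply: eis_shift;
      rewrite ?size_rVpoly //; apply: idlBC.
  apply: (idlBC idp); apply: (@eis_unique (rVpoly (row_shift b v))); rewrite ?size_rVpoly //.
  by rewrite -E.
have nsub x : multiples n.+1 x -> p2 x by apply: multiples_sub.
transitivity (\sum_(c <- s) cnt 0%R n.+1 eis_set)%N; last first.
  by rewrite big_const_seq count_predT iter_addn_0 mulnC.
apply: eq_bigr => c _; apply: (cnt_bij basis (shiftK c)).
- by move=> v w; apply: shift_congm; apply: multiples_ideal.
- by move=> v w; apply: shift_congm; apply: multiples_ideal.
- exact: periodic_sub eis_periodic.
Qed.

Lemma density_shifted_eis n : p2 n.+1%:R ->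
  (cnt 0 n.+1 shifted_eis_set * q ^ d.+1 = q.-1 ^ 2 * n.+1 ^ (d.+1 * k))%N.
Proof.
move=> p2n; rewrite cnt_shifted_eis // cnt_eis.
have h1 := cnt1_prime (p2p p2n); have h2 := cnt1_sq p2n.
have hC : (cnt1 0 n.+1 p + cnt1 0 n.+1 (~` p) = n.+1 ^ k)%N.
  by rewrite -(cnt1_setT e 0) -(@cnt1_setD 0 n.+1 setT p) ?setTD.
have hD := cnt1_setD 0 n.+1 p2p.
move: h1 h2 hC hD.
set P := cnt1 _ _ p; set Q := cnt1 _ _ p2; set X := cnt1 _ _ (~` p); set Y := cnt1 _ _ (_ `\` _).
have -> : (n.+1 ^ (d.+1 * k) = (n.+1 ^ k) ^ d.+1)%N by rewrite -expnM mulnC.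
set N := (n.+1 ^ k)%N; have := norm_gt1; case: q => // r _ /= h1 h2 hC hD.
have hX : (X * r.+1 = N * r)%N by nia.
have hY : (Y * r.+1 ^ 2 = N * r)%N by nia.
case: d d1 => [|[|d']] // _ /=.
have -> : (r.+1 * (Y * P ^ d'.+1 * X) * r.+1 ^ d'.+3 =
  (Y * r.+1 ^ 2) * (P * r.+1) ^ d'.+1 * (X * r.+1))%N by rewrite expnMn !expnS; nia.
by rewrite h1 hX hY !expnS; nia.
Qed.
End Local.

(** * Independence of distinct primes *)

Section Comaximal.
Variables (A : comNzRingType) (k : nat) (e : 'I_k -> A).
Hypothesis basis : forall x : A, exists! a : {ffun 'I_k -> int}, x = \sum_j e j *~ a j.
Hypothesis domain : forall x y : A, x * y = 0 -> x = 0 \/ y = 0.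
Local Notation cnt := (cnt e).

Lemma prime_maximal (p p' : set A) : is_prime p -> is_prime p' -> p `<=` p' -> p = p'.
Proof.
move=> pp pp' sub; apply/seteqP; split=> // x p'x; apply: contrapT => px.
have [l lp pl] := prime_nat basis domain pp.
have [y hy] := prime_inv basis pp lp pl px.
case: pp' => idp' n1 _ _; apply: n1.
by rewrite -(subKr (x * y) 1); apply: (idlB idp'); [apply: idlMr | apply: sub].
Qed.

Lemma comaximal (p p' : set A) : is_prime p -> is_prime p' -> p != p' ->
  exists u w, [/\ ideal_mul p p u, ideal_mul p' p' w & u + w = 1].
Proof.
move=> pp pp' ne; have [a pa p'a] : exists2 a, p a & ~ p' a.
  apply: contrapT => hN; case/eqP: ne; apply: (prime_maximal pp pp') => x px.
  by apply: contrapT => hx; apply: hN; exists x.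
have [l lp pl] := prime_nat basis domain pp'.
have [y hy] := prime_inv basis pp' lp pl p'a.
have idp2 := sq_ideal pp; have idp2' := sq_ideal pp'.
set t := a * y - 1 in hy; set s := a * y.
have ps : p s by apply: idlMr => //; case: pp.
(* The cubic 3 s ^ 2 - 2 s ^ 3 vanishes to second order at 0 and equals 1 to second order at 1. *)
exists (s ^+ 2 * (3%:R - 2%:R * s)), (t ^+ 2 * (2%:R * s + 1)); split.
- by apply: idlMr => //; rewrite expr2; apply: sq_mul.
- by apply: idlMr => //; rewrite expr2; apply: sq_mul.
- by rewrite /t -/s; ring.
Qed.

Lemma comaximal_seq (p : set A) (ps : seq (set A)) : is_prime p ->
  (forall p', p' \in ps -> is_prime p' /\ p != p') ->
  exists u w, [/\ ideal_mul p p u, forall p', p' \in ps -> ideal_mul p' p' w & u + w = 1].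
Proof.
move=> pp; have idp2 := sq_ideal pp.
elim: ps => [|p' ps IH] hps.
  by exists 0, 1; split; rewrite ?add0r //; apply: idl0.
have [pp' ne] := hps _ (mem_head _ _).
have [u1 [w1 [hu1 hw1 E1]]] := comaximal pp pp' ne.
have [|u2 [w2 [hu2 hw2 E2]]] := IH; first by move=> x xs; apply: hps; rewrite inE xs orbT.
exists (u1 + w1 * u2), (w1 * w2); split.
- by apply: idlD => //; apply: idlM.
- move=> x; rewrite inE => /orP [/eqP ->|xs]; first by apply: idlMr => //; apply: sq_ideal.
  have [ppx _] := hps x (mem_behead (s := p' :: ps) xs).
  by apply: (idlM (sq_ideal ppx)); apply: hw2.
- rewrite -E1; transitivity (u1 + w1 * (u2 + w2)); first by ring.
  by rewrite E2 mulr1.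
Qed.

Lemma cnt_prime_indep m n (ps : seq (set A)) (T : set A -> set 'rV[A]_m) : uniq ps ->
  (forall p, p \in ps -> [/\ is_prime p, ideal_mul p p n.+1%:R & periodic_mod (ideal_mul p p) (T
    p)]) ->
  ((\prod_(p <- ps) cnt 0%R n.+1 (T p)) * n.+1 ^ (m * k) =
   cnt 0%R n.+1 [set v | forall p, p \in ps -> T p v] * (n.+1 ^ (m * k)) ^ size ps)%N.
Proof.
elim: ps => [_ _|p ps IH /= /andP [pps ups] hps].
  rewrite big_nil /= mul1n muln1 -(cnt_setT e m 0); congr cnt.
  by apply/seteqP; split.
have [pp pn pT] := hps _ (mem_head _ _).
have hps' x : x \in ps ->
    [/\ is_prime x, ideal_mul x x n.+1%:R & periodic_mod (ideal_mul x x) (T x)].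
  by move=> xs; apply: hps; rewrite inE xs orbT.
have [|u [w [hu hw uw]]] := @comaximal_seq p ps pp.
  by move=> x xs; have [? _ _] := hps' x xs; split=> //; apply: contraNneq pps => ->.
pose I2 : set A := [set x | forall p', p' \in ps -> ideal_mul p' p' x].
have id2 : is_ideal I2.
  split=> [p' h|x y hx hy p' h|a x hx p' h]; have [pp' _ _] := hps' _ h.
  - exact: (idl0 (sq_ideal pp')).
  - by apply: (idlD (sq_ideal pp')); [exact: hx | exact: hy].
  - by apply: (idlM (sq_ideal pp')); exact: hx.
have I2n : I2 n.+1%:R by move=> x xs; have [] := hps' _ xs.
have pT2 : periodic_mod I2 [set v | forall p, p \in ps -> T p v].
  move=> v v' hv h x xs; have [_ _ hx] := hps' _ xs; apply: hx (h x xs) => i.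
  exact: (hv i x xs).
have H := cnt_indep basis (sq_ideal pp) id2 hu hw uw pn I2n pT pT2.
rewrite big_cons -mulnA IH // mulnA H.
rewrite expnS -mulnA; congr (_ * _)%N; congr cnt.
apply/seteqP; split=> v /=.
  by move=> [h1 h2] x; rewrite inE => /orP [/eqP ->|/h2].
by move=> h; split=> [|x xs]; apply: h; rewrite inE ?eqxx ?xs ?orbT.
Qed.
End Comaximal.

(** * Heights and packing *)

Section Height.
Variables (A : comNzRingType) (k : nat) (e : 'I_k -> A).
Hypothesis basis : forall x : A, exists! a : {ffun 'I_k -> int}, x = \sum_j e j *~ a j.
Hypothesis domain : forall x y : A, x * y = 0 -> x = 0 \/ y = 0.
Local Notation cnt := (cnt e).
Local Notation cnt1 := (cnt1 e).
Local Notation coords := (coords basis).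

Lemma rank_gt0 : (0 < k)%N.
Proof.
case: k e basis => // e0 b0; case/eqP: (oner_neq0 A).
by have [a [-> _]] := b0 1; rewrite big_ord0.
Qed.

Lemma coordsDE x y j : coords (x + y) j = coords x j + coords y j.
Proof. by rewrite (coordsD basis) ffunE. Qed.
Lemma coordsBE x y j : coords (x - y) j = coords x j - coords y j.
Proof. by rewrite (coordsB basis) ffunE ffunE. Qed.
Lemma coords_pt1 c N (r : {ffun 'I_k -> 'I_N}) j : coords (pt1 e c r) j = (r j)%:Z + c.
Proof. by rewrite (lincombK basis) ffunE. Qed.

Lemma coords_ext x y : (forall j, coords x j = coords y j) -> x = y.
Proof. by move=> h; apply: (coords_inj (basis := basis)); apply/ffunP. Qed.

Definition height (x : A) : nat := \max_j `|coords x j|%N.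

Lemma heightP x c : reflect (forall j, `|coords x j| <= c)%N (height x <= c)%N.
Proof. by apply: (iffP (bigmax_leqP _ _ _)) => h j; [exact: (h j isT) | move=> _; exact: h]. Qed.
Lemma height_co x j : (`|coords x j| <= height x)%N.
Proof. exact: (leq_bigmax (F := fun j => `|coords x j|%N)). Qed.

Lemma heightD x y : (height (x + y) <= height x + height y)%N.
Proof.
apply/heightP => j; rewrite coordsDE.
by have := height_co x j; have := height_co y j; lia.
Qed.
Lemma height0 : height 0 = 0%N.
Proof. by apply/eqP; rewrite -leqn0; apply/heightP => j; rewrite (coords0 basis) ffunE. Qed.
Lemma heightMz x (z : int) : (height (x *~ z) <= `|z| * height x)%N.
Proof.
by apply/heightP => j; rewrite (coordsMzE basis) abszM leq_mul2l height_co orbT.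
Qed.
Lemma height_sum (I : Type) (s : seq I) (F : I -> A) :
  (height (\sum_(i <- s) F i) <= \sum_(i <- s) height (F i))%N.
Proof.
elim: s => [|i s IH]; first by rewrite !big_nil height0.
by rewrite !big_cons; apply: leq_trans (heightD _ _) _; rewrite leq_add2l.
Qed.
Lemma heightMn x n : height (n%:R * x) = (n * height x)%N.
Proof.
rewrite /height (big_morph (muln n) (op1 := maxn) (id1 := 0%N)) ?muln0 //; last exact: maxnMr.
by apply: eq_bigr => j _; rewrite (coordsMnE basis) abszM.
Qed.
(** Sum of the heights of the products of basis elements; the successor keeps it positive. *)
Definition heightC : nat := (\sum_i \sum_j height (e i * e j)).+1.

Lemma heightM x y : (height (x * y) <= heightC * (height x * height y))%N.
Proof.
have {1}-> : x * y = \sum_i \sum_j (e i * e j) *~ (coords x i * coords y j).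
  rewrite -{1}(coordsK basis x) -{1}(coordsK basis y) /lincomb mulr_suml; apply: eq_bigr => i _.
  rewrite mulr_sumr; apply: eq_bigr => j _.
  by rewrite mulrzAl mulrzAr -mulrzA (mulrC (coords y j)).
apply: leq_trans (height_sum _ _) _.
apply: (@leq_trans (\sum_i \sum_j height (e i * e j) * (height x * height y))%N).
  apply: leq_sum => i _; apply: leq_trans (height_sum _ _) _; apply: leq_sum => j _.
  apply: leq_trans (heightMz _ _) _; rewrite abszM mulnC leq_mul2l.
  by rewrite leq_mul ?height_co ?orbT.
under eq_bigr do rewrite -big_distrl.
by rewrite -big_distrl /= leq_mul2r leqnSn orbT.
Qed.

(* Round the coordinates of z / g. *)
Lemma small_representative g z : g != 0 -> exists z' t,
  z = z' + g * t /\ (height z' <= heightC * height g)%N.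
Proof.
move=> g0; have [n n0 [h hn]] := exists_multiple basis domain g0.
pose t := lincomb e [ffun j => (coords (z * h) j %/ n)%Z];
  pose r := lincomb e [ffun j => (coords (z * h) j %% n)%Z].
have hz : z * h = n%:R * t + r.
  apply: coords_ext => j.
  by rewrite coordsDE (coordsMnE basis) /t /r !(lincombK basis) !ffunE [n%:Z * _]mulrC -divz_eq.
exists (z - g * t), t; split; first by rewrite subrK.
have E : n%:R * (z - g * t) = r * g.
  have -> : r = z * h - n%:R * t by rewrite hz addrC addKr.
  by rewrite -hn; ring.
have rn : (height r <= n)%N.
  apply/heightP => j; rewrite (lincombK basis) ffunE; have nz : n%:Z != 0 by case: (n) n0.
  by rewrite -lez_nat gez0_abs ?modz_ge0 // ltW // ltz_pmod.
rewrite -(leq_pmul2l n0) -heightMn E; apply: leq_trans (heightM _ _) _.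
by rewrite mulnCA leq_mul2r rn orbT.
Qed.

Lemma pt1_onto (c : int) N x : (forall j, c <= coords x j < c + N%:Z) ->
  exists r : {ffun 'I_k -> 'I_N}, pt1 e c r = x.
Proof.
case: N => [|N] h.
  by have := h (Ordinal rank_gt0); rewrite addr0 => /andP [h1 h2]; have := le_lt_trans h1 h2;
    rewrite ltxx.
exists [ffun j => inord `|coords x j - c|%N]; apply: coords_ext => j.
rewrite coords_pt1 ffunE inordK; have /andP [h1 h2] := h j; lia.
Qed.

Lemma height_onto C x : (height x <= C)%N -> exists r : {ffun 'I_k ->
  'I_(2 * C).+1}, pt1 e (- C%:Z) r = x.
Proof.
by move=> /heightP h; apply: pt1_onto => j; have := h j; lia.
Qed.

(** The intersection J of the primes contains gA, and every class modulo g has a representative of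
    height at most heightC * height g. So A / J has at most (2 heightC height g + 1)^k elements,
    while its order is the product of the norms by independence. *)
Lemma prod_norm_le g (ps : seq (set A)) : g != 0 -> uniq ps ->
  (forall p, p \in ps -> is_prime p /\ p g) ->
  (\prod_(p <- ps) ideal_norm p <= (2 * (heightC * height g) + 1) ^ k)%N.
Proof.
move=> g0 ups hps; set C := (heightC * height g)%N.
have [n0 n00 [h hn]] := exists_multiple basis domain g0.
(* [g] divides [n0], so [n0] lies in every prime of the list and its square in the square of each,
   as [cnt_prime_indep] requires. *)
pose n := (n0 ^ 2).-1; have n1 : n.+1 = (n0 * n0)%N by rewrite prednK // expn_gt0 n00.
have p2n p : p \in ps -> ideal_mul p p n.+1%:R.
  move=> /hps [pp pg]; rewrite n1 natrM -hn mulrACA.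
  by apply: (idlMr (sq_ideal pp)); apply: sq_mul.
pose J : set A := [set x | forall p, p \in ps -> p x].
have idJ : is_ideal J.
  split=> [p hp|x y hx hy p hp|a x hx p hp]; have [[idp _ _ _] _] := hps p hp.
  - exact: idl0.
  - by apply: idlD; [|exact: hx|exact: hy].
  - by apply: idlM; [|exact: hx].
have Jn : J n.+1%:R.
  by move=> p hp; have [pp _] := hps p hp; apply: sq_sub (p2n p hp).
have H1 : (n.+1 ^ k <= (2 * C).+1 ^ k * cnt1 0%R n.+1 J)%N.
  have -> : ((2 * C).+1 ^ k * cnt1 0%R n.+1 J = \sum_(r : {ffun 'I_k -> 'I_(2 * C).+1})
      cnt1 0%R n.+1 [set x | J (x - pt1 e (- C%:Z) r)%R])%N.
    under eq_bigr => r _ do rewrite (cnt1_shift basis _ (ideal_periodic1 idJ Jn)).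
    by rewrite sum_nat_const card_ffun !card_ord.
  rewrite exchange_big -(cnt1_setT e 0); apply: leq_sum => r _ /=.
  apply: leq_trans (leq_b1 _) _.
  have [z [t [hz1 hz2]]] := small_representative (pt1 e 0 r) g0.
  have [s hs] := height_onto hz2.
  rewrite (bigD1 s) //= hs; case: asboolP => // -[] p hp.
  rewrite hz1 addrC addKr; have [[idp _ _ _] pg] := hps p hp.
  exact: idlMr.
have H2 : (n.+1 ^ k = cnt1 0%R n.+1 J * \prod_(p <- ps) ideal_norm p)%N.
  have := @cnt_prime_indep A k e basis domain 1 n ps (fun p => [set v | forall i, p (v 0 i)]) ups.
  rewrite mul1n; set Pr := (\prod_(p <- ps) cnt _ _ _)%N => E.
  have E1 : (Pr * \prod_(p <- ps) ideal_norm p = (n.+1 ^ k) ^ size ps)%N.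
    rewrite /Pr -big_split /= big_seq.
    under eq_bigr => p hp do rewrite -cnt1E (cnt1_prime basis domain (hps p hp).1 (Jn p hp)).
    by rewrite -big_seq big_const_seq count_predT iter_muln_1.
  have E2 : cnt 0 n.+1 [set v : 'rV_1 | forall p, p \in ps -> forall i, p (v 0 i)] = cnt1 0 n.+1 J.
    rewrite cnt1E; congr cnt; apply/seteqP; split=> v /= hv.
      by move=> i p hp; apply: hv.
    by move=> p hp i; apply: hv.
  have Npos : (0 < (n.+1 ^ k) ^ size ps)%N by rewrite !expn_gt0.
  rewrite E2 in E; apply/eqP; rewrite -(eqn_pmul2l Npos); apply/eqP.
  rewrite -{1}E1 mulnAC E.
    by rewrite mulnAC [RHS]mulnC.
  move=> p hp; have [pp _] := hps p hp; split=> //; first exact: p2n.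
  move=> v w hvw hv i; have [idp _ _ _] := pp.
  by apply/(idl_congr idp (sq_sub pp (hvw i))); apply: hv.
have J0 : (0 < cnt1 0%R n.+1 J)%N.
  by rewrite lt0n; apply/eqP => J0; move: H2; rewrite J0 mul0n => /eqP; rewrite expn_eq0.
by rewrite -(leq_pmul2l J0) -H2 addn1 mulnC.
Qed.

(** Each norm is at least L, and by [prod_norm_le] their product is at most (2 heightC L^3 + 1)^k,
    which is at most L^(4 k). *)
Lemma few_primes L g (ps : seq (set A)) : (2 * heightC + 1 < L)%N -> g != 0 ->
  (height g <= L ^ 3)%N ->
  uniq ps -> (forall p, p \in ps -> [/\ is_prime p, p g & (L <= ideal_norm p)%N]) ->
  (size ps <= 4 * k)%N.
Proof.
move=> hL g0 hg ups hps.
have L1 : (1 < L)%N by lia.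
rewrite -(leq_exp2l _ _ L1) expnM; apply: (@leq_trans (\prod_(p <- ps) ideal_norm p)%N).
  rewrite -iter_muln_1 -(count_predT ps) -big_const_seq big_seq [leqRHS]big_seq.
  by apply: leq_prod => p /hps [].
apply: leq_trans (prod_norm_le g0 ups _) _; first by move=> p /hps [].
rewrite leq_exp2r ?rank_gt0 //.
have : (0 < L ^ 3)%N by rewrite expn_gt0; lia.
rewrite (expnS L 3); move: hg; set X := (L ^ 3)%N; nia.
Qed.

Lemma cnt1_card c N (T : set A) :
  cnt1 c N T = #|[set r : {ffun 'I_k -> 'I_N} | `[< T (pt1 e c r) >]]%SET|.
Proof. by rewrite -sum1dep_card [RHS]big_mkcond; apply: eq_bigr => r _; case: asboolP. Qed.

(* If [r] is maximal with (2 heightC r + 1)^k < N(p), then [p] has no nonzero element of height at most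
   [r], so the translates of [0, r]^k by elements of [p] are disjoint. *)
Lemma packing p H : is_prime p ->
  (cnt1 (- H%:Z) (2 * H) [set x | p x /\ x != 0%R] * ideal_norm p <= (3 * (2 * heightC + 1) * H) ^
    k)%N.
Proof.
move=> pp; have idp : is_ideal p by case: pp.
have k0 := rank_gt0; have q1 := norm_gt1 basis domain pp.
pose P r := ((2 * (heightC * r) + 1) ^ k < ideal_norm p)%N.
have exP : exists r, P r by exists 0%N; rewrite /P muln0 exp1n.
have bP r : P r -> (r <= ideal_norm p)%N.
  move=> /ltnW; apply: leq_trans; apply: (@leq_trans ((2 * (heightC * r) + 1) ^ 1)%N);
    last by rewrite leq_pexp2l ?addn1.
  by rewrite expn1 /heightC; nia.
case: (ex_maxnP exP bP) => r hr rmax.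
have small x : p x -> (height x <= r)%N -> x = 0.
  move=> px hx; apply/eqP; apply: contraT => x0.
  have := @prod_norm_le x [:: p] x0 isT; rewrite big_seq1 => h.
  have := leq_trans (leq_ltn_trans (h _) _) (leqnn (ideal_norm p)); rewrite ltnn => -> //.
    by move=> p'; rewrite mem_seq1 => /eqP ->.
  apply: leq_ltn_trans hr; rewrite leq_exp2r // leq_add2r leq_mul2l /= leq_mul2l hx orbT //.
(* For H <= r the box contains no nonzero element of [p]; otherwise the sums below stay in a cube of
   side 2 H + r <= 3 H. *)
case: (leqP H r) => Hr.
  rewrite [X in (X * _)%N](_ : _ = 0%N) ?mul0n // /cnt1 big1 // => s _.
  case: asboolP => // -[px /eqP []]; apply: small => //; apply: leq_trans Hr.
  by apply/heightP => j; rewrite coords_pt1; case: (s j) => a /= ha; lia.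
have qle : (ideal_norm p <= ((2 * heightC + 1) * r.+1) ^ k)%N.
  rewrite leqNgt; apply/negP => h; have /rmax : P r.+1; last by rewrite ltnn.
  by apply: leq_ltn_trans h; rewrite leq_exp2r //; nia.
have cle : (cnt1 (- H%:Z) (2 * H) p * r.+1 ^ k <= (3 * H) ^ k)%N.
  apply: (@leq_trans ((2 * H + r) ^ k)%N); last by rewrite leq_exp2r //; lia.
  rewrite cnt1_card; set S := [set _ | _]%SET.
  have <- : #|{: {ffun 'I_k -> 'I_r.+1}}| = (r.+1 ^ k)%N by rewrite card_ffun !card_ord.
  have <- : #|{: {ffun 'I_k -> 'I_(2 * H + r)}}| = ((2 * H + r) ^ k)%N by rewrite card_ffun
    !card_ord.
  rewrite -cardsT -cardsX.
  have lt a b : (a < 2 * H)%N -> (b < r.+1)%N -> (a + b < 2 * H + r)%N by lia.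
  pose f (x : {ffun 'I_k -> 'I_(2 * H)} * {ffun 'I_k -> 'I_r.+1}) : {ffun 'I_k -> 'I_(2 * H + r)} :=
    [ffun j => Ordinal (lt _ _ (ltn_ord (x.1 j)) (ltn_ord (x.2 j)))].
  rewrite -(card_in_imset (f := f)); first exact: max_card.
  move=> [a b] [a' b']; rewrite !inE /= !andbT => /asboolP pa /asboolP pa' /ffunP E.
  have {}E j : (a j + b j = a' j + b' j)%N.
    by have := congr1 val (E j); rewrite !ffunE.
  have Eb : pt1 e 0 b - pt1 e 0 b' = 0.
    apply: small.
      have -> : pt1 e 0 b - pt1 e 0 b' = pt1 e (- H%:Z) a' - pt1 e (- H%:Z) a.
        apply: coords_ext => j.
        rewrite !coordsBE !coords_pt1; move: (E j); case: (a j) => ? /= _; case: (b j) => ? /= _.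
        by case: (a' j) => ? /= _; case: (b' j) => ? /= _; lia.
      exact: idlB.
    apply/heightP => j; rewrite coordsBE !coords_pt1.
    by case: (b j) => ? /= ?; case: (b' j) => ? /= ?; lia.
  have {}Eb j : b j = b' j.
    apply/val_inj/eqP; rewrite -eqz_nat; have := congr1 (fun x => coords x j) Eb.
    rewrite (coords0 basis) coordsBE !coords_pt1 ffunE /=.
    by case: (b j) => ? /= _; case: (b' j) => ? /= _ h; apply/eqP; lia.
  congr (_, _); apply/ffunP => j; last exact: Eb.
  by apply/val_inj; move: (E j); rewrite Eb => /addIn.
apply: (@leq_trans (cnt1 (- H%:Z) (2 * H) p * ((2 * heightC + 1) * r.+1) ^ k)%N).
  apply: leq_mul => //; apply: leq_sum => s _.
  by case: asboolP => // -[? _]; case: asboolP.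
rewrite (mulnAC 3); move: (3 * H)%N cle => X cle.
by rewrite !expnMn mulnCA [leqRHS]mulnC leq_mul2l cle orbT.
Qed.
End Height.

(** * Fibre counts and a growth estimate *)

Section Counting.
(* [get] reads a coordinate and [put] overwrites it: this counts [T] along the coordinate. *)
Lemma lens_count (G W : finType) (get : G -> W) (put : G -> W -> G) (T : pred G) :
  (forall g w, get (put g w) = w) -> (forall g, put g (get g) = g) ->
  (forall g w w', put (put g w) w' = put g w') ->
  (\sum_g #|[pred w | T (put g w)]| = #|W| * #|T|)%N.
Proof.
move=> gp pg pp.
under eq_bigr => g _ do rewrite -sum1_card big_mkcond.
rewrite pair_bigA /=.
pose h (x : G * W) := (put x.1 x.2, get x.1).
have hK : involutive h by move=> [g w]; rewrite /h /= pp pg gp.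
rewrite (reindex_inj (inv_inj hK)) /=.
under eq_bigr => x _ do rewrite inE pp pg.
rewrite -(pair_bigA _ (fun g w => if T g then 1 else 0)%N) exchange_big /= sum_nat_const.
by rewrite -big_mkcond sum1_card.
Qed.

Lemma lens_bound (G W : finType) (get : G -> W) (put : G -> W -> G) (T : pred G) N c :
  (forall g w, get (put g w) = w) -> (forall g, put g (get g) = g) ->
  (forall g w w', put (put g w) w' = put g w') ->
  (forall g, #|[pred w | T (put g w)]| * N <= c)%N -> (#|W| * #|T| * N <= c * #|G|)%N.
Proof.
move=> gp pg pp hT; rewrite -(lens_count T gp pg pp) [leqRHS]mulnC -sum_nat_const big_distrl.
by apply: leq_sum => g _.
Qed.

Lemma fiber_bound (G Y : finType) (S : {set G}) (f : G -> Y) N c :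
  (forall y, #|[set r in S | f r == y]%SET| * N <= c)%N -> (#|S| * N <= #|Y| * c)%N.
Proof.
move=> h; rewrite -[#|S|]sum1_card (partition_big f xpredT) //= big_distrl -sum_nat_const /=.
apply: leq_sum => y _; apply: leq_trans (h y); rewrite leq_mul2r -sum1_card.
by under [leqRHS]eq_bigl do rewrite inE; rewrite leqnn orbT.
Qed.

(** Used with H = 2^t: the number of possible norms of smooth elements is polynomial in log H, hence
    small compared with H. *)
Lemma exp_beats_poly a b s c : exists t, (c * (a + b * t) ^ s < 2 ^ t)%N.
Proof.
(* For t = 2^u it is enough that c + s (a + b + u) <= 2^u, since a + b 2^u <= 2^(a + b + u); the
   choice u = 3 D gives 2^u >= (D + 1)^3. *)
pose D := (c + s * (a + b) + s)%N; pose u := (3 * D)%N; exists (2 ^ u)%N.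
have h1 : (c + s * (a + b + u) <= 2 ^ u)%N.
  apply: (@leq_trans (D.+1 * D.+1 * D.+1)%N); first by rewrite /u /D; nia.
  have := ltn_expl D (isT : 1 < 2)%N; rewrite /u -[3%N]/(1 + 1 + 1)%N !mulnDl mul1n !expnD.
  by move=> h; rewrite !leq_mul.
apply: leq_trans (leq_pexp2l (isT : 0 < 2)%N h1).
rewrite expnD (mulnC s) (expnM 2).
have h2 : (a + b * 2 ^ u <= 2 ^ (a + b + u))%N.
  rewrite expnD; have := ltn_expl (a + b) (isT : 1 < 2)%N.
  have : (0 < 2 ^ u)%N by rewrite expn_gt0.
  by move: (2 ^ u)%N (2 ^ (a + b))%N => X Y; nia.
apply: (@leq_ltn_trans (c * (2 ^ (a + b + u)) ^ s)%N).
  by rewrite leq_mul2l; case: (s) => [|s']; rewrite ?expn0 ?orbT // leq_exp2r ?h2 ?orbT.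
by rewrite ltn_mul2r ltn_expl // andbT !expn_gt0.
Qed.
End Counting.

Lemma horner_char_poly_det (R : comNzRingType) n (M : 'M[R]_n) t :
  (char_poly M).[t] = \det (t%:M - M).
Proof.
rewrite -horner_evalE -det_map_mx; congr determinant; apply/matrixP => i j.
rewrite !mxE -[LHS]/(('X *+ (i == j) - (M i j)%:P).[t]).
by rewrite hornerD hornerN hornerC hornerMn hornerX.
Qed.

(* Up to a nonzero factor, det (M0 + t M1) is a characteristic polynomial evaluated at t. *)
Lemma det_pencil_roots (n : nat) (M0 M1 : 'M[int]_n) (v : int) (s : seq int) : (0 < n)%N ->
  \det M1 != 0 -> uniq s -> {in s, forall t, \det (M0 + t *: M1) = v} -> (size s <= n)%N.
Proof.
move=> n0 d1 us hs.
pose toQ := map_mx (intr : int -> rat).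
have detQ (M : 'M[int]_n) : \det (toQ n n M) = (\det M)%:~R by rewrite det_map_mx.
have d1Q : \det (toQ n n M1) != 0 by rewrite detQ intr_eq0.
have M1u : toQ n n M1 \in unitmx by rewrite unitmxE unitfE.
pose P : {poly rat} := char_poly (- (invmx (toQ n n M1) *m toQ n n M0))
  - (v%:~R / \det (toQ n n M1))%:P.
have sP : size P = n.+1.
  by rewrite size_polyDl size_char_poly // size_polyN (leq_ltn_trans (size_polyC_leq1 _)).
rewrite -ltnS -sP -(size_map (intr : int -> rat)); apply: max_poly_roots.
- by rewrite -size_poly_gt0 sP.
- apply/allP => _ /mapP [t ts ->]; rewrite /root hornerD hornerN hornerC horner_char_poly_det.
  rewrite opprK subr_eq0 eq_sym -(inj_eq (mulfI d1Q)) mulrCA divff // mulr1 -det_mulmx.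
  rewrite mulmxDr mulmxA mulmxV // mul1mx mul_mx_scalar -(hs t ts) -detQ.
  by apply/eqP; congr determinant; apply/matrixP => i j; rewrite !mxE rmorphD rmorphM addrC.
- by rewrite map_inj_uniq // ; apply: intr_inj.
Qed.

(** * Values of the norm form *)

Section Norms.
Variables (A : comNzRingType) (k : nat) (e : 'I_k -> A).
Hypothesis basis : forall x : A, exists! a : {ffun 'I_k -> int}, x = \sum_j e j *~ a j.
Hypothesis domain : forall x y : A, x * y = 0 -> x = 0 \/ y = 0.
Local Notation cnt1 := (cnt1 e).
Local Notation coords := (coords basis).
Local Notation mulmat := (mulmat basis).
Local Notation normA := (normA basis).
Local Notation height := (height basis).

Lemma mulmatD x y : mulmat (x + y) = mulmat x + mulmat y.
Proof. by apply/matrixP => i j; rewrite !mxE mulrDl coordsDE. Qed.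
Lemma mulmatMz x t : mulmat (x *~ t) = t *: mulmat x.
Proof. by apply/matrixP => i j; rewrite !mxE mulrzAl (coordsMzE basis). Qed.

Lemma basis_neq0 j : e j != 0.
Proof.
apply/eqP => ej; have /ffunP/(_ j) := lincombK basis [ffun i => (i == j)%:Z].
rewrite /lincomb (bigD1 j) //= big1 => [|i ij]; rewrite ?ffunE ?(negPf ij) ?eqxx //.
by rewrite ej mul0rz addr0 (coords0 basis) ffunE.
Qed.

(** When all coordinates but one are fixed, the norm is the determinant of a pencil M0 + t M1 whose
    M1 is the matrix of a basis element, hence nonsingular; [det_pencil_roots] allows at most k
    values of t. *)
Lemma card_norm_eq c N v :
  (#|[set r : {ffun 'I_k -> 'I_N} | normA (pt1 e c r) == v]%SET| * N <= k * N ^ k)%N.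
Proof.
pose j0 := Ordinal (rank_gt0 basis).
pose put (r : {ffun 'I_k -> 'I_N}) t := [ffun j => if j == j0 then t else r j].
have := @lens_bound _ _ (fun r : {ffun 'I_k -> 'I_N} => r j0) put
  (mem [set r : {ffun 'I_k -> 'I_N} | normA (pt1 e c r) == v]%SET) 1 k.
rewrite card_ffun !card_ord muln1 mulnC; apply.
- by move=> g w; rewrite ffunE eqxx.
- by move=> g; apply/ffunP => j; rewrite ffunE; case: eqP => [->|].
- by move=> g w w'; apply/ffunP => j; rewrite !ffunE; case: eqP.
move=> g; pose x0 := lincomb e [ffun j => if j == j0 then c else (g j)%:Z + c].
have E t : pt1 e c (put g t) = x0 + e j0 *~ t%:Z.
  rewrite /x0 /pt1 /lincomb (bigD1 j0) //= [X in _ = X + _](bigD1 j0) //=.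
  rewrite !ffunE eqxx mulrzDr [RHS]addrAC; congr (_ + _); first exact: addrC.
  by apply: eq_bigr => j /negPf jj; rewrite !ffunE jj.
rewrite muln1 cardE -(size_map (fun t : 'I_N => t%:Z)).
apply: (@det_pencil_roots _ (mulmat x0) (mulmat (e j0)) v); first exact: rank_gt0 basis.
- by apply: normA_neq0; rewrite ?basis_neq0.
- by rewrite map_inj_uniq ?enum_uniq // => a b [] /val_inj.
- move=> y /mapP [t]; rewrite mem_enum !inE => /eqP h ->; rewrite -h.
  by rewrite E /normA mulmatD mulmatMz.
Qed.

(** The k! terms of the Leibniz expansion, each a product of k matrix entries bounded by
    [heightM]. *)
Definition normC : nat := (k`! * (heightC basis * \sum_i height (e i)) ^ k)%N.

Lemma norm_le x : (`|normA x| <= normC * height x ^ k)%N.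
Proof.
rewrite /normA /determinant -lez_nat abszE.
apply: le_trans (ler_norm_sum _ _ _) _.
have -> : Posz (normC * height x ^ k) =
  \sum_(s : 'S_k) Posz ((heightC basis * \sum_i height (e i)) ^ k * height x ^ k).
  by rewrite sumr_const card_Sn -mulr_natl natz -PoszM mulnA.
apply: ler_sum => s _; rewrite normrMsign normr_prod -expnMn.
have -> : Posz ((heightC basis * (\sum_i height (e i)) * height x) ^ k) =
  \prod_(i < k) Posz (heightC basis * (\sum_i height (e i)) * height x).
  by rewrite prodr_const card_ord -!natz natrX.
apply: ler_prod => i _; rewrite normr_ge0 /= -abszE lez_nat mxE.
apply: leq_trans (height_co _ _ _) _; apply: leq_trans (heightM _ _ _) _.
rewrite -mulnA leq_mul2l mulnC leq_mul2r (bigD1 i) //= leq_addr !orbT //.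
Qed.

(** Ideals containing l are determined by their residues modulo l, so a proper one above [I] with
    the most residues is maximal, hence prime. *)
Lemma proper_ideal_prime (I : set A) l : (1 < l)%N -> is_ideal I -> ~ I 1 -> I l%:R ->
  exists2 p, is_prime p & I `<=` p.
Proof.
move=> l1 idI I1 Il; have l0 := ltnW l1.
pose P m := `[< exists J : set A, [/\ is_ideal J, ~ J 1, I `<=` J & cnt1 0 l J = m] >].
have exP : exists m, P m by exists (cnt1 0 l I); apply/asboolP; exists I; split.
have bP m : P m -> (m <= l ^ k)%N.
  move=> /asboolP [J [_ _ _ <-]]; rewrite -(cnt1_setT e 0); apply: leq_sum => r _.
  by case: (asboolP (setT _)) => [_|[]] //; exact: leq_b1.
case: (ex_maxnP exP bP) => m /asboolP [J [idJ J1 IJ cJ]] mmax; exists J => //; split=> //.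
- move=> x y Jxy; apply: contrapT => /not_orP [Jx Jy].
  pose J' : set A := [set z | exists2 j, J j & exists a, z = j + x * a].
  have idJ' : is_ideal J'.
    split=> [|_ _ [j hj [a ->]] [j' hj' [a' ->]]|b _ [j hj [a ->]]].
    - by exists 0; [exact: idl0 | exists 0; rewrite mulr0 addr0].
    - by exists (j + j'); [exact: idlD | exists (a + a'); rewrite mulrDr addrACA].
    - by exists (b * j); [exact: idlM | exists (b * a); rewrite mulrDr mulrCA].
  have JJ' : J `<=` J' by move=> j hj; exists j => //; exists 0; rewrite mulr0 addr0.
  have J'x : J' x by exists 0; [exact: idl0 | exists 1; rewrite mulr1 add0r].
  case: (pselect (J' 1)) => [[j hj [a ha]]|J'1].
    apply: Jy; rewrite -[y]mul1r ha mulrDl mulrAC.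
    by apply: (idlD idJ); apply: (idlMr idJ).
  suff : (cnt1 0 l J < cnt1 0 l J')%N.
    rewrite cJ ltnNge => /negP; apply; apply: mmax; apply/asboolP; exists J'; split=> //.
    by move=> z /IJ /JJ'.
  rewrite -(cnt1_setD e 0 l JJ') -addn1 leq_add2l lt0n.
  have El : l.-1.+1 = l by rewrite prednK.
  rewrite -El; set r := residue basis l.-1 x.
  have hr : multiples l.-1.+1 (pt1 e 0 r - x) by apply: residue_pt1.
  have Jl : J l.-1.+1%:R by rewrite El; apply: IJ.
  rewrite /cnt1 (bigD1 r) //=; case: asboolP => // -[]; split.
    by apply/(idl_congr idJ' (multiples_sub idJ' (JJ' _ Jl) hr)).
  by move=> /(idl_congr idJ (multiples_sub idJ Jl hr)).
- exists l%:R; first exact: IJ.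
  apply/eqP => l0'; have := @natA_inj A k e basis l 1 l0; rewrite mulr1 => /(_ l0') /eqP.
  by rewrite oner_eq0.
Qed.

(** Otherwise x a + l b = 1 for some a and b; then x a has norm 1 modulo l, although its norm is a
    multiple of that of x. *)
Lemma prime_dvd_norm l x : prime l -> (l %| `|normA x|)%N ->
  exists p, [/\ is_prime p, p x & p l%:R].
Proof.
move=> lp ln.
pose I : set A := [set z | exists a b, z = x * a + l%:R * b].
have idI : is_ideal I.
  split=> [|_ _ [a [b ->]] [a' [b' ->]]|c _ [a [b ->]]].
  - by exists 0, 0; rewrite !mulr0 addr0.
  - by exists (a + a'), (b + b'); ring.
  - by exists (c * a), (c * b); ring.
have Ix : I x by exists 1, 0; rewrite mulr1 mulr0 addr0.
have Il : I l%:R by exists 0, 1; rewrite mulr1 mulr0 add0r.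
have [|p pp Ip] := proper_ideal_prime (prime_gt1 lp) idI _ Il; last first.
  by exists p; split=> //; apply: Ip.
move=> [a [b E]].
have Fl : (l%:R : 'F_l) = 0 by rewrite -Fp_nat_mod // modnn.
have : ((normA (x * a))%:~R : 'F_l) = 1.
  have -> : x * a = 1 + b *~ (- l%:Z) by rewrite mulrNz -pmulrn -mulr_natl [X in _ = X - _]E addrK.
  rewrite /normA mulmatD mulmatMz mulmat1 -det_map_mx -[RHS](det1 _ k); congr determinant.
  apply/matrixP => i j; rewrite !mxE rmorphD rmorphM rmorphN /= -pmulrn Fl oppr0 mul0r addr0.
  by rewrite mulrb; case: eqP.
rewrite normAM rmorphM /=.
have -> : ((normA x)%:~R : 'F_l) = 0.
  have /dvdzP [c ->] : (l %| normA x)%Z by rewrite dvdzE.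
  by rewrite rmorphM /= -pmulrn Fl mulr0.
by rewrite mul0r => /eqP; rewrite eq_sym oner_eq0.
Qed.
End Norms.

(** * Divergence of the sum of inverse norms *)

Section Divergence.
Variables (A : comNzRingType) (k : nat) (e : 'I_k -> A).
Hypothesis basis : forall x : A, exists! a : {ffun 'I_k -> int}, x = \sum_j e j *~ a j.
Hypothesis domain : forall x y : A, x * y = 0 -> x = 0 \/ y = 0.
Local Notation cnt1 := (cnt1 e).
Local Notation normA := (normA basis).
Local Notation height := (height basis).

Lemma pt1_inj c N : injective (@pt1 A k e c N).
Proof.
move=> r s /(congr1 (coords basis)); rewrite !(lincombK basis) => /ffunP h.
apply/ffunP => j; have := h j; rewrite !ffunE => /addIr [] /val_inj //.
Qed.

Lemma box_height H (r : {ffun 'I_k -> 'I_(2 * H)}) : (height (pt1 e (- H%:Z) r) <= H)%N.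
Proof. by apply/heightP => j; rewrite coords_pt1; case: (r j) => a /= ha; lia. Qed.

Lemma cnt1_0 c N : (cnt1 c N [set x | x = 0%R] <= 1)%N.
Proof.
rewrite cnt1_card; apply/card_le1_eqP => r s; rewrite 2!finset.inE => /asboolP hr /asboolP hs.
by apply: (@pt1_inj c N); rewrite hr hs.
Qed.

Definition smooth (ps : seq (set A)) : set A :=
  [set x | x != 0 /\ forall p, is_prime p -> p x -> p \in ps].

(** The rational primes dividing the norm lie below primes of [ps], and their exponents are at most
    the logarithm [T]; so the norm takes at most (T + 1)^(size ps) absolute values. The factor 2
    counts the sign, the rest is [card_norm_eq]. *)
Lemma cnt_smooth ps H : (forall p, p \in ps -> is_prime p) -> (0 < H)%N ->
  (cnt1 (- H%:Z) (2 * H) (smooth ps) * (2 * H) <=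
   (trunc_log 2 (normC basis * H ^ k)).+1 ^ size ps * (2 * k * (2 * H) ^ k))%N.
Proof.
move=> hps H0; set T := trunc_log _ _.
have [lp hlp] : exists lp : set A -> nat, forall p, p \in ps -> prime (lp p) /\ p (lp p)%:R.
  suff /choice [f hf] : forall p, exists l, p \in ps -> prime l /\ p l%:R by exists f.
  move=> p; case: (boolP (p \in ps)) => [pps|]; last by exists 0%N.
  by have [l h1 h2] := prime_nat basis domain (hps p pps); exists l.
pose L := map lp ps.
rewrite cnt1_card; set S := [set _ | _]%SET.
pose N r := `|normA (pt1 e (- H%:Z) (r : {ffun 'I_k -> 'I_(2 * H)}))|%N.
have Npos r : r \in S -> (0 < N r)%N.
  by rewrite inE => /asboolP [x0 _]; rewrite absz_gt0 (normA_neq0 basis domain).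
have NT l r : prime l -> r \in S -> (logn l (N r) <= T)%N.
  move=> pl rS; apply: trunc_log_max => //.
  apply: (@leq_trans (l ^ logn l (N r))%N).
    by case: (logn _ _) => [|a]; rewrite ?expn0 // leq_exp2r // prime_gt1.
  apply: (@leq_trans (N r)); first by rewrite dvdn_leq ?Npos // pfactor_dvdnn.
  apply: leq_trans (norm_le basis _) _; rewrite leq_mul2l.
  by rewrite leq_exp2r ?(rank_gt0 basis) // box_height orbT.
have NL l r : l \in primes (N r) -> r \in S -> l \in L.
  rewrite mem_primes => /and3P [pl _ ldiv]; rewrite inE => /asboolP [_ hr].
  have [p [pp px pl']] := prime_dvd_norm pl ldiv.
  have pps := hr _ pp px; have [h1 h2] := hlp _ pps.
  have := prime_dvd pp pl pl' h2; rewrite dvdn_prime2 // => /eqP ->.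
  exact: map_f.
pose f r : {ffun 'I_(size ps) -> 'I_T.+1} := [ffun i : 'I_(size ps) =>
  inord (logn (nth 0%N L i) (N r))].
have -> : (T.+1 ^ size ps)%N = #|{: {ffun 'I_(size ps) -> 'I_T.+1}}| by rewrite card_ffun !card_ord.
apply: (@fiber_bound _ _ S f) => y.
case: (set_0Vmem [set r in S | f r == y]%SET) => [->|[r0]]; first by rewrite cards0.
rewrite inE => /andP [r0S /eqP fr0].
have fN r : r \in S -> f r = y -> N r = N r0.
  move=> rS fr; apply: eqn_from_log; rewrite ?Npos // => l.
  case: (boolP (l \in L)) => [lL|lL]; last first.
    have aux s : s \in S -> logn l (N s) = 0%N.
      move=> sS; apply/eqP; rewrite -leqn0 leqNgt logn_gt0; apply/negP => h.
      by move: lL; rewrite (NL _ _ h sS).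
    by rewrite !aux.
  have pl : prime l by have /mapP [p /hlp [? _] ->] := lL.
  have lt : (index l L < size ps)%N by rewrite -(size_map lp) index_mem.
  have /ffunP /(_ (Ordinal lt)) : f r = f r0 by rewrite fr fr0.
  by rewrite !ffunE /= nth_index // => /(congr1 val); rewrite /= !inordK // ltnS NT.
pose B v := [set r : {ffun 'I_k -> 'I_(2 * H)} | normA (pt1 e (- H%:Z) r) == v]%SET.
have sub : [set r in S | f r == y]%SET \subset (B (N r0) :|: B (- (N r0)%:Z)).
  apply/fintype.subsetP => r; rewrite !inE => /andP [rS /eqP fr].
  have := fN r; rewrite inE => /(_ rS fr) <-; rewrite /N.
  by move: (normA _) => v; lia.
apply: (@leq_trans ((#|B (N r0)| + #|B (- (N r0)%:Z)|) * (2 * H))%N).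
  by rewrite leq_mul2r (leq_trans (subset_leq_card sub)) ?orbT // cardsU leq_subr.
rewrite mulnDl; apply: (@leq_trans (k * (2 * H) ^ k + k * (2 * H) ^ k)%N).
  by apply: leq_add; apply: (card_norm_eq basis domain).
by rewrite -mulnDl addnn -mul2n.
Qed.

(** By [packing] a prime covers at most (D H)^k / N(p) nonzero elements of the box. If the inverse
    norms outside [ps] always summed to less than 1 / (4 D^k), at most H^k / 4 nonzero elements
    would lie in primes outside [ps], against the bound of [cnt_smooth]. The constant does not
    depend on [ps], so the step can be iterated. *)
Lemma primes_tail (R : realType) (ps : seq (set A)) : (forall p, p \in ps -> is_prime p) ->
  exists ps' : seq (set A), [/\ uniq ps', (forall p, p \in ps' -> is_prime p /\ p \notin ps) &
    ((4 * (3 * (2 * heightC basis + 1)) ^ k)%:R)^-1 <= \sum_(p <- ps') ((ideal_norm p)%:R)^-1 :> R].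
Proof.
move=> hps; apply: contrapT => hN.
set D := (3 * (2 * heightC basis + 1))%N in hN.
have k0 := rank_gt0 basis.
(* In 8 k + 4, the 8 k is four times the factor 2 k of [cnt_smooth], and the 4 comes from the zero
   element. *)
have [t ht] := exp_beats_poly (normC basis).+1 k (size ps) (8 * k + 4).
pose H := (2 ^ t)%N; pose F := {ffun 'I_k -> 'I_(2 * H)}.
have H0 : (0 < H)%N by rewrite expn_gt0.
pose T := trunc_log 2 (normC basis * H ^ k).
have Tle : (T <= normC basis + k * t)%N.
  rewrite -(trunc_expnK (normC basis + k * t) (isT : 1 < 2)%N); apply: leq_trunc_log.
  by rewrite expnD mulnC /H -expnM (mulnC t) mulnC leq_mul2r ltnW ?orbT // ltn_expl.
pose bad (r : F) (p : set A) := [/\ is_prime p, p \notin ps,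
  p (pt1 e (- H%:Z) r) & pt1 e (- H%:Z) r != 0].
have [P hP] : exists P : F -> set A, forall r, (exists p, bad r p) -> bad r (P r).
  suff /choice [P hP] : forall r, exists Pr, (exists p, bad r p) -> bad r Pr by exists P.
  move=> r.
  case: (pselect (exists p, bad r p)) => [[p hp]|hn]; first by exists p.
  by exists set0 => /hn.
(* One witness for each covered box element makes the relevant primes a finite list. *)
pose Q := undup [seq P r | r <- enum [set r : F | `[< exists p, bad r p >]]%SET].
have hQ p : p \in Q -> is_prime p /\ p \notin ps.
  by rewrite mem_undup => /mapP [r]; rewrite mem_enum inE => /asboolP /hP [h1 h2 _ _] ->.
have sumQ : \sum_(p <- Q) ((ideal_norm p)%:R)^-1 <= ((4 * D ^ k)%:R)^-1 :> R.
  rewrite leNgt; apply/negP => /ltW h; apply: hN; exists Q; split=> //; exact: undup_uniq.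
pose c p := cnt1 (- H%:Z) (2 * H) [set x | p x /\ x != 0%R].
have cQ : (4 * \sum_(p <- Q) c p <= H ^ k)%N.
  have D0 : (0 < D ^ k)%N by rewrite expn_gt0 /D muln_gt0 addn1.
  rewrite -(ler_nat R) natrM natr_sum.
  apply: (@le_trans _ _ (4 * \sum_(p <- Q) ((D * H) ^ k)%:R * ((ideal_norm p)%:R)^-1)).
    rewrite ler_pM2l //; rewrite big_seq [leRHS]big_seq; apply: ler_sum => p /hQ [pp _].
    rewrite ler_pdivlMr ?ltr0n ?(ltnW (norm_gt1 basis domain pp)) //.
    by rewrite -natrM ler_nat packing.
  rewrite -mulr_sumr; apply: (@le_trans _ _ (4 * (((D * H) ^ k)%:R * ((4 * D ^ k)%:R)^-1))).
    by rewrite ler_pM2l // ler_wpM2l ?ler0n.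
  rewrite expnMn !natrM invfM.
  rewrite le_eqVlt; apply/orP; left; apply/eqP.
  have D0' : (D ^ k)%:R != 0 :> R by rewrite pnatr_eq0 -lt0n.
  by field.
have tot : ((2 * H) ^ k <= 1 + \sum_(p <- Q) c p + cnt1 (- H%:Z) (2 * H) (smooth ps))%N.
  rewrite -(cnt1_setT e (- H%:Z)).
  apply: (@leq_trans (cnt1 (- H%:Z) (2 * H) [set x | x = 0%R] +
     \sum_(p <- Q) c p + cnt1 (- H%:Z) (2 * H) (smooth ps))%N); last first.
    by rewrite !leq_add2r cnt1_0.
  rewrite /c exchange_big -!big_split; apply: leq_sum => r _ /=.
  apply: leq_trans (leq_b1 _) _.
  case: (asboolP ([set x | x = 0] _)) => [//|x0].
  case: (pselect (exists p, bad r p)) => [ex|nex].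
    have [pp pps pr r0] := hP r ex.
    rewrite (big_rem (P r)) /=; last first.
      by rewrite mem_undup; apply: map_f; rewrite mem_enum inE; apply/asboolP.
    by case: asboolP => [|[]].
  rewrite [X in (_ <= _ + X)%N](_ : _ = 1%N) ?addn1 //.
  case: asboolP => // -[]; split; first exact/eqP.
  move=> p pp pr; apply: contrapT => /negP pps; apply: nex; exists p; split=> //; exact/eqP.
have sm := cnt_smooth hps H0; rewrite -/T in sm.
set X := (2 * H)%N in sm tot; set S := cnt1 _ _ (smooth ps) in sm tot.
have XH : (H < X)%N by rewrite /X; lia.
have Y0 : (0 < X ^ k)%N by rewrite expn_gt0; lia.
have HX : (H ^ k <= X ^ k)%N by rewrite leq_exp2r // ltnW.
have XX : (X <= X ^ k)%N by rewrite -{1}(expn1 X) leq_pexp2l //; lia.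
pose U := (T.+1 ^ size ps)%N.
have U0 : (0 < U)%N by rewrite expn_gt0.
have hU : ((8 * k + 4) * U < H)%N.
  apply: leq_ltn_trans ht; rewrite leq_mul2l /U; apply/orP; right.
  by case: (size ps) => [|s]; rewrite ?expn0 // leq_exp2r // addSn ltnS.
rewrite -/U in sm.
move: (\sum_(p <- Q) c p)%N cQ tot => Z cQ tot.
suff : (3 * X <= (8 * k + 4) * U)%N by lia.
rewrite -(leq_pmul2l Y0).
have h1 : (X ^ k * X * 4 <= (4 + 4 * Z + 4 * S) * X)%N.
  by rewrite mulnAC leq_mul2r; apply/orP; right; lia.
have h2 : (4 * Z * X <= X ^ k * X)%N by rewrite leq_mul2r (leq_trans cQ HX) orbT.
have h3 : (4 * X <= 4 * X ^ k * U)%N by rewrite -mulnA leq_mul2l /= (leq_trans XX) // leq_pmulr.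
have h4 : (4 * S * X <= X ^ k * (8 * k * U))%N.
  rewrite -mulnA; apply: leq_trans (_ : 4 * (U * (2 * k * X ^ k)) <= _)%N;
    first by rewrite leq_mul2l sm orbT.
  by apply: eq_leq; ring.
have -> : (X ^ k * ((8 * k + 4) * U) = X ^ k * (8 * k * U) + 4 * X ^ k * U)%N by ring.
have -> : (X ^ k * (3 * X) = X ^ k * X * 3)%N by ring.
lia.
Qed.

Lemma norm_sum_unbounded (R : realType) (C : R) : exists ps : seq (set A),
  [/\ uniq ps, (forall p, p \in ps -> is_prime p) & C < \sum_(p <- ps) ((ideal_norm p)%:R)^-1].
Proof.
pose eps : R := ((4 * (3 * (2 * heightC basis + 1)) ^ k)%:R)^-1.
have eps0 : 0 < eps by rewrite invr_gt0 ltr0n muln_gt0 expn_gt0 muln_gt0 addn1.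
have step N : exists ps : seq (set A),
    [/\ uniq ps, (forall p, p \in ps -> is_prime p) & N%:R * eps <= \sum_(p <- ps) ((ideal_norm
      p)%:R)^-1].
  elim: N => [|N [ps [us hs le]]]; first by exists [::]; split; rewrite // big_nil mul0r.
  have [ps' [us' hs' le']] := primes_tail R hs.
  exists (ps' ++ ps); split.
  - rewrite cat_uniq us us' andbT; apply/hasPn => p hp; apply/negP => /hs' [_].
    by rewrite hp.
  - by move=> p; rewrite mem_cat => /orP [/hs' []|/hs].
  - by rewrite big_cat /= -natr1 mulrDl mul1r addrC lerD.
have [ps [us hs le]] := step (Num.bound (`|C| / eps)); exists ps; split=> //.
apply: lt_le_trans le; rewrite -ltr_pdivrMr //.
apply: le_lt_trans (archi_boundP _); last by rewrite divr_ge0 // ltW.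
by apply: ler_wpM2r; [rewrite invr_ge0 ltW | exact: ler_norm].
Qed.
End Divergence.

(** * Contribution of the large primes *)

Lemma coef_XaddC_exp (R : comNzRingType) (c : R) n j : (j <= n)%N ->
  (('X + c%:P) ^+ n)`_(n - j) = c ^+ j *+ 'C(n, j).
Proof.
move=> jn; have jn' : (j < n.+1)%N by [].
rewrite exprDn coef_sum (bigD1 (Ordinal jn')) //= big1 => [|i ij].
  by rewrite addr0 coefMn -polyC_exp coefMC coefXn eqxx mul1r.
rewrite coefMn -polyC_exp coefMC coefXn.
case: eqP => [E|_]; last by rewrite mul0r mul0rn.
case/eqP: ij; apply/val_inj => /=; have := ltn_ord i; lia.
Qed.

Lemma card_congr_pairs N l (T : pred ('I_N * 'I_N)) : (0 < l)%N ->
  (forall x y, T x -> T y -> x.1 = y.1 %[mod l] /\ x.2 = y.2 %[mod l]) ->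
  (#|T| <= (N %/ l).+1 ^ 2)%N.
Proof.
move=> l0 hT.
have lt (a : 'I_N) : (a %/ l < (N %/ l).+1)%N by rewrite ltnS leq_div2r // ltnW.
pose f (x : 'I_N * 'I_N) : 'I_(N %/ l).+1 * 'I_(N %/ l).+1 := (Ordinal (lt x.1), Ordinal (lt x.2)).
have -> : ((N %/ l).+1 ^ 2 = #|{: 'I_(N %/ l).+1 * 'I_(N %/ l).+1}|)%N.
  by rewrite card_prod !card_ord mulnn.
apply: (@leq_card_in _ _ f T) => x y xT yT [] h1 h2.
have [e1 e2] := hT _ _ xT yT.
case: x y h1 h2 e1 e2 {xT yT} => [a b] [a' b'] /= h1 h2 e1 e2.
congr (_, _); apply/val_inj => /=.
- by rewrite (divn_eq a l) (divn_eq a' l) h1 e1.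
- by rewrite (divn_eq b l) (divn_eq b' l) h2 e2.
Qed.

Section Tail.
Variables (A : comNzRingType) (k : nat) (e : 'I_k -> A).
Hypothesis basis : forall x : A, exists! a : {ffun 'I_k -> int}, x = \sum_j e j *~ a j.
Hypothesis domain : forall x y : A, x * y = 0 -> x = 0 \/ y = 0.
Local Notation cnt := (cnt e).
Local Notation cnt1 := (cnt1 e).
Local Notation height := (height basis).
Variables (d : nat) (d3 : (2 < d)%N).

Definition top : nat -> 'I_d.+1 := fun j => inord (d - j).
(* Both vanish on the coefficients of a (X + b)^d. *)
Definition quad (v : 'rV[A]_d.+1) : A :=
  d.-1%:R * v 0 (top 1) ^+ 2 - (2 * d)%:R * (v 0 (top 0) * v 0 (top 2)).
Definition cubic (v : 'rV[A]_d.+1) : A :=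
  (d.-1 * d.-2)%:R * v 0 (top 1) ^+ 3 - (6 * d ^ 2)%:R * (v 0 (top 0) ^+ 2 * v 0 (top 3)).

Lemma top_val j : top j = (d - j)%N :> nat.
Proof. by rewrite inordK // ltnS leq_subr. Qed.
Lemma topE i j : (i <= d)%N -> (j <= d)%N -> (top i == top j) = (i == j).
Proof. by move=> hi hj; rewrite -val_eqE /= !top_val; lia. Qed.

Section Reduction.
Variables (p : set A) (idp : is_ideal p).

Lemma shifted_eis_reduction v : shifted_eis_set p v ->
  ~ p (v 0 (top 0)) /\ exists b, forall j, (j <= d)%N ->
    p (v 0 (top j) - v 0 (top 0) * (b ^+ j *+ 'C(d, j))).
Proof.
move=> [b [h1 h2 _]]; set w := row_shift b v in h1 h2.
have E j : v 0 (top j) = (rVpoly w \Po ('X + (- b)%:P))`_(top j).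
  by rewrite -rVpoly_shift shiftK coef_rVpoly_ord.
have E0 : v 0 (top 0) = (rVpoly w)`_d.
  by rewrite E top_val ?subn0 // lead_shift // size_rVpoly.
split; first by rewrite E0.
exists (- b) => j jd; rewrite E0 E top_val.
rewrite coef_comp_poly; set f := rVpoly w.
have sf : (size f <= d.+1)%N := size_rVpoly w.
have -> : \sum_(i < size f) f`_i * (('X + (- b)%:P) ^+ i)`_(d - j) =
          \sum_(i < d.+1) f`_i * (('X + (- b)%:P) ^+ i)`_(d - j).
  rewrite (big_ord_widen _ (fun i => f`_i * (('X + (- b)%:P) ^+ i)`_(d - j)) sf) big_mkcond.
  by apply: eq_bigr => i _; case: ltnP => // hi; rewrite nth_default ?mul0r.
rewrite big_ord_recr /= coef_XaddC_exp // addrK.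
by apply: (idl_sum idp) => i _; apply: (idlMr idp); apply: h2.
Qed.

(** Eliminate [b] from the values a b^j 'C(d, j) of the top coefficients for j = 1, 2, 3. The
    multipliers 2 d and 6 d^2 clear the binomial coefficients, so nothing is divided. *)
Lemma shifted_eis_quad_cubic v : shifted_eis_set p v ->
  [/\ ~ p (v 0 (top 0)), p (quad v) & p (cubic v)].
Proof.
move=> /shifted_eis_reduction [p0 [b hb]]; split=> //.
  have := hb 1%N (ltnW (ltnW d3)); have := hb 2%N (ltnW d3).
  rewrite /quad bin1 expr1; move: (v 0 (top 0)) (v 0 (top 1)) (v 0 (top 2)) => a a1 a2.
  rewrite -mulr_natr -[_ *+ d]mulr_natr => h2 h1.
  set x1 := a1 - _ in h1; set x2 := a2 - _ in h2.
  have -> : d.-1%:R * a1 ^+ 2 - (2 * d)%:R * (a * a2) =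
    d.-1%:R * (a1 + a * (b * d%:R)) * x1 - (2 * d)%:R * a * x2.
    have /(congr1 (fun n => n%:R : A)) : ('C(d, 2) * 2 = d * d.-1)%N.
      by rewrite bin2 muln2 halfK (_ : odd _ = false) ?subn0 //; case: (d) => //= n;
        rewrite oddM /= andNb.
    rewrite /x1 /x2 !natrM; move: (d.-1%:R : A) (d%:R : A) ('C(d, 2)%:R : A) => D1 D C2 hC.
    (* The added term is zero by [hC]; it lets [ring] work with the binomial coefficient as an
       unknown. *)
    transitivity (D1 * a1 ^+ 2 - 2 * D * (a * a2) + a ^+ 2 * b ^+ 2 * D * (C2 * 2 - D * D1));
      last by ring.
    by rewrite hC subrr mulr0 addr0.
  by apply: (idlB idp); apply: (idlM idp).
have := hb 1%N (ltnW (ltnW d3)); have := hb 3%N d3.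
rewrite /cubic bin1 expr1; move: (v 0 (top 0)) (v 0 (top 1)) (v 0 (top 3)) => a a1 a3.
rewrite -mulr_natr -[_ *+ d]mulr_natr => h3 h1.
set x1 := a1 - _ in h1; set x3 := a3 - _ in h3.
have -> : (d.-1 * d.-2)%:R * a1 ^+ 3 - (6 * d ^ 2)%:R * (a ^+ 2 * a3) =
  (d.-1 * d.-2)%:R * (a1 ^+ 2 + a1 * (a * (b * d%:R)) + (a * (b * d%:R)) ^+ 2) * x1
   - (6 * d ^ 2)%:R * a ^+ 2 * x3.
  have /(congr1 (fun n => n%:R : A)) : ('C(d, 3) * 6 = d * (d.-1 * d.-2))%N.
    by rewrite (_ : 6 = 3`!)%N // bin_ffact !ffactnS ffactn0 muln1.
  rewrite /x1 /x3 !natrM.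
  move: (d.-1%:R : A) (d.-2%:R : A) (d%:R : A) ('C(d, 3)%:R : A) => D1 D2 D C3 hC.
  transitivity (D1 * D2 * a1 ^+ 3 - 6 * (D * D) * (a ^+ 2 * a3)
    + a ^+ 3 * b ^+ 3 * (D * D) * (C3 * 6 - D * (D1 * D2))); last by ring.
  by rewrite hC subrr mulr0 addr0.
by apply: (idlB idp); apply: (idlM idp).
Qed.
End Reduction.

Definition upd (W : Type) (I : finType) (r : {ffun I -> W}) i w : {ffun I -> W} :=
  [ffun j => if j == i then w else r j].

Lemma updK W (I : finType) (r : {ffun I -> W}) i : upd r i (r i) = r.
Proof. by apply/ffunP => j; rewrite ffunE; case: eqP => [->|]. Qed.
Lemma upd_same W (I : finType) (r : {ffun I -> W}) i w : upd r i w i = w.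
Proof. by rewrite ffunE eqxx. Qed.
Lemma upd_other W (I : finType) (r : {ffun I -> W}) i j w : j != i -> upd r i w j = r j.
Proof. by rewrite ffunE => /negPf ->. Qed.
Lemma upd_upd W (I : finType) (r : {ffun I -> W}) i w w' : upd (upd r i w) i w' = upd r i w'.
Proof. by apply/ffunP => j; rewrite !ffunE; case: eqP. Qed.
Lemma updC W (I : finType) (r : {ffun I -> W}) i j w w' : i != j ->
  upd (upd r i w) j w' = upd (upd r j w') i w.
Proof.
move=> ij; apply/ffunP => l; rewrite !ffunE; case: (eqVneq l j) => [->|//].
by rewrite eq_sym (negPf ij).
Qed.

Lemma pt1_upd c N (r : {ffun 'I_k -> 'I_N}) j s s' :
  pt1 e c (upd r j s) - pt1 e c (upd r j s') = e j *~ (s%:Z - s'%:Z).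
Proof.
rewrite /pt1 /lincomb (bigD1 j) //= [X in _ - X](bigD1 j) //= !ffunE eqxx.
rewrite (eq_bigr (fun i => e i *~ [ffun j0 => (upd r j s' j0)%:Z + c] i)); last first.
  by move=> i /negPf ij; rewrite !ffunE ij.
by rewrite opprD addrACA subrr addr0 -mulrzBr; congr (_ *~ _); lia.
Qed.

(** Otherwise 1 would lie in [p]. Along such a coordinate, two values that are incongruent modulo
    [l] give different residues modulo [p]. *)
Lemma basis_notin (p : set A) : is_ideal p -> ~ p 1 -> exists j, ~ p (e j).
Proof.
move=> idp p1; apply: contrapT => hN; apply: p1; rewrite -(coordsK basis 1).
apply: (idl_sum idp) => j _; apply: (idlMz idp); apply: contrapT => h.
by apply: hN; exists j.
Qed.

Lemma prime_mod_eq (p : set A) l j (s s' : nat) c : is_prime p -> prime l -> p l%:R ->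
  ~ p (e j) -> ~ p c -> p (c * (e j *~ (s%:Z - s'%:Z))) -> s = s' %[mod l].
Proof.
move=> pp pl hl ej hc; have pM : forall x y, p (x * y) -> p x \/ p y by case: pp.
move=> /pM [] //; rewrite -mulrzr => /pM [] // /(prime_dvdz pp pl hl).
by rewrite -eqz_mod_dvd !modz_nat => /eqP [].
Qed.

Lemma prime_notin (p : set A) l n : is_prime p -> prime l -> p l%:R -> (0 < n < l)%N -> ~ p n%:R.
Proof.
move=> pp pl hl /andP [n0 nl] /(prime_dvd pp pl hl) /(dvdn_leq n0).
by rewrite leqNgt nl.
Qed.

Variable N : nat.
Variable c : int.
Local Notation G := {ffun 'I_d.+1 -> {ffun 'I_k -> 'I_N}}.
Local Notation P r := (pt e c (r : G)).
Let n01 : top 1 != top 0. Proof. by rewrite topE //; lia. Qed.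
Let n02 : top 0 != top 2. Proof. by rewrite topE //; lia. Qed.
Let n03 : top 0 != top 3. Proof. by rewrite topE //; lia. Qed.
Let n12 : top 1 != top 2. Proof. by rewrite topE //; lia. Qed.
Let n13 : top 1 != top 3. Proof. by rewrite topE //; lia. Qed.
Let n23 : top 2 != top 3. Proof. by rewrite topE //; lia. Qed.

Lemma ptE (r : G) z i : P r z i = pt1 e c (r i).
Proof. by rewrite mxE. Qed.

Lemma cnt_card (T : set 'rV[A]_d.+1) : cnt c N T = #|[pred r : G | `[< T (P r) >]]|.
Proof. by rewrite -sum1_card [RHS]big_mkcond; apply: eq_bigr => r _; rewrite inE; case: asboolP.
  Qed.

(** Through this condition on [l] the relations determine a_(d-2) and a_(d-3) modulo [p]: the
    coefficients in front of them become units. *)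
Lemma six_d_notin (p : set A) l : is_prime p -> prime l -> p l%:R -> (6 * d < l)%N ->
  forall a, ~ p a -> ~ p ((2 * d)%:R * a) /\ ~ p ((6 * d ^ 2)%:R * a ^+ 2).
Proof.
move=> pp pl hl dl a pa; have pM : forall x y, p (x * y) -> p x \/ p y by case: pp.
have pd : ~ p d%:R by apply: (prime_notin pp pl hl); lia.
split=> /pM [].
- by apply: (prime_notin pp pl hl); lia.
- by [].
- rewrite expnS expn1 !natrM => /pM []; last by move=> /pM [].
  by apply: (prime_notin pp pl hl); lia.
- by rewrite expr2 => /pM [].
Qed.

(** When everything but coordinate [j] of a_(d-2) and a_(d-3) is fixed, the two relations determine
    both coordinates modulo [l]. One integer coordinate of each already gives the summable saving
    1/l^2. *)
Lemma cnt_small_prime (p : set A) l : is_prime p -> prime l -> p l%:R -> (6 * d < l)%N ->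
  (cnt c N [set v : 'rV[A]_d.+1 | [/\ ~ p (v 0%R (top 0)), p (quad v) & p (cubic v)]] * N ^ 2 <=
   (N %/ l).+1 ^ 2 * N ^ (d.+1 * k))%N.
Proof.
move=> pp pl hl dl; have idp : is_ideal p by case: pp.
have [j ej] : exists j, ~ p (e j) by apply: basis_notin => //; case: pp.
pose get (r : G) := (r (top 2) j, r (top 3) j).
pose put (r : G) (w : 'I_N * 'I_N) : G :=
  upd (upd r (top 2) (upd (r (top 2)) j w.1)) (top 3) (upd (r (top 3)) j w.2).
rewrite cnt_card; set T := [pred r : G | _].
have := @lens_bound _ _ get put T 1 ((N %/ l).+1 ^ 2).
rewrite card_prod !card_ord (card_pts k) mulnn muln1 mulnC; apply.
- move=> g [w1 w2]; rewrite /get /put /=.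
  by rewrite (upd_other _ _ n23) !upd_same.
- by move=> g; rewrite /get /put /= !updK.
- move=> g [w1 w2] [w1' w2']; rewrite /put /= (upd_other _ _ n23) !upd_same.
  by rewrite !upd_upd (@updC _ _ _ (top 3) (top 2)) 1?eq_sym // !upd_upd.
move=> g; rewrite muln1; apply: card_congr_pairs; first exact: prime_gt0.
have hput w : [/\ put g w (top 0) = g (top 0), put g w (top 1) = g (top 1),
    put g w (top 2) = upd (g (top 2)) j w.1 & put g w (top 3) = upd (g (top 3)) j w.2].
  rewrite /put; split.
  - by rewrite (upd_other _ _ n03) (upd_other _ _ n02).
  - by rewrite (upd_other _ _ n13) (upd_other _ _ n12).
  - by rewrite (upd_other _ _ n23) upd_same.
  - by rewrite upd_same.
move=> [s t] [s' t']; move: (hput (s, t)) (hput (s', t')) => /=.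
move: (put g (s, t)) (put g (s', t')) => x y [x0 x1 x2 x3] [y0 y1 y2 y3].
move=> /asboolP [h0 h1 h2] /asboolP [h0' h1' h2'].
move: h0 h1 h2 h0' h1' h2'; rewrite /quad /cubic !ptE x0 x1 x2 x3 y0 y1 y2 y3.
set a := pt1 e c (g (top 0)) => h0 h1 h2 _ h1' h2'.
have [k1 k2] := six_d_notin pp pl hl dl h0.
split.
- apply: (prime_mod_eq pp pl hl ej k1); rewrite -(pt1_upd c (g (top 2))).
  by move: (idlB idp h1' h1); congr p; ring.
- apply: (prime_mod_eq pp pl hl ej k2); rewrite -(pt1_upd c (g (top 3))).
  by move: (idlB idp h2' h2); congr p; ring.
Qed.

Lemma int_eq0 j (z : int) : e j *~ z = 0 -> z = 0.
Proof.
move=> h; have := lincombK basis [ffun i => if i == j then z else 0].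
rewrite /lincomb (bigD1 j) //= big1 => [|i ij]; rewrite ?ffunE ?(negPf ij) ?eqxx //.
by rewrite h addr0 (coords0 basis) => /ffunP /(_ j); rewrite !ffunE eqxx.
Qed.

(** The relation is linear in a_(d-2) with coefficient 2 d a_d up to sign, which is nonzero in a
    domain of characteristic 0, so it determines one coordinate of a_(d-2). *)
Lemma cnt_quad_eq0 : (cnt c N [set v : 'rV[A]_d.+1 | v 0%R (top 0) != 0%R /\ quad v = 0%R] * N <=
  N ^ (d.+1 * k))%N.
Proof.
pose j := Ordinal (rank_gt0 basis).
pose get (r : G) := r (top 2) j.
pose put (r : G) (w : 'I_N) : G := upd r (top 2) (upd (r (top 2)) j w).
rewrite cnt_card; set T := [pred r : G | _].
have := @lens_bound _ _ get put T 1 1.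
rewrite !card_ord (card_pts k) muln1 mul1n mulnC; apply.
- by move=> g w; rewrite /get /put !upd_same.
- by move=> g; rewrite /get /put !updK.
- by move=> g w w'; rewrite /put !upd_same !upd_upd.
move=> g; rewrite muln1; apply/card_le1_eqP => s s'.
have hput w : [/\ put g w (top 0) = g (top 0), put g w (top 1) = g (top 1)
    & put g w (top 2) = upd (g (top 2)) j w].
  by rewrite /put (upd_other _ _ n02) (upd_other _ _ n12) upd_same.
move: (hput s) (hput s'); rewrite !finset.inE.
move: (put g s) (put g s') => x y [x0 x1 x2] [y0 y1 y2] /asboolP [h0 h1] /asboolP [_ h1'].
move: h0 h1 h1'; rewrite /quad !ptE x0 x1 x2 y0 y1 y2.
set a := pt1 e c (g (top 0)) => h0 h1 h1'.
have : (2 * d)%:R * (a * (pt1 e c (upd (g (top 2)) j s) - pt1 e c (upd (g (top 2)) j s'))) = 0.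
  by rewrite -[RHS](subrr 0) -{1}h1' -h1; ring.
move=> /(natA_inj basis) H; have {H}/domain [/eqP|] := H ltac:(lia); first by rewrite (negPf h0).
by rewrite pt1_upd => /int_eq0 E; apply/val_inj => /=; lia.
Qed.

(** As N <= l, coordinates congruent modulo [l] are equal: the cubic relation saves a full factor
    N. *)
Lemma cnt_cubic_prime (p : set A) l (r : G) : is_prime p -> prime l -> p l%:R -> (6 * d < l)%N ->
  (N <= l)%N -> ~ p (P r 0 (top 0)) ->
  (#|[pred w : {ffun 'I_k -> 'I_N} | `[< p (cubic (P (upd r (top 3) w))) >]]| * N <= N ^ k)%N.
Proof.
move=> pp pl hl dl Nl p0; have idp : is_ideal p by case: pp.
have [j ej] : exists j, ~ p (e j) by apply: basis_notin => //; case: pp.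
set T := [pred w : {ffun 'I_k -> 'I_N} | _].
have := @lens_bound _ _ (fun w : {ffun 'I_k -> 'I_N} => w j) (fun w s => upd w j s) T 1 1.
rewrite card_ffun !card_ord muln1 mul1n mulnC; apply.
- by move=> g w; rewrite upd_same.
- by move=> g; rewrite updK.
- by move=> g w w'; rewrite upd_upd.
move=> g; rewrite muln1; apply/card_le1_eqP => s s'.
pose put (w : 'I_N) := upd r (top 3) (upd g j w).
have hput w : [/\ put w (top 0) = r (top 0), put w (top 1) = r (top 1)
    & put w (top 3) = upd g j w].
  by rewrite /put (upd_other _ _ n03) (upd_other _ _ n13) upd_same.
move: (hput s) (hput s'); rewrite !finset.inE -/(put s) -/(put s').
move: (put s) (put s') => x y [x0 x1 x3] [y0 y1 y3] /asboolP h1 /asboolP h1'.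
move: h1 h1' p0; rewrite /cubic !ptE x0 x1 x3 y0 y1 y3.
set a := pt1 e c (r (top 0)) => h1 h1' p0.
have [_ k2] := six_d_notin pp pl hl dl p0.
have : s = s' %[mod l].
  apply: (prime_mod_eq pp pl hl ej k2); rewrite -(pt1_upd c g).
  by move: (idlB idp h1' h1); congr p; ring.
rewrite !modn_small ?(leq_trans (ltn_ord _)) // => E; exact: val_inj.
Qed.
End Tail.

Lemma sum_inv_sq (R : realType) M j : (0 < M)%N ->
  \sum_(i < j) ((M + i).+1%:R ^- 2 : R) <= M%:R^-1 - (M + j)%:R^-1.
Proof.
move=> M0; elim: j => [|j IH]; first by rewrite big_ord0 addn0 subrr.
rewrite big_ord_recr /= addnS; apply: le_trans (lerD IH (lexx _)) _.
have x0 : 0 < (M + j)%:R :> R by rewrite ltr0n addn_gt0 M0.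
rewrite -natr1; move: ((M + j)%:R : R) x0 => x x0.
have x1 : 0 < x + 1 by lra.
rewrite -addrA lerD2l -subr_ge0.
have -> : - (x + 1)^-1 - (- x^-1 + (x + 1) ^- 2) = (x * (x + 1) ^+ 2)^-1.
  by field; rewrite !gt_eqF.
by rewrite invr_ge0 mulr_ge0 ?exprn_ge0 // ltW.
Qed.

Section Tail.
Variables (A : comNzRingType) (k : nat) (e : 'I_k -> A).
Hypothesis basis : forall x : A, exists! a : {ffun 'I_k -> int}, x = \sum_j e j *~ a j.
Hypothesis domain : forall x y : A, x * y = 0 -> x = 0 \/ y = 0.
Local Notation cnt := (cnt e).
Local Notation height := (height basis).
Local Notation B := (heightC basis).
Variables (d : nat) (d3 : (2 < d)%N).
Local Notation top := (top d).
Local Notation E X := (X ^ (d.+1 * k))%N.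

Lemma quad_height (v : 'rV[A]_d.+1) H : (forall i, height (v 0%R i) <= H)%N ->
  (height (quad v) <= 3 * d * (B * H ^ 2))%N.
Proof.
move=> hv.
have hM i j : (height (v 0%R i * v 0%R j)%R <= B * H ^ 2)%N.
  apply: leq_trans (heightM _ _ _) _.
  by rewrite leq_mul2l -mulnn leq_mul ?hv ?orbT.
rewrite /quad expr2 -mulrN.
apply: leq_trans (heightD _ _ _) _.
have hN x : height (- x) = height x.
  by apply: eq_bigr => j _; rewrite (coordsN basis) ffunE abszN.
rewrite !heightMn hN.
have := hM (top 1) (top 1); have := hM (top 0) (top 2).
move: (height _) (height _) (B * H ^ 2)%N => a b Y; case: (d) => // d'; rewrite /=; nia.
Qed.

Section Large.
Variables (c : int) (X : nat).
Hypothesis X_large : (2 * B + 1 < X)%N.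
Local Notation G := {ffun 'I_d.+1 -> {ffun 'I_k -> 'I_X}}.
Local Notation P r := (pt e c (r : G)).
Hypothesis quad_le : forall r, (height (quad (P r)) <= X ^ 3)%N.

Definition large_set : set 'rV[A]_d.+1 := [set v | quad v != 0 /\ exists p l,
  [/\ is_prime p, prime l, p l%:R, (6 * d < l)%N /\ (X <= l)%N & [/\ ~ p (v 0 (top 0)),
    p (quad v) & p (cubic v)]]].

(** [quad] does not involve a_(d-3). Fixing all the other coefficients fixes a nonzero element,
    which [few_primes] places in at most 4 k of the primes concerned; for each of them
    [cnt_cubic_prime] bounds the choices of a_(d-3). *)
Lemma cnt_large : (cnt c X large_set * X <= 4 * k * E X)%N.
Proof.
pose put (g : G) (w : {ffun 'I_k -> 'I_X}) : G := upd g (top 3) w.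
rewrite cnt_card; set T := [pred r : G | _].
have := @lens_bound _ _ (fun g : G => g (top 3)) put T X (4 * k * X ^ k).
rewrite card_ffun !card_ord (card_pts k) => H.
have Xk0 : (0 < X ^ k)%N by rewrite expn_gt0; lia.
rewrite -(leq_pmul2l Xk0) mulnA (mulnCA (X ^ k)%N) mulnA; apply: H.
- by move=> g w; rewrite /put upd_same.
- by move=> g; rewrite /put updK.
- by move=> g w w'; rewrite /put upd_upd.
move=> g.
have hput w : [/\ put g w (top 0) = g (top 0), put g w (top 1) = g (top 1)
    & put g w (top 2) = g (top 2)].
  by rewrite /put !upd_other // topE //; lia.
have q_eq w : quad (P (put g w)) = quad (P g).
  by rewrite /quad !ptE; have [-> -> ->] := hput w.
have t_eq w : P (put g w) 0 (top 0) = P g 0 (top 0).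
  by rewrite !ptE; have [-> _ _] := hput w.
pose good w (p : set A) := exists l, [/\ is_prime p, prime l, p l%:R, (6 * d < l)%N /\ (X <= l)%N &
  [/\ ~ p (P g 0 (top 0)), p (quad (P g)) & p (cubic (P (put g w)))]].
have [Pf hPf] : exists Pf : {ffun 'I_k -> 'I_X} -> set A, forall w, (exists p, good w p) ->
  good w (Pf w).
  suff /choice [f hf] : forall w, exists p', (exists p, good w p) -> good w p' by exists f.
  move=> w; case: (pselect (exists p, good w p)) => [[p hp]|hn]; first by exists p.
  by exists set0 => /hn.
set F := [pred w | _].
have hF w : F w -> quad (P g) != 0 /\ exists p, good w p.
  move=> /asboolP [h0 [p [l [h1 h2 h3 h4 [h5 h6 h7]]]]]; split; first by rewrite -(q_eq w).
  by exists p, l; split=> //; split=> //; rewrite -?(t_eq w) -?(q_eq w).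
pose ps := undup [seq Pf w | w <- enum F].
have hps p : p \in ps -> exists w, F w /\ p = Pf w.
  by rewrite mem_undup => /mapP [w]; rewrite mem_enum => wF ->; exists w.
have size_ps : (size ps <= 4 * k)%N.
  case: (posnP (size ps)) => [->//|]; rewrite -has_predT => /hasP [p /hps [w [wF _]] _].
  have [q0 _] := hF w wF.
  apply: (few_primes domain X_large q0 (quad_le g)); first exact: undup_uniq.
  move=> p' /hps [w' [/hF [_ /hPf [l [h1 h2 h3 [_ h4] [_ h5 _]]]] ->]]; split=> //.
  exact: leq_trans h4 (prime_le_norm basis domain h1 h2 h3).
apply: (@leq_trans (\sum_(p <- ps) #|[pred w | F w & `[< p (cubic (P (put g w))) >]]| * X)%N).
  rewrite -big_distrl leq_mul2r; apply/orP; right.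
  rewrite -sum1_card big_mkcond /=.
  under [leqRHS]eq_bigr do rewrite -sum1_card big_mkcond.
  rewrite exchange_big /=; apply: leq_sum => w _; case: ifP => // wF.
  have [_ ex] := hF w wF; have [l [_ _ _ _ [_ _ hc]]] := hPf w ex.
  rewrite (big_rem (Pf w)) /=; last by rewrite mem_undup map_f // mem_enum.
  rewrite [X in (_ <= (if X then _ else _) + _)%N](_ : _ = true) //.
  by rewrite inE; apply/andP; split=> //; apply/asboolP.
apply: (@leq_trans (\sum_(p <- ps) X ^ k)%N); last first.
  by rewrite big_const_seq count_predT iter_addn_0 mulnC leq_mul2r size_ps orbT.
rewrite big_seq [leqRHS]big_seq; apply: leq_sum =>
  p /hps [w [/hF [_ /hPf [l [h1 h2 h3 [h4 h5] [h6 _ _]]]] pE]].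
rewrite -pE in h1 h3 h6.
apply: leq_trans (cnt_cubic_prime basis d3 h1 h2 h3 h4 h5 h6).
rewrite leq_mul2r; apply/orP; right; apply/subset_leq_card/fintype.subsetP => w'.
by rewrite !finset.inE => /andP [].
Qed.
End Large.

Definition tail_set M : set 'rV[A]_d.+1 := [set v | exists p,
  [/\ is_prime p, (forall l, prime l -> p l%:R -> (M < l)%N) & shifted_eis_set p v]].

Lemma residue_prime_fun : exists lp : set A -> nat, forall p, is_prime p ->
  prime (lp p) /\ p (lp p)%:R.
Proof.
suff /choice [f hf] : forall p : set A, exists l, is_prime p -> prime l /\ p l%:R by exists f.
move=> p; case: (pselect (is_prime p)) => [pp|hn]; last by exists 0%N.
by have [l h1 h2] := prime_nat basis domain pp; exists l.
Qed.

Lemma box_row_height m H (r : {ffun 'I_m -> {ffun 'I_k -> 'I_(2 * H)}}) i :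
  (height (pt e (- H%:Z) r 0%R i) <= H)%N.
Proof. by rewrite mxE; apply: box_height. Qed.

(** All primes above a rational prime l contain l, so [few_primes] with g = l leaves at most 4 k of
    them; the lower bounds on [M] provide its size conditions. The remaining sum over l is bounded
    by telescoping. *)
Lemma sum_residue_primes (R : realType) (lp : set A -> nat) (ps : seq (set A)) M X : (0 < M)%N ->
  (2 * B + 1 < M)%N -> (height 1%R <= M)%N ->
  (forall p, is_prime p -> prime (lp p) /\ p (lp p)%:R) -> uniq ps ->
  (forall p, p \in ps -> [/\ is_prime p, (M < lp p)%N & (lp p <= X)%N]) ->
  \sum_(p <- ps) (lp p)%:R ^- 2 <= (4 * k)%:R / M%:R :> R.
Proof.
move=> M0 MB Mh hlp ups hps.
pose F l : R := (M + l).+1%:R ^- 2.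
have -> : \sum_(p <- ps) (lp p)%:R ^- 2 =
    \sum_(l < X) \sum_(p <- ps | lp p == (M + l).+1) F l.
  rewrite [RHS](exchange_big_dep xpredT) //= big_seq [RHS]big_seq;
    apply: eq_bigr => p /hps [_ h1 h2].
  have lt : (lp p - M.+1 < X)%N by lia.
  rewrite (big_pred1 (Ordinal lt)) => [|i]; first by rewrite /F /=; congr (_%:R ^- 2); lia.
  by rewrite /= -val_eqE /=; apply/eqP/eqP => h; lia.
apply: (@le_trans _ _ (\sum_(l < X) (4 * k)%:R * F l)).
  apply: ler_sum => l _; rewrite big_const_seq iter_addr_0 -[_ *+ count _ _]mulr_natl.
  apply: ler_wpM2r; first by rewrite invr_ge0 exprn_ge0.
  rewrite ler_nat -size_filter.
  case: (posnP (size [seq p <- ps | lp p == (M + l).+1])) => [->//|].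
  rewrite -has_predT => /hasP [p]; rewrite mem_filter => /andP [/eqP pl pps] _.
  have [pp _ _] := hps p pps; have [lpr lpp] := hlp p pp; rewrite pl in lpr lpp.
  have nz : (M + l).+1%:R != 0 :> A.
    apply/eqP => h; have := natA_inj basis (ltn0Sn (M + l)) (x := 1); rewrite mulr1 => /(_ h) /eqP.
    by rewrite oner_eq0.
  apply: (few_primes domain (L := (M + l).+1) (g := (M + l).+1%:R)) => //;
    first by rewrite (leq_trans MB) // leqW // leq_addr.
  - rewrite -[_%:R]mulr1 heightMn expnS leq_mul2l -mulnn /=.
    by apply: leq_trans Mh _; nia.
  - exact: filter_uniq.
  - move=> p'; rewrite mem_filter => /andP [/eqP pl' pps'].
    have [pp' _ _] := hps p' pps'; have [lpr' lpp'] := hlp p' pp'; rewrite pl' in lpr' lpp'.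
    by split=> //; apply: (prime_le_norm basis domain).
rewrite -mulr_sumr ler_wpM2l ?ler0n // (le_trans (sum_inv_sq _ _ M0)) //.
by rewrite gerBl invr_ge0 ler0n.
Qed.

(** Three cases: the residue characteristic is at most 2 H, or it is larger and [quad] vanishes, or
    it is larger and [quad] is nonzero. In 16 k, 4 k bounds the number of primes over l and 4 is the
    square of the 2 in X / l + 1 <= 2 X / l; in 4 k + 1, the 1 is the zero set of [quad]. *)
Lemma cnt_tail_le M H : (6 * d <= M)%N -> (2 * B + 1 < M)%N -> (height 1%R <= M)%N ->
  (2 * B + 1 < 2 * H)%N -> (3 * d * B <= 2 * H)%N -> forall R : realType,
  (cnt (- H%:Z) (2 * H) (tail_set M))%:R <=
  ((16 * k)%:R / M%:R + (4 * k + 1)%:R / (2 * H)%:R) * (E (2 * H))%:R :> R.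
Proof.
move=> Md MB Mh XB Xd R; set X := (2 * H)%N.
have X0 : (0 < X)%N by rewrite /X; lia.
have [lp hlp] := residue_prime_fun.
pose G := {ffun 'I_d.+1 -> {ffun 'I_k -> 'I_X}}.
pose small (r : G) (p : set A) := [/\ is_prime p, (M < lp p)%N, (lp p <= X)%N &
  shifted_eis_set p (pt e (- H%:Z) r)].
have [P hP] : exists P : G -> set A, forall r, (exists p, small r p) -> small r (P r).
  suff /choice [f hf] : forall r, exists p', (exists p, small r p) -> small r p' by exists f.
  move=> r; case: (pselect (exists p, small r p)) => [[p hp]|hn]; first by exists p.
  by exists set0 => /hn.
pose Q := undup [seq P r | r <- enum [pred r : G | `[< exists p, small r p >]]].
have hQ p : p \in Q -> [/\ is_prime p, (M < lp p)%N & (lp p <= X)%N].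
  rewrite mem_undup => /mapP [r]; rewrite mem_enum finset.inE => /asboolP /hP [h1 h2 h3 _] ->.
  by split.
pose D (p : set A) : set 'rV[A]_d.+1 := [set v : 'rV[A]_d.+1 | [/\ ~ p (v 0 (top 0)),
  p (quad v) & p (cubic v)]].
pose Z : set 'rV[A]_d.+1 := [set v : 'rV[A]_d.+1 | v 0 (top 0) != 0 /\ quad v = 0].
have cover_tail : (cnt (- H%:Z) X (tail_set M) <= \sum_(p <- Q) cnt (- H%:Z) X (D p) +
    (cnt (- H%:Z) X Z + cnt (- H%:Z) X (large_set X)))%N.
  rewrite /cnt exchange_big -!big_split; apply: leq_sum => r _ /=.
  case: asboolP => // -[p [pp pM hp]].
  have [lpr lpp] := hlp p pp; have idp : is_ideal p by case: pp.
  have [t0 tq tc] := shifted_eis_quad_cubic d3 idp hp.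
  case: (leqP (lp p) X) => [lX|Xl].
    have [pp' h1 h2 h3] : small r (P r) by apply: hP; exists p; split=> //; apply: pM.
    have idp' : is_ideal (P r) by case: pp'.
    rewrite (big_rem (P r)) /=; last first.
      rewrite mem_undup map_f // mem_enum finset.inE; apply/asboolP; exists p; split=> //.
      exact: pM.
    by case: asboolP => // -[]; apply: shifted_eis_quad_cubic.
  case: (eqVneq (quad (pt e (- H%:Z) r)) 0) => [q0|q0].
    rewrite [X in (_ <= _ + (X + _))%N](_ : _ = 1%N) ?addn1 ?addnS ?addSn //.
    case: asboolP => // -[]; split=> //; apply: contra_notN t0 => /eqP ->; exact: idl0.
  rewrite [X in (_ <= _ + (_ + X))%N](_ : _ = 1%N) ?addn1 ?addnS //.
  case: asboolP => // -[]; split=> //; exists p, (lp p); split=> //; split; last exact: ltnW.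
  by have := pM _ lpr lpp; lia.
have E0 : (0 < E X)%N by rewrite expn_gt0 X0.
have cD : \sum_(p <- Q) (cnt (- H%:Z) X (D p))%:R <= (16 * k)%:R / M%:R * (E X)%:R :> R.
  apply: (@le_trans _ _ (\sum_(p <- Q) (4 * E X)%:R * (lp p)%:R ^- 2)).
    rewrite big_seq [leRHS]big_seq; apply: ler_sum => p /hQ [pp h1 h2].
    have [lpr lpp] := hlp p pp; have l0 := prime_gt0 lpr.
    rewrite ler_pdivlMr ?exprn_gt0 ?ltr0n // -natrX -natrM ler_nat.
    have := cnt_small_prime basis d3 X (- H%:Z) pp lpr lpp (leq_ltn_trans Md h1).
    rewrite -/(D p); move: (cnt _ _ (D p)) => C hC.
    have hdiv : ((X %/ lp p).+1 * lp p <= 2 * X)%N.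
      by rewrite mulSn; have := leq_divM X (lp p); lia.
    rewrite -(leq_pmul2l (_ : 0 < X ^ 2)%N) ?expn_gt0 ?X0 //.
    apply: (@leq_trans ((X %/ lp p).+1 ^ 2 * E X * lp p ^ 2)%N).
      by rewrite mulnA (mulnC (X ^ 2)%N) leq_mul2r hC orbT.
    rewrite mulnAC -expnMn; apply: (@leq_trans ((2 * X) ^ 2 * E X)%N).
      by rewrite leq_mul2r leq_exp2r // hdiv orbT.
    by rewrite expnMn mulnCA -mulnA.
  rewrite -mulr_sumr; have := @sum_residue_primes R lp Q M X _ MB Mh hlp (undup_uniq _) hQ.
  move=> /(_ ltac:(lia)) le.
  apply: le_trans (ler_wpM2l (ler0n _ _) le) _.
  rewrite le_eqVlt; apply/orP; left; apply/eqP; rewrite !natrM.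
  rewrite (_ : 16 = 4 * 4 :> R); last by rewrite -natrM.
  by ring.
have cZ : (cnt (- H%:Z) X Z * X <= E X)%N := cnt_quad_eq0 basis domain d3 X (- H%:Z).
have cL : (cnt (- H%:Z) X (large_set X) * X <= 4 * k * E X)%N.
  apply: cnt_large => // r; apply: (@leq_trans (3 * d * (B * H ^ 2))%N).
    by apply: quad_height => i; apply: box_row_height.
  rewrite mulnA (expnS X 2); apply: leq_mul; first exact: Xd.
  by rewrite leq_exp2r // /X; lia.
move: cover_tail; rewrite -(ler_nat R) => le; apply: le_trans le _.
rewrite natrD natr_sum mulrDl lerD //.
rewrite mulrAC ler_pdivlMr ?ltr0n // -!natrM ler_nat mulnDl mulnDl mul1n addnC.
exact: leq_add.
Qed.
End Tail.

(** * Residues in an interval of integers *)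

Definition residue_count (n N : nat) (c : int) (r : nat) : nat :=
  #|[pred t : 'I_N | ((t%:Z + c) %% n)%Z == r]|.

Lemma residue_count_bounds n N c r : (r < n)%N ->
  (residue_count n N c r * n <= N + n)%N /\ (N <= residue_count n N c r * n + n)%N.
Proof.
move=> rn; have n0 : (0 < n)%N by apply: leq_ltn_trans rn.
have nz : n%:Z != 0 by rewrite eqz_nat -lt0n.
pose r' := `|((r%:Z - c) %% n)%Z|%N.
have r'E : r'%:Z = ((r%:Z - c) %% n)%Z by rewrite gez0_abs // modz_ge0.
have r'n : (r' < n)%N by rewrite -ltz_nat r'E ltz_pmod.
have E (t : nat) : (((t%:Z + c) %% n)%Z == r) = (t %% n == r')%N.
  have -> : (r : int) = (r %% n)%Z by rewrite modz_small // le0z_nat ltz_nat.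
  rewrite -eqz_nat r'E -modz_nat !eqz_mod_dvd; congr (_ %| _)%Z; lia.
split.
  suff : (residue_count n N c r <= (N %/ n).+1)%N.
    by move=> h; apply: (@leq_trans ((N %/ n).+1 * n)%N);
      rewrite ?leq_mul2r ?h ?orbT // mulSn addnC leq_add2r leq_divM.
  have lt (t : 'I_N) : (t %/ n < (N %/ n).+1)%N by rewrite ltnS leq_div2r // ltnW.
  rewrite -[leqRHS]card_ord; apply: (@leq_card_in _ _ (fun t => Ordinal (lt t))) => t t'.
  rewrite !finset.inE !E => /eqP h /eqP h' [] hq; apply/val_inj => /=.
  by rewrite (divn_eq t n) (divn_eq t' n) hq h h'.
suff : (N %/ n <= residue_count n N c r)%N.
  move=> h; rewrite {1}(divn_eq N n); apply: leq_add; last exact: ltnW (ltn_pmod _ n0).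
  by rewrite leq_mul2r h orbT.
have lt (q : 'I_(N %/ n)) : (q * n + r' < N)%N.
  apply: leq_trans (leq_divM N n); apply: (@leq_trans (q.+1 * n)%N).
    by rewrite mulSn addnC ltn_add2r.
  by rewrite leq_mul2r ltn_ord orbT.
pose f q := Ordinal (lt q).
rewrite -[leqLHS]card_ord -(card_imset (f := f)); last first.
  move=> q q' /(congr1 val) /= h; apply/val_inj/eqP => /=.
  by rewrite -(eqn_pmul2r n0) -(eqn_add2r r') h.
apply/subset_leq_card/fintype.subsetP => _ /imsetP [q _ ->].
by rewrite finset.inE E /= modnMDl modn_small.
Qed.

(** * Equidistribution of periodic sets *)

Section Equidistribution.
Variables (A : comNzRingType) (k : nat) (e : 'I_k -> A).
Hypothesis basis : forall x : A, exists! a : {ffun 'I_k -> int}, x = \sum_j e j *~ a j.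
Local Notation cnt := (cnt e).
Variables (m n : nat).
Local Notation n1 := n.+1.

Lemma card_residue c N (r : {ffun 'I_m -> {ffun 'I_k -> 'I_n1}}) :
  (\sum_(s : {ffun 'I_m -> {ffun 'I_k -> 'I_N}}) (residue_row basis n (pt e c s) == r) =
   \prod_i \prod_j residue_count n1 N c (r i j))%N.
Proof.
transitivity (\prod_(i < m) \sum_(x : {ffun 'I_k -> 'I_N}) \prod_(j < k)
   ((((x j)%:Z + c) %% n1)%Z == r i j))%N; last first.
  apply: eq_bigr => i _; transitivity (\prod_(j < k) \sum_(t < N) ((t%:Z + c) %% n1 == r i j)%Z)%N.
    by rewrite bigA_distr_bigA.
  apply: eq_bigr => j _; rewrite /residue_count -sum1_card [RHS]big_mkcond.
  by apply: eq_bigr => t _; rewrite finset.inE; case: eqP.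
rewrite bigA_distr_bigA; apply: eq_bigr => s _ /=.
have E i j : (residue_row basis n (pt e c s) i j == r i j) = ((((s i j)%:Z + c) %% n1)%Z == r i j).
  by rewrite ffunE -val_eqE -eqz_nat residueE mxE coords_pt1.
case: eqP => [h|h].
  by rewrite big1 // => i _; rewrite big1 // => j _; rewrite -E h eqxx.
have [i hi] : exists i, residue_row basis n (pt e c s) i <> r i.
  by apply/existsNP => h'; apply: h; apply/ffunP.
have [j hj] : exists j, residue_row basis n (pt e c s) i j <> r i j.
  by apply/existsNP => h'; apply: hi; apply/ffunP.
by rewrite (bigD1 i) //= (bigD1 j) //= -E; case: eqP.
Qed.

Lemma cnt_periodic c N (T : set 'rV[A]_m) : periodic_mod (multiples n1) T ->
  cnt c N T = (\sum_(r : {ffun 'I_m -> {ffun 'I_k -> 'I_n1}})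
    `[< T (pt e 0 r) >] * \prod_i \prod_j residue_count n1 N c (r i j))%N.
Proof.
move=> hT; under [RHS]eq_bigr do rewrite -card_residue big_distrr /=.
rewrite exchange_big; apply: eq_bigr => s _ /=.
rewrite (bigD1 (residue_row basis n (pt e c s))) //= eqxx muln1 big1 ?addn0.
  congr (nat_of_bool (asbool _)); apply: (periodicE (multiples_ideal n1) hT).
  by apply: congmC; [exact: multiples_ideal | exact: residue_row_pt].
by move=> r; rewrite eq_sym => /negPf ->; rewrite muln0.
Qed.

Lemma residue_count_cvg (R : realType) (r : nat) : (r < n1)%N ->
  (residue_count n1 (2 * H) (- H%:Z) r)%:R / (2 * H)%:R @[H --> \oo] --> (n1%:R^-1 : R).
Proof.
move=> rn; apply/cvgrPdist_le => eps eps0.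
near=> H.
have [h1 h2] := residue_count_bounds (2 * H) (- H%:Z) rn.
have H0 : (0 < H)%N by near: H; exists 1%N.
have HR : eps^-1 <= (2 * H)%:R.
  apply: (@le_trans _ _ H%:R); last by rewrite ler_nat; lia.
  by near: H; apply: nbhs_infty_ger.
have X0 : (0 < 2 * H)%N by lia.
move: h1 h2; move: (residue_count _ _ _ _) => a; move: (2 * H)%N X0 HR => X.
rewrite -(ltr0n R) -!(ler_nat R) !natrD !natrM.
move: (X%:R : R) => {}X X0 HR.
have n0 : 0 < n1%:R :> R by rewrite ltr0n.
move: (n1%:R : R) n0 (a%:R : R) => nR n0 aR h1 h2.
have eX : 1 <= eps * X by rewrite mulrC -ler_pdivrMr // mul1r.
have -> : nR^-1 - aR / X = (X - aR * nR) / (nR * X) by field; rewrite !gt_eqF.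
rewrite normrM normfV (gtr0_norm (mulr_gt0 n0 X0)) ler_pdivrMr ?mulr_gt0 //.
rewrite mulrCA; apply: (@le_trans _ _ nR).
  by rewrite ler_norml; apply/andP; split; lra.
by rewrite ler_peMr // ltW.
Unshelve. all: end_near.
Qed.

Lemma density_periodic (R : realType) (T : set 'rV[A]_m) : periodic_mod (multiples n1) T ->
  (cnt (- H%:Z) (2 * H) T)%:R / (2 * H)%:R ^+ (m * k) @[H --> \oo] -->
  ((cnt 0 n1 T)%:R / n1%:R ^+ (m * k) : R).
Proof.
move=> hT.
have -> : (cnt 0 n1 T)%:R / n1%:R ^+ (m * k) =
   \sum_(r : {ffun 'I_m -> {ffun 'I_k -> 'I_n1}})
     (`[< T (pt e 0 r) >]%:R * \prod_(i < m) \prod_(j < k) n1%:R^-1) :> R.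
  rewrite natr_sum mulr_suml; apply: eq_bigr => r _; congr (_ * _).
  by rewrite !prodr_const !card_ord -exprM exprVn mulnC.
have -> : (fun H => (cnt (- H%:Z) (2 * H) T)%:R / (2 * H)%:R ^+ (m * k)) =
   (fun H => \sum_(r : {ffun 'I_m -> {ffun 'I_k -> 'I_n1}})
     (`[< T (pt e 0 r) >]%:R * \prod_(i < m) \prod_(j < k)
        ((residue_count n1 (2 * H) (- H%:Z) (r i j))%:R / (2 * H)%:R))) :> (nat -> R).
  apply/funext => H; rewrite (cnt_periodic _ _ hT) natr_sum mulr_suml; apply: eq_bigr => r _.
  rewrite natrM -mulrA; congr (_ * _); rewrite natr_prod.
  under [RHS]eq_bigr do rewrite big_split /=.
  rewrite big_split /=; congr (_ * _); first by apply: eq_bigr => i _; rewrite natr_prod.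
  by rewrite !prodr_const !card_ord -exprM exprVn (mulnC m k).
apply: cvg_big => [|r _]; first exact: add_continuous.
apply: cvgM; first exact: cvg_cst.
apply: cvg_big => [|i _]; first exact: mul_continuous.
apply: cvg_big => [|j _]; first exact: mul_continuous.
by apply: residue_count_cvg; apply: ltn_ord.
Qed.
End Equidistribution.

(** * Infinite products with factors between 0 and 1 *)

Section InfiniteProduct.
Variables (R : realType) (I : choiceType) (P : set I) (F : I -> R).
Hypothesis F01 : forall i, 0 <= F i <= 1.

Definition partial_prod (S : {fset P}) : R := \prod_(i <- S) F (val i).

Lemma partial_prod_ge0 S : 0 <= partial_prod S.
Proof. by apply: prodr_ge0 => i _; case/andP: (F01 (val i)). Qed.

Lemma partial_prod_le (S S' : {fset P}) : (S `<=` S')%fset -> partial_prod S' <= partial_prod S.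
Proof.
move=> SS'; rewrite /partial_prod (big_fsetID _ (mem S)) /=.
have -> : [fset x in S' | x \in S]%fset = S.
  by apply/fsetP => x; rewrite !inE /= andbC; case: (boolP (x \in S)) => // /(fsubsetP SS') ->.
rewrite ler_piMr ?partial_prod_ge0 //; apply: prodr_ile1 => i _; exact: F01.
Qed.

(** The partial products decrease along inclusion, so the limit is their infimum. The two further
    clauses are the form in which the density argument uses it. *)
Lemma infinite_product_exists : exists l, [/\ has_infinite_product P F l,
  (forall S : {fset P}, l <= partial_prod S) &
  (forall eps, 0 < eps -> exists S : {fset P}, partial_prod S < l + eps)].
Proof.
pose E := [set partial_prod S | S in [set: {fset P}]].
have Einf : has_inf E.
  split; first by exists (partial_prod fset0), fset0.
  by exists 0 => _ [S _ <-]; apply: partial_prod_ge0.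
have h1 S : inf E <= partial_prod S by apply: ge_inf; [case: Einf | exists S].
have h2 eps : 0 < eps -> exists S, partial_prod S < inf E + eps.
  by move=> e0; have [_ [S _ <-] h] := inf_adherent e0 Einf; exists S.
exists (inf E); split=> //; have FF := @totally_filter P.
apply/cvgrPdist_lt => eps e0.
have [S0 hS0] := h2 eps e0; exists S0 => // S /partial_prod_le hS /=.
have := h1 S; rewrite -/(partial_prod S) => h3.
by rewrite distrC ger0_norm ?subr_ge0 // ltrBlDl (le_lt_trans hS).
Qed.
End InfiniteProduct.

(** By induction from (1 - x) (1 + x + S) <= 1 + S. A large sum of the [c i] thus forces a small
    product. *)
Lemma prod_one_minus_le (R : realType) (J : eqType) (s : seq J) (c : J -> R) :
  (forall i, i \in s -> 0 <= c i <= 1) ->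
  (\prod_(i <- s) (1 - c i)) * (1 + \sum_(i <- s) c i) <= 1.
Proof.
elim: s => [_|i s IH hs]; first by rewrite !big_nil addr0 mulr1.
have /andP [c0 c1] := hs i (mem_head _ _).
have hs' j : j \in s -> 0 <= c j <= 1 by move=> js; apply: hs; rewrite inE js orbT.
rewrite !big_cons; have := IH hs'.
have S0 : 0 <= \sum_(i <- s) c i.
  by rewrite big_seq; apply: sumr_ge0 => j /hs' /andP [].
have P0 : 0 <= \prod_(i <- s) (1 - c i).
  by rewrite big_seq; apply: prodr_ge0 => j /hs' /andP [_]; rewrite subr_ge0.
move: (\sum_(i <- s) c i) (\prod_(i <- s) _) (c i) c0 c1 S0 P0 => S P x x0 x1 S0 P0 h.
apply: le_trans h; rewrite mulrAC mulrC ler_wpM2l //; nra.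
Qed.

(** * Densities *)

Section Density.
Variables (A : comNzRingType) (k : nat) (e : 'I_k -> A).
Hypothesis basis : forall x : A, exists! a : {ffun 'I_k -> int}, x = \sum_j e j *~ a j.
Hypothesis domain : forall x y : A, x * y = 0 -> x = 0 \/ y = 0.
Hypothesis normal : forall (b w : A) (n i j : nat), (0 < n)%N -> (i < j)%N ->
  b ^+ j = b ^+ i * n%:R ^+ (j - i) + w * n%:R ^+ j -> multiples n b.
Local Notation cnt := (cnt e).
Variables (R : realType) (d : nat) (d1 : (1 < d)%N).

Local Notation Seis p := (@shifted_eis_set A p d).

Definition euler_factor (p : set A) : R :=
  1 - ((ideal_norm p)%:R - 1) ^+ 2 / (ideal_norm p)%:R ^+ d.+1.

Definition box_mean (T : set 'rV[A]_d.+1) (H : nat) : R :=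
  (cnt (- H%:Z) (2 * H) T)%:R / (2 * H)%:R ^+ (d.+1 * k).

Lemma box_mean_le T U H : T `<=` U -> box_mean T H <= box_mean U H.
Proof.
move=> TU; rewrite ler_wpM2r ?invr_ge0 ?exprn_ge0 // ler_nat; exact: cnt_mono.
Qed.

Lemma box_mean_setU T U H : box_mean (T `|` U) H <= box_mean T H + box_mean U H.
Proof.
rewrite -mulrDl ler_wpM2r ?invr_ge0 ?exprn_ge0 // -natrD ler_nat -big_split.
by apply: leq_sum => r _; case: asboolP => // -[h|h]; do ?case: asboolP.
Qed.

Lemma box_mean_le1 T H : box_mean T H <= 1.
Proof.
case: (posnP H) => [->|H0].
  (* At H = 0 the denominator is 0 because the exponent is positive, and its inverse is 0 by
     convention. *)
  by rewrite /box_mean muln0 expr0n muln_eq0 /= eqn0Ngt (rank_gt0 basis) /= invr0 mulr0 ler01.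
rewrite ler_pdivrMr ?exprn_gt0 ?ltr0n ?muln_gt0 // mul1r -natrX ler_nat.
by rewrite -(cnt_setT e _ (- H%:Z)); apply: cnt_mono.
Qed.

Definition shifted_eis_some (ps : seq (set A)) : set 'rV[A]_d.+1 :=
  [set v | exists2 p, p \in ps & Seis p v].

Lemma common_multiple (ps : seq (set A)) : (forall p, p \in ps -> is_prime p) ->
  exists n, forall p, p \in ps -> ideal_mul p p n.+1%:R.
Proof.
elim: ps => [|p ps IH] hps; first by exists 0%N.
have [|n hn] := IH; first by move=> x xs; apply: hps; rewrite inE xs orbT.
have pp := hps p (mem_head _ _); have [l lp pl] := prime_nat basis domain pp.
have l0 := prime_gt0 lp.
exists (l * l * n.+1).-1 => x; rewrite prednK ?muln_gt0 ?l0 // natrM inE => /orP [/eqP ->|xs].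
  by apply: (idlMr (sq_ideal pp)); rewrite natrM; apply: sq_mul.
by apply: (idlM (sq_ideal _)); [apply: hps; rewrite inE xs orbT | apply: hn].
Qed.

(** Passing to complements replaces inclusion-exclusion: missing all the sets is an intersection of
    periodic conditions, which [cnt_prime_indep] turns into a product. *)
Lemma density_finite (ps : seq (set A)) : uniq ps -> (forall p, p \in ps -> is_prime p) ->
  box_mean (shifted_eis_some ps) @ \oo --> 1 - \prod_(p <- ps) euler_factor p.
Proof.
move=> ups hps; have [n hn] := common_multiple hps.
pose N := (n.+1 ^ (d.+1 * k))%N.
have N0 : N%:R != 0 :> R by rewrite pnatr_eq0 -lt0n expn_gt0.
have periodic_some : periodic_mod (multiples n.+1) (shifted_eis_some ps).
  move=> v w h [p pps hp]; exists p => //; have pp := hps p pps.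
  by apply: (shifted_eis_periodic pp d1) hp => i; apply: (multiples_sub (sq_ideal pp) (hn p pps)).
have := @density_periodic A k e basis d.+1 n R _ periodic_some.
suff -> : (cnt 0 n.+1 (shifted_eis_some ps))%:R / n.+1%:R ^+ (d.+1 * k) =
  1 - \prod_(p <- ps) euler_factor p :> R by [].
have indep := @cnt_prime_indep A k e basis domain d.+1 n ps (fun p => ~` Seis p) ups.
have hT p : p \in ps -> [/\ is_prime p, ideal_mul p p n.+1%:R &
    periodic_mod (ideal_mul p p) (~` (Seis p))].
  move=> pps; have pp := hps p pps; split=> //; first exact: hn.
  move=> v w h hv hw; apply: hv; apply: (shifted_eis_periodic pp d1) hw.
  exact: (congmC (sq_ideal pp) h).
have {indep} := indep hT.
have -> : [set v | forall p, p \in ps -> (~` Seis p) v] = ~` shifted_eis_some ps.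
  apply/seteqP; split=> v hv; first by move=> [p pps hp]; apply: hv hp.
  by move=> p pps hp; apply: hv; exists p.
move=> /(congr1 (fun x => x%:R : R)); rewrite !natrM natr_prod -/N [(N ^ _)%:R]natrX => indep.
have := cnt_setC e 0 n.+1 (shifted_eis_some ps) => /(congr1 (fun x => x%:R : R)).
rewrite natrD -/N -natrX => hC.
have -> : \prod_(p <- ps) euler_factor p = \prod_(p <- ps) ((cnt 0 n.+1 (~` (Seis p)))%:R / N%:R).
  rewrite big_seq [RHS]big_seq; apply: eq_bigr => p pps; have pp := hps p pps.
  have := cnt_setC e 0 n.+1 (Seis p) => /(congr1 (fun x => x%:R : R)).
  have := density_shifted_eis basis domain normal pp d1 (hn p pps) => /(congr1 (fun x => x%:R : R)).
  rewrite natrD -/N !natrM !natrX -[n.+1%:R ^+ _]natrX -/N.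
  have q1 := norm_gt1 basis domain pp.
  have q0 : (ideal_norm p)%:R != 0 :> R by rewrite pnatr_eq0 -lt0n ltnW.
  have Eq : (ideal_norm p)%:R - 1 = (ideal_norm p).-1%:R :> R.
    by rewrite -{1}(prednK (ltnW q1)) -natr1 addrK.
  rewrite /euler_factor Eq.
  move=> h1 h2; have -> : (cnt 0 n.+1 (~` (Seis p)))%:R =
    N%:R - (cnt 0 n.+1 (Seis p))%:R :> R by rewrite -h2 addrC addKr.
  rewrite mulrBl divff //; congr (1 - _); apply/eqP; rewrite eqr_div ?expf_neq0 //.
  by rewrite -h1 mulrC.
rewrite big_split /= [X in 1 - _ * X]big_const_seq count_predT iter_mulr_1 exprVn.
have NX0 : N%:R ^+ size ps != 0 :> R by rewrite expf_neq0.
set U' := (cnt 0 n.+1 (~` _))%:R in indep hC; set C := \prod_(p <- ps) _ in indep *.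
have -> : C = U' * N%:R ^+ size ps / N%:R by rewrite -indep mulfK.
rewrite -/N.
have -> : (cnt 0 n.+1 (shifted_eis_some ps))%:R = N%:R - U' :> R by rewrite -hC addrK.
by move: (_ ^+ size ps) NX0 => Y Y0; field; rewrite Y0 N0.
Qed.

(** Every such prime contains M!, hence is determined by its set of residues modulo M!, and there
    are finitely many sets of residues. *)
Lemma primes_containing_small M : exists ps : seq (set A), forall p,
  (is_prime p /\ exists2 l, prime l /\ (l <= M)%N & p l%:R) <-> p \in ps.
Proof.
pose n := (M`!).-1; have n1 : n.+1 = M`! by rewrite prednK // fact_gt0.
pose F := {ffun 'I_k -> 'I_n.+1}.
pose small (p : set A) := is_prime p /\ exists2 l, prime l /\ (l <= M)%N & p l%:R.
pose res (p : set A) : {set F} := [set r : F | `[< p (pt1 e 0 r) >]]%SET.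
have res_inj p p' : small p -> small p' -> res p = res p' -> p = p'.
  have sub q q' : small q -> small q' -> res q = res q' -> q `<=` q'.
    move=> [pq [l [lp lM] hl]] [pq' [l' [lp' lM'] hl']] E x qx.
    have idq : is_ideal q by case: pq.
    have idq' : is_ideal q' by case: pq'.
    have fact_in (s : set A) c : is_ideal s -> prime c -> (c <= M)%N -> s c%:R -> s n.+1%:R.
      move=> ids cp cM sc; have /dvdnP [a ->] : (c %| n.+1)%N by rewrite n1 dvdn_fact // prime_gt0.
      by rewrite natrM; apply: idlM.
    have hr := residue_pt1 basis n x.
    have : residue basis n x \in res q.
      rewrite finset.inE; apply/asboolP.
      by apply/(idl_congr idq (multiples_sub idq (fact_in q l idq lp lM hl) hr)).
    rewrite E finset.inE => /asboolP.
    exact: (idl_congr idq' (multiples_sub idq' (fact_in q' l' idq' lp' lM' hl') hr)).2.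
  by move=> h h' E; apply/seteqP; split; apply: sub.
have [f hf] : exists f : {set F} -> set A, forall X, (exists2 p, small p & res p = X) ->
  small (f X) /\ res (f X) = X.
  suff /choice [f hf] : forall X : {set F}, exists q, (exists2 p, small p & res p = X) ->
    small q /\ res q = X by exists f.
  move=> X; case: (pselect (exists2 p, small p & res p = X)) => [[p hp hX]|hn]; first by exists p.
  by exists set0 => /hn.
exists [seq f X | X <- enum [pred X : {set F} | `[< exists2 p, small p & res p = X >]]] => p.
split=> [hp|/mapP [X]].
  have ex : exists2 p', small p' & res p' = res p by exists p.
  have [h1 h2] := hf _ ex; apply/mapP; exists (res p); last by apply: res_inj.
  by rewrite mem_enum finset.inE; apply/asboolP.
by rewrite mem_enum finset.inE => /asboolP /hf [h _] ->.
Qed.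

Lemma euler_factor_bound p : d = 2 -> is_prime p ->
  0 <= 1 - euler_factor p <= 1 /\ ((ideal_norm p)%:R)^-1 / 4 <= 1 - euler_factor p.
Proof.
move=> d2 pp; rewrite /euler_factor d2 opprB addrC subrK.
have : 2 <= (ideal_norm p)%:R :> R by rewrite ler_nat (norm_gt1 basis domain pp).
move: (ideal_norm p)%:R => q q2; have q0 : 0 < q by lra.
split; last first.
  rewrite ler_pdivlMr ?exprn_gt0 //.
  have -> : q^-1 / 4 * q ^+ 3 = q ^+ 2 / 4 by field; rewrite gt_eqF.
  by rewrite !expr2; nra.
apply/andP; split; first by apply: divr_ge0; [exact: sqr_ge0 | apply: exprn_ge0; exact: ltW].
rewrite ler_pdivrMr ?exprn_gt0 // mul1r; apply: (@le_trans _ _ (q ^+ 2)).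
  by rewrite !expr2; nra.
by rewrite [leRHS]exprS; apply: ler_peMl; [apply: exprn_ge0 | ]; lra.
Qed.

Lemma quadratic_product_le0 (l : R) : d = 2 ->
  (forall ps, uniq ps -> (forall p, p \in ps -> is_prime p) ->
    l <= \prod_(p <- ps) euler_factor p) ->
  l <= 0.
Proof.
move=> d2 hl; rewrite leNgt; apply/negP => l0.
(* The bound 4 / l is chosen so that, after the factor 1/4 of [euler_factor_bound], the sum exceeds
   1 / l; then l times (1 + sum) exceeds 1, against [prod_one_minus_le]. *)
have [ps [ups hps hsum]] := norm_sum_unbounded basis domain (4 / l).
have := @prod_one_minus_le R _ ps (fun p => 1 - euler_factor p) (fun p hp =>
  (euler_factor_bound d2 (hps p hp)).1).
under eq_bigr do rewrite subKr.
apply/negP; rewrite -ltNge.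
have hS : l^-1 < \sum_(p <- ps) (1 - euler_factor p).
  apply: (@lt_le_trans _ _ (\sum_(p <- ps) (ideal_norm p)%:R^-1 / 4)).
    by rewrite -mulr_suml ltr_pdivlMr // mulrC.
  by rewrite big_seq [leRHS]big_seq; apply: ler_sum => p /hps /(euler_factor_bound d2) [].
apply: (@lt_le_trans _ _ (l * (1 + \sum_(p <- ps) (1 - euler_factor p)))); last first.
  rewrite ler_wpM2r ?hl // addr_ge0 // (le_trans _ (ltW hS)) // invr_ge0 ltW //.
rewrite mulrDr mulr1 -[ltLHS]add0r ltrD //.
by rewrite -[ltLHS](divff (lt0r_neq0 l0)) ltr_pM2l.
Qed.

Definition shifted_eis_any : set 'rV[A]_d.+1 := [set v | exists2 p, is_prime p & Seis p v].

Lemma density_shifted_eis_any (l : R) :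
  (forall ps, uniq ps -> (forall p, p \in ps -> is_prime p) ->
    l <= \prod_(p <- ps) euler_factor p) ->
  (forall eps, 0 < eps -> exists ps, [/\ uniq ps, (forall p, p \in ps -> is_prime p) &
     \prod_(p <- ps) euler_factor p < l + eps]) ->
  box_mean shifted_eis_any @ \oo --> 1 - l.
Proof.
move=> hl hinf; apply/cvgrPdist_le => eps eps0.
have eps2 : 0 < eps / 2 by rewrite divr_gt0.
have lower : \forall H \near \oo, 1 - l - eps <= box_mean shifted_eis_any H.
  have [ps [ups hps hprod]] := hinf _ eps2.
  have /cvgrPdist_le /(_ _ eps2) := density_finite ups hps.
  apply: filterS => H; rewrite ler_norml => /andP [_ h].
  have hU : box_mean (shifted_eis_some ps) H <= box_mean shifted_eis_any H.
    by apply: box_mean_le => v [p /hps pp hp]; exists p.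
  move: h hU hprod; move: (\prod_(_ <- _) _) (box_mean _ _) (box_mean _ _) => x y z h1 h2 h3; lra.
have upper : \forall H \near \oo, box_mean shifted_eis_any H <= 1 - l + eps.
  (* For d = 2 the number [l] is at most 0, so the trivial bound 1 is enough. *)
  case: (ltngtP 2 d) d1 => // [d3 _|d2 _]; last first.
    near=> H; apply: le_trans (box_mean_le1 _ _) _.
    have := quadratic_product_le0 (esym d2) hl; lra.
  pose B := heightC basis.
  pose K : R := (16 * k)%:R / (eps / 4).
  (* The first three summands meet the size conditions of [cnt_tail_le]; the last makes its term 16
     k / M at most eps / 4. *)
  pose M := (6 * d + (2 * B + 2) + height basis 1 + (Num.bound K).+1)%N.
  have [ps hps] := primes_containing_small M.
  have ups : uniq (undup ps) := undup_uniq ps.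
  have hpp p : p \in undup ps -> is_prime p by rewrite mem_undup => /hps [].
  have /cvgrPdist_le /(_ _ eps2) := density_finite ups hpp.
  move=> hfin; near=> H.
  have H1 : (2 * B + 1 + 3 * d * B + (Num.bound ((4 * k + 1)%:R / (eps / 4))).+1 <= H)%N.
    by near: H; apply: nbhs_infty_ge.
  have h1 : box_mean (shifted_eis_some (undup ps)) H <= 1 - l + eps / 2.
    have : `|1 - \prod_(p <- undup ps) euler_factor p - box_mean (shifted_eis_some (undup ps)) H|
      <= eps / 2 by near: H.
    rewrite ler_norml => /andP [h _]; have := hl _ ups hpp.
    move: h; move: (\prod_(_ <- _) _) (box_mean _ _) => x y h; lra.
  have h2 : box_mean (tail_set M) H <= eps / 2.
    have X0 : (0 < 2 * H)%N by lia.
    rewrite ler_pdivrMr ?exprn_gt0 ?ltr0n //.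
    apply: le_trans (@cnt_tail_le A k e basis domain d d3 M H _ _ _ _ _ R) _; rewrite /M; try lia.
    rewrite natrX ler_wpM2r ?exprn_ge0 //.
    have bnd (c : nat) (N : nat) : (Num.bound (c%:R / (eps / 4) : R) < N)%N ->
      c%:R / N%:R <= eps / 4.
      move=> hN; have e4 : 0 < eps / 4 by rewrite divr_gt0.
      have N0 : 0 < N%:R :> R by rewrite ltr0n; apply: leq_trans hN.
      rewrite ler_pdivrMr // mulrC -ler_pdivrMr //.
      apply: ltW; apply: (lt_le_trans (archi_boundP _)); first by rewrite divr_ge0 // ltW.
      by rewrite ler_nat ltnW.
    have -> : eps / 2 = eps / 4 + eps / 4 by field.
    by apply: lerD; apply: bnd; rewrite -/K; lia.
  apply: (@le_trans _ _ (box_mean (shifted_eis_some (undup ps) `|` tail_set M) H)).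
    apply: box_mean_le => v [p pp hp].
    case: (pselect (exists2 c, prime c /\ (c <= M)%N & p c%:R)) => [ex|nex].
      by left; exists p => //; rewrite mem_undup; apply/hps.
    right; exists p; split=> // c cp pc; rewrite ltnNge; apply/negP => cM.
    by apply: nex; exists c.
  apply: le_trans (box_mean_setU _ _ _) _; have ->
    : 1 - l + eps = (1 - l + eps / 2) + eps / 2 by field.
  exact: lerD.
near=> H; rewrite ler_norml.
have : 1 - l - eps <= box_mean shifted_eis_any H by near: H.
have : box_mean shifted_eis_any H <= 1 - l + eps by near: H.
by move: (box_mean _ _) => x h1 h2; apply/andP; split; lra.
Unshelve. all: end_near.
Qed.
End Density.

(** * Rings of integers *)

Section RingOfIntegers.
Variable K : fieldExtType rat.
Local Notation oK := (ring_of_integers K).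

Lemma integers_domain (x y : oK) : x * y = 0 -> x = 0 \/ y = 0.
Proof.
move=> /(congr1 val); rewrite rmorphM rmorph0 => /eqP; rewrite mulf_eq0.
by move=> /orP [] /eqP h; [left | right]; apply: val_inj; exact: h.
Qed.

(** The fraction b / n is a root of X^j - X^i - w, which is monic because i < j and has integral
    coefficients; so it is integral over the integers. *)
Lemma integers_normal (b w : oK) (n i j : nat) : (0 < n)%N -> (i < j)%N ->
  b ^+ j = b ^+ i * n%:R ^+ (j - i) + w * n%:R ^+ j -> multiples n b.
Proof.
move=> n0 ij /(congr1 val); rewrite rmorphD !rmorphM !rmorphXn !rmorph_nat /= => E.
have nK : n%:R != 0 :> K by rewrite -(rmorph_nat (in_alg K)) fmorph_eq0 pnatr_eq0 -lt0n.
pose y : K := algint_val b / n%:R.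
have yE : y ^+ j - y ^+ i - algint_val w = 0.
  have Ej : n%:R ^+ j = n%:R ^+ (j - i) * n%:R ^+ i :> K by rewrite -exprD subnK // ltnW.
  rewrite /y !expr_div_n E Ej.
  have X0 : n%:R ^+ (j - i) != 0 :> K by rewrite expf_neq0.
  have Y0 : n%:R ^+ i != 0 :> K by rewrite expf_neq0.
  move: (n%:R ^+ (j - i)) (n%:R ^+ i) X0 Y0 => X Y X0 Y0.
  by field; rewrite X0 Y0.
pose P : {poly K} := 'X^j - ('X^i + (algint_val w)%:P).
have sz : (size ('X^i + (algint_val w)%:P : {poly K})%R < j.+1)%N.
  rewrite (leq_ltn_trans (size_polyD _ _)) // gtn_max size_polyXn ltnS ij.
  by rewrite (leq_ltn_trans (size_polyC_leq1 _)) // ltnS (leq_trans _ ij).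
have Pmonic : P \is monic.
  by rewrite monicE /P lead_coefDl ?lead_coefXn // size_polyN size_polyXn.
have Proot : root P y.
  by rewrite /root /P !hornerE opprD addrA yE.
have Pint : {in P : seq K, integralRange (intr : int -> K)}.
  apply/integral_poly => t; rewrite /P coefB coefD !coefXn coefC.
  apply: integral_sub; first exact: integral_nat.
  apply: integral_add; first exact: integral_nat.
  by case: eqP => _; [apply/asboolP; exact: algint_valP | exact: (integral_nat _ 0)].
have /asboolP yint := integral_root_monic Pmonic Proot Pint.
exists (RingOfIntegers yint); apply: val_inj.
by rewrite rmorphM rmorph_nat /= /y mulrC divfK.
Qed.

Lemma is_primeP (A : comNzRingType) (p : set A) :
  is_prime p <-> p \in nonzero_prime_ideals A.
Proof.
rewrite inE; split.
- move=> [[p0 pD pM] p1 pP [x px x0]]; split.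
  + split.
    * by rewrite inE.
    * by apply/negP; rewrite inE.
    * by move=> a u v; rewrite !inE => hu hv; apply: pD => //; apply: pM.
  + move=> u v; rewrite !inE => /pP [h|h]; apply/orP; [left|right]; by rewrite inE.
  + by apply/eqP => E; move: px; rewrite E => /eqP; rewrite (negPf x0).
- move=> [[p0 p1 pD] pP pn].
  have p0' : p 0 by move: p0; rewrite inE.
  have pD' a u v : p u -> p v -> p (a * u + v).
    by move=> hu hv; have := pD a u v; rewrite !inE; apply.
  split.
  + split=> // [x y hx hy|a x hx]; first by rewrite -[x]mul1r; apply: pD'.
    by rewrite -[_ * _]addr0; apply: pD'.
  + by move=> h; case/negP: p1; rewrite inE.
  + by move=> x y h; have := pP x y; rewrite !inE => /(_ h) /orP []; rewrite inE; [left|right].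
  + apply: contrapT => hN; case/eqP: pn; apply/seteqP; split=> [x px|x ->] //.
    by apply/eqP; apply: contraT => x0; case: hN; exists x.
Qed.

(** A shift keeps the coefficient of X^d. Lying outside [p] it is nonzero, so both the polynomial
    and its translate have degree exactly [d]. *)
Lemma shifted_eisenstein_setE (A : comNzRingType) d :
  shifted_eisenstein_set A d = @shifted_eis_any A d.
Proof.
have key p (pp : is_prime p) (v : 'rV[A]_d.+1) b :
    size (rVpoly v) = d.+1 /\ eisenstein p (rVpoly v \Po ('X + b%:P)) <-> eis_set p (row_shift b v).
  rewrite /eis_set /mkset /eis_poly rVpoly_shift; set f := rVpoly v; set g := f \Po _.
  have sf : (size f <= d.+1)%N := size_rVpoly v.
  have sg : (size g <= d.+1)%N by apply: leq_trans (size_shift _ _) sf.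
  have gd : g`_d = f`_d := lead_shift b sf.
  have full (h : {poly A}) : (size h <= d.+1)%N -> h`_d != 0 -> size h = d.+1.
    move=> sh hd; apply/eqP; rewrite eqn_leq sh ltnNge; apply/negP => /leq_sizeP /(_ d (leqnn d)).
    by move/eqP; rewrite (negPf hd).
  have p0 : p 0 by case: pp => -[].
  split.
    move=> [sfd [h1 h2 h3]].
    have fd : f`_d != 0 by rewrite -[d]/(d.+1.-1) -sfd -lead_coefE lead_coef_eq0 -size_poly_eq0 sfd.
    have sgd : size g = d.+1 by apply: full => //; rewrite gd.
    rewrite lead_coefE sgd /= in h1 h2; split.
    - by move=> h; case/negP: h1; rewrite inE.
    - by move=> i /h2; rewrite inE.
    - by move=> h; case/negP: h3; rewrite inE.
  move=> [h1 h2 h3]; have gd0 : g`_d != 0 by apply/eqP => E; apply: h1; rewrite E.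
  have sgd : size g = d.+1 by apply: full.
  split; first by apply: full => //; rewrite -gd.
  split; rewrite ?lead_coefE ?sgd /=.
  - by apply/negP; rewrite inE.
  - by move=> i /h2; rewrite inE.
  - by apply/negP; rewrite inE.
apply/seteqP; split=> v /=.
  move=> [sv [p /is_primeP pp [b hb]]]; exists p => //; exists b.
  by apply/key.
move=> [p pp [b /(key p pp v b) [sv hb]]]; split=> //; exists p; first exact/is_primeP.
by exists b.
Qed.

Lemma box_ratioE (R : realType) d (e : 'I_(\dim {:K}) -> oK) (T : set 'rV[oK]_d.+1) H :
  integral_basis e -> box_ratio R T e H = box_mean e R T H.
Proof.
move=> basis; rewrite /box_ratio /box_mean; congr (_%:R / _).
rewrite cnt_card; set D := [pred r | _].
have -> : fset_set (T `&` [set v | forall i, v 0 i \in box H e]) =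
   [fset pt e (- H%:Z) r | r in D]%fset.
  apply/fsetP => v; rewrite in_fset_set; last first.
    apply: (@sub_finite_set _ _ [set pt e (- H%:Z) r | r in
      [set: {ffun 'I_d.+1 -> {ffun 'I_(\dim {:K}) -> 'I_(2 * H)}}]]); last first.
      exact/finite_image/finite_finset.
    move=> {}v [_ hv].
    have /choice [f hf] : forall i, exists r : {ffun 'I_(\dim {:K}) ->
      'I_(2 * H)}, pt1 e (- H%:Z) r = v 0 i.
      move=> i; have := hv i; rewrite inE => -[a ha <-].
      by apply: (pt1_onto (basis := basis)) => j; rewrite (lincombK basis); have := ha j; lia.
    by exists (finfun f) => //; apply/rowP => i; rewrite mxE ffunE hf.
  apply/idP/imfsetP => [|[r /= hr ->]].
    rewrite inE => -[Tv hv].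
    have /choice [f hf] : forall i, exists r : {ffun 'I_(\dim {:K}) ->
      'I_(2 * H)}, pt1 e (- H%:Z) r = v 0 i.
      move=> i; have := hv i; rewrite inE => -[a ha <-].
      by apply: (pt1_onto (basis := basis)) => j; rewrite (lincombK basis); have := ha j; lia.
    have E : pt e (- H%:Z) (finfun f) = v by apply/rowP => i; rewrite mxE ffunE hf.
    by exists (finfun f) => //=; rewrite finset.inE E; apply/asboolP.
  rewrite inE; split; first by move: hr; rewrite finset.inE => /asboolP.
  move=> i; rewrite mxE inE; eexists; last reflexivity.
  by move=> j /=; rewrite ffunE; case: (r i j) => a /= ha; lia.
rewrite card_imfset //=; first by rewrite cardE.
move=> r s /rowP E; apply/ffunP => i; have := E i; rewrite !mxE; exact: (pt1_inj basis).
Qed.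
End RingOfIntegers.

Theorem corollary20 (R : realType) (K : fieldExtType rat) (d : nat)
    (hd : (2 <= d)%N) :
  exists2 l : R,
    has_infinite_product (nonzero_prime_ideals (ring_of_integers K))
      (fun p => 1 - ((ideal_norm p)%:R - 1) ^+ 2 / (ideal_norm p)%:R ^+ d.+1) l
  & has_density (shifted_eisenstein_set (ring_of_integers K) d) (1 - l).
Proof.
pose F : set (ring_of_integers K) -> R := @euler_factor (ring_of_integers K) R d.
(* All sets are included, not only primes, so the value 0 of [ideal_norm] has to be treated; there
   0^(d+1) has inverse 0 and the factor is 1. *)
have F01 p : 0 <= F p <= 1.
  rewrite /F /euler_factor; case: (ideal_norm p) => [|q];
    first by rewrite expr0n invr0 mulr0 subr0 ler01 lexx.
  have q0 : 0 < q.+1%:R ^+ d.+1 :> R by rewrite exprn_gt0 // ltr0n.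
  rewrite -[q.+1%:R - 1]/(q.+1%:R - 1%:R) -natrB // subn1 /= gerBl subr_ge0.
  rewrite divr_ge0 ?exprn_ge0 ?ler0n // andbT ler_pdivrMr // mul1r -!natrX ler_nat.
  by apply: leq_trans (leq_pexp2l _ (leqW hd)); rewrite // leq_exp2r.
have [l [hl lmin linf]] := infinite_product_exists (nonzero_prime_ideals (ring_of_integers K)) F01.
exists l => // e he; rewrite shifted_eisenstein_setE.
have -> : box_ratio R (@shifted_eis_any (ring_of_integers K) d) e =
    box_mean e R (@shifted_eis_any (ring_of_integers K) d).
  by apply/funext => H; apply: box_ratioE.
apply: (density_shifted_eis_any he (@integers_domain K) (@integers_normal K) hd).
- move=> ps ups hps.
  pose S : {fset nonzero_prime_ideals (ring_of_integers K)} := [fset x in pmap insub ps]%fset.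
  suff <- : partial_prod F S = \prod_(p <- ps) F p by apply: lmin.
  rewrite /partial_prod -(big_map val xpredT F); apply: perm_big.
  apply: uniq_perm => //; first by rewrite map_inj_uniq ?fset_uniq //; apply: val_inj.
  move=> p; apply/mapP/idP => [[i]|pps].
    by rewrite inE /= mem_pmap_sub => h ->.
  have /is_primeP hp := hps p pps.
  by exists (SigSub hp) => //; rewrite inE /= mem_pmap_sub.
- move=> eps /linf [S hS]; exists [seq val i | i <- S]; split.
  + by rewrite map_inj_uniq ?fset_uniq //; apply: val_inj.
  + by move=> _ /mapP [i _ ->]; apply/is_primeP; apply: valP.
  + by rewrite big_map.
Qed.
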